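(* Every normalized Horn pair $(K,L)$ has an asymptotic realization. In particular, if $0<\delta<\frac12$ and $(K,L)$ is a normalized Horn pair with $$\Gamma(K,L)>1-2\delta,$$ then $$R_D(\delta)\le\Phi(K,L).$$
   Context: Horn pairs: a normalized Horn pair is a pair $K,L\in M_m(\mathbb C)$ (some $m\ge1$) with $K,L\succeq0$ and $\operatorname{tr}(K+L)=1$. Put $\operatorname{Ent}(A)=-\operatorname{tr}(A\log_2A)$ (with $0\log_20=0$) and $$\Gamma(K,L)=2\operatorname{tr}(K^{1/2}L^{1/2}),\qquad \Phi(K,L)=\operatorname{Ent}(K)+\operatorname{Ent}(L)-\operatorname{Ent}(K+L).$$ Delsarte exponent: $K_j^{(n)}(i)$ is defined by $\sum_{j=0}^n K_j^{(n)}(i)z^j=(1+z)^{n-i}(1-z)^i$. For an integer $d$, $\operatorname{LP}_n(d)$ is the maximum of $\sum_{i=0}^nA_i$ over real $A_0,\dots,A_n$ with $A_0=1$, $A_i\ge0$, $A_i=0$ for $1\le i<d$, and $\sum_{i=0}^nA_iK_j^{(n)}(i)\ge0$ for $0\le j\le n$. For $0<\delta<\frac12$, $R_D(\delta)=\limsup_{n\to\infty}\frac1n\log_2\operatorname{LP}_n(\lceil\delta n\rceil)$. Hecke algebra over Hamming space: let $\mathsf B_n=C_2^n\rtimes\mathfrak S_n$ and $X_n=\mathsf B_n/\mathfrak S_n\cong\{0,1\}^n$, with basepoint $o$ (the zero word) and $t_n(x,y)=1-\frac{2d_H(x,y)}n$, where $d_H$ is Hamming distance. For a finite-dimensional unitary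 $\mathfrak S_n$-module $E$, let $\mathcal I_E=\operatorname{Ind}_{\mathfrak S_n}^{\mathsf B_n}E$ be the space of functions $f:\mathsf B_n\to E$ with $f(gh)=h^{-1}f(g)$ for $h\in\mathfrak S_n$, viewed as sections over $X_n$ of the bundle $\mathsf B_n\times_{\mathfrak S_n}E$ with fibers $E_x$, with inner product the average over $X_n$ of fiber inner products and $\mathsf B_n$ acting by left translation. Put $\mathcal H_E=\operatorname{End}_{\mathsf B_n}(\mathcal I_E)$. Each $A\in\mathcal H_E$ has a unique kernel $K_A(x,y):E_y\to E_x$ with $(Af)(x)=\frac1{|X_n|}\sum_{y}K_A(x,y)f(y)$. Define $\mathsf S_{t_n}:\mathcal H_E\to\mathcal H_E$ by $K_{\mathsf S_{t_n}(A)}(x,y)=t_n(x,y)K_A(x,y)$. For $\Omega\subset\operatorname{Irr}(\mathsf B_n)$, let $z_\Omega$ be the central projection of $\mathcal I_E$ onto the isotypic components of types in $\Omega$, $\mathcal H_{E,\Omega}=z_\Omega\mathcal H_Ez_\Omega$, and $\Theta_\Omega(A)=z_\Omega\mathsf S_{t_n}(A)z_\Omega$ for $A\in\mathcal H_{E,\Omega}$. For $\rho\in\mathcal H_{E,\Omega}$ put $D_\rho=\dim\operatorname{ran}\rho$ and $r_\rho=\operatorname{rank}K_\rho(o,o)$. Asymptotic realization: an asymptotic realization of $(K,L)$ is a sequence $(E_n,\Omega_n,\rho_n,\Lambda_n)$, where $E_n$ is a finite-dimensional unitary $\mathfrak S_n$-module, $\Omega_n\subset\operatorname{Irr}(\mathsf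 B_n)$, $\Lambda_n\in\mathbb R$, and $0\ne\rho_n\succeq0$ in $\mathcal H_{E_n,\Omega_n}$ satisfies $\Theta_{\Omega_n}(\rho_n)\succeq\Lambda_n\rho_n$, such that $$\liminf_{n\to\infty}\Lambda_n\ge\Gamma(K,L),\qquad \limsup_{n\to\infty}\frac1n\log_2\frac{D_{\rho_n}}{r_{\rho_n}}\le\Phi(K,L).$$ *)

(* Defs.v *)
From HB Require Import structures.
From mathcomp Require Import all_boot all_order all_algebra all_fingroup.
From mathcomp Require Import mxrepresentation sesquilinear spectral.
From mathcomp Require Import all_classical all_reals all_analysis.
From mathcomp Require Import complex.

Set Implicit Arguments.
Unset Strict Implicit.
Unset Printing Implicit Defensive.

Import Order.TTheory GRing.Theory Num.Theory.
Import numFieldNormedType.Exports.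
Local Open Scope ring_scope.
Local Open Scope sesquilinear_scope.

Section Horn.
Variable R : realType.
Local Notation C := R[i].

Definition log2 (x : R) : R := ln x / ln 2.

Definition psdmx m (A : 'M[C]_m) : Prop :=
  A \is hermsymmx /\ forall v : 'rV[C]_m, 0 <= (v *m A *m v ^t*) 0 0.

(* Functional calculus: f is applied to the (real) eigenvalues of A. *)
Definition mxfun m (f : R -> R) (A : 'M[C]_m) : 'M[C]_m :=
  invmx (spectralmx A)
  *m diag_mx (map_mx (fun z : C => (f (complex.Re z))%:C%C) (spectral_diag A))
  *m spectralmx A.

Definition mxsqrt m (A : 'M[C]_m) : 'M[C]_m := mxfun Num.sqrt A.

(* 0 * log2 0 = 0, since ln 0 = 0 in the library. *)
Definition Ent m (A : 'M[C]_m) : R := - complex.Re (\tr (A *m mxfun log2 A)).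

Definition horn_pair m (K L : 'M[C]_m) : Prop :=
  [/\ psdmx K, psdmx L & \tr (K + L) = 1].

(* The trace of a product of two Hermitian matrices is real. *)
Definition Gam m (K L : 'M[C]_m) : R :=
  2 * complex.Re (\tr (mxsqrt K *m mxsqrt L)).

Definition Phi m (K L : 'M[C]_m) : R := Ent K + Ent L - Ent (K + L).

End Horn.

Section Delsarte.
Local Open Scope classical_set_scope.
Variable R : realType.

Definition krawtchouk (n j i : nat) : R :=
  ((1 + 'X) ^+ (n - i) * (1 - 'X) ^+ i : {poly R})`_j.

Definition LP_feasible (n : nat) (d : int) (A : 'I_n.+1 -> R) : Prop :=
  [/\ A ord0 = 1,
      forall i, 0 <= A i,
      forall i : 'I_n.+1, (1 <= i)%N -> i%:Z < d -> A i = 0 &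
      forall j : 'I_n.+1, 0 <= \sum_(i < n.+1) A i * krawtchouk n j i].

Definition LP_values (n : nat) (d : int) : set R :=
  [set s | exists2 A : 'I_n.+1 -> R, LP_feasible d A & s = \sum_i A i].

(* A maximum: see LP_attained and LP_ub. *)
Definition LP (n : nat) (d : int) : R := sup (LP_values n d).

Lemma krawtchouk_sum n i : (i <= n)%N ->
  \sum_(j < n.+1) krawtchouk n j i = (i == 0)%N%:R * 2 ^+ n.
Proof.
move=> i_n; set p := (1 + 'X) ^+ (n - i) * (1 - 'X) ^+ i : {poly R}.
have size_lin (q : {poly R}) k : (size q <= 2)%N -> (size (q ^+ k) <= k.+1)%N.
  move=> q2; apply: leq_trans (size_poly_exp_leq q k) _.
  by rewrite ltnS -[leqRHS]mul1n leq_mul2r; case: (size q) q2 => [|[|[]]] //; rewrite orbT.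
have sz1 : (size (1 + 'X : {poly R})%R <= 2)%N.
  by rewrite (leq_trans (size_polyD _ _)) // size_polyX size_poly1.
have sz2 : (size (1 - 'X : {poly R})%R <= 2)%N.
  by rewrite (leq_trans (size_polyD _ _)) // size_polyN size_polyX size_poly1.
have size_p : (size p <= n.+1)%N.
  apply: leq_trans (size_polyMleq _ _) _; rewrite -ltnS.
  have := leq_add (size_lin _ (n - i)%N sz1) (size_lin _ i sz2).
  rewrite addSn addnS subnK // => le2; case: (_ + _)%N le2 => //.
have := horner_coef_wide 1 size_p; under eq_bigr do rewrite expr1n mulr1.
move=> <-; rewrite /p !hornerE; case: i {size_p p} i_n => [|i] i_n.
  by rewrite subn0 expr0 mulr1 mul1r.
by rewrite subrr exprS mul0r mulr0 mul0r.
Qed.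

Lemma LP_feasible_le n d (A : 'I_n.+1 -> R) :
  LP_feasible d A -> \sum_i A i <= 2 ^+ n.
Proof.
case=> A0 _ _ AK.
have <- : \sum_(j < n.+1) \sum_(i < n.+1) A i * krawtchouk n j i = 2 ^+ n.
  rewrite exchange_big /= (bigD1 ord0) //= -mulr_sumr krawtchouk_sum //.
  rewrite A0 !mul1r big1 ?addr0 // => i i0.
  rewrite -mulr_sumr krawtchouk_sum -1?ltnS // -[_ == _]/(i == ord0).
  by rewrite (negPf i0) mul0r mulr0.
rewrite [X in _ <= X](bigD1 ord0) //= [X in _ <= X + _](eq_bigr A) => [|i _]; last first.
  by rewrite /krawtchouk /= -horner_coef0 !hornerE ?addr0 ?subr0 ?expr1n ?mulr1 /= !mulr1.
by rewrite lerDl sumr_ge0.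
Qed.

Lemma LP_values_neq0 n d : LP_values n d !=set0.
Proof.
pose A (i : 'I_n.+1) : R := (i == ord0)%:R.
exists (\sum_i A i), A => //; split=> [||i i0 _|j]; rewrite /A ?eqxx //.
  by case: i i0 => [[]].
rewrite (bigD1 ord0) //= big1 ?addr0 ?mul1r => [|i /negPf->]; last by rewrite mul0r.
rewrite /krawtchouk expr0 mulr1.
elim: (n - _)%N (j : nat) => [k|k IHk [|i]]; first by rewrite expr0 coef1 ler0n.
  by rewrite exprS mulrDl mul1r coefD coefXM addr0.
by rewrite exprS mulrDl mul1r coefD coefXM addr_ge0.
Qed.

Lemma LP_ub n d (A : 'I_n.+1 -> R) : LP_feasible d A -> \sum_i A i <= LP n d.
Proof.
move=> fA; apply: ub_le_sup; last by exists A.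
by exists (2 ^+ n) => _ [B fB ->]; exact: LP_feasible_le fB.
Qed.

Lemma LP_attained n d :
  exists2 A : 'I_n.+1 -> R, LP_feasible d A & LP n d = \sum_i A i.
Proof.
pose P := [set v : 'rV[R]_n.+1 | LP_feasible d (v ord0)].
have coordC i : continuous (fun v : 'rV[R]_n.+1 => v ord0 i).
  exact: coord_continuous.
have linC (c : 'I_n.+1 -> R) :
    continuous (fun v : 'rV[R]_n.+1 => \sum_i v ord0 i * c i).
  apply: continuous_big => [|i _ v]; first exact: add_continuous.
  by apply: (@continuousM R _ (fun v : 'rV[R]_n.+1 => v ord0 i) (fun=> c i));
    [exact: coordC|exact: cst_continuous].
have P0 : P !=set0.
  have [_ [A fA _]] := LP_values_neq0 n d.
  exists (\row_i A i); rewrite /P /=.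
  by have -> : (\row_i A i) ord0 = A by apply/funext => i; rewrite mxE.
have Pclosed : closed P.
  rewrite (_ : P = [set v : 'rV[R]_n.+1 | v ord0 ord0 = 1]
    `&` \bigcap_(i in [set: 'I_n.+1]) [set v : 'rV[R]_n.+1 | 0 <= v ord0 i]
    `&` \bigcap_(i in [set i : 'I_n.+1 | (1 <= i)%N /\ i%:Z < d])
          [set v : 'rV[R]_n.+1 | v ord0 i = 0]
    `&` \bigcap_(j in [set: 'I_n.+1])
          [set v : 'rV[R]_n.+1 | 0 <= \sum_i v ord0 i * krawtchouk n j i]).
    have pre (f : 'rV[R]_n.+1 -> R) (D : set R) :
      continuous f -> closed D -> closed (f @^-1` D).
      by move=> cf cD; apply: preimage_closed => // x _; exact: cf.
    apply: closedI; [apply: closedI; [apply: closedI|]|].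
    - exact: (pre _ _ (coordC _) (@closed_eq R 1)).
    - by apply: closed_bigI => i _; exact: (pre _ _ (coordC _) (@closed_ge R 0)).
    - by apply: closed_bigI => i _; exact: (pre _ _ (coordC _) (@closed_eq R 0)).
    - by apply: closed_bigI => j _; exact: (pre _ _ (linC _) (@closed_ge R 0)).
  apply/seteqP; split=> v /=.
    move=> [v1 v0 vd vK]; split; first split; first split=> //.
    - by move=> i _; exact: v0.
    - by move=> i [i1 id]; exact: vd.
    - by move=> j _; exact: vK.
  move=> [[[v1 v0] vd] vK]; split=> // [i|i i1 id|j].
  - exact: v0.
  - by apply: vd.
  - exact: vK.
have Pcompact : compact P.
  apply: (subclosed_compact Pclosed
    (@rV_compact R n.+1 (fun=> `[0, 2 ^+ n]%classic) _)) => [i|v fv i /=].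
    exact: segment_compact.
  have [_ v0 _ _] := fv; rewrite in_itv /= v0 /=.
  apply: le_trans (LP_feasible_le fv).
  by rewrite (bigD1 i) //= lerDl sumr_ge0.
have sumC : {within P, continuous (fun v : 'rV[R]_n.+1 => \sum_i v ord0 i)}.
  apply: continuous_subspaceT.
  by apply: continuous_big => [|i _ v]; [exact: add_continuous|exact: coordC].
have [v] := compact_EVT_max P0 Pcompact sumC; rewrite inE => fv vmax.
exists (v ord0) => //; apply/le_anti; rewrite LP_ub // andbT.
apply: ge_sup; first exact: LP_values_neq0.
move=> _ [A fA ->]; have := vmax (\row_i A i); rewrite inE /P /=.
have -> : (\row_i A i) ord0 = A by apply/funext => i; rewrite mxE.
exact.
Qed.

Definition R_D (delta : R) : \bar R :=
  limn_esup (fun n : nat => (log2 (LP n (Num.ceil (delta * n%:R))) / n%:R)%:E).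

End Delsarte.

Section Hyperoctahedral.
Variable n : nat.
Local Open Scope group_scope.

(* MathComp permutations compose from left to right and sdprod_by expects a
   right action; sigma then acts on words from the left by
   (sigma . x) i = x (sigma i), see bn_mulE. *)
Definition permword (x : 'rV['F_2]_n) (s : 'S_n) : 'rV['F_2]_n :=
  \row_i x ord0 (s^-1 i).

Fact permword_is_action : is_action [set: 'S_n] permword.
Proof.
split=> [s x y /rowP E|x s t _ _].
  by apply/rowP=> i; have := E (s i); rewrite !mxE permK.
by apply/rowP=> i; rewrite !mxE invMg permM.
Qed.

Definition permword_action := Action permword_is_action.

Fact permword_is_groupAction :
  is_groupAction [set: 'rV['F_2]_n] permword_action.
Proof.
move=> s _; rewrite inE; apply/andP; split.
  by apply/fintype.subsetP=> x _; rewrite inE.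
by apply/morphicP=> x y _ _; rewrite !actpermE; apply/rowP=> i; rewrite !mxE.
Qed.

Definition permword_groupAction := GroupAction permword_is_groupAction.

Definition Bn : finGroupType := sdprod_by permword_groupAction.

Definition bn_word (x : 'rV['F_2]_n) : Bn := sdpair1 permword_groupAction x.
Definition bn_perm (s : 'S_n) : Bn := sdpair2 permword_groupAction s.

(* Every g : Bn is uniquely bn_word x * bn_perm s; its coset g S_n, a point
   of X_n = Bn / S_n, is identified with the word x = word_of g. *)
Definition perm_of (g : Bn) : 'S_n := (val g).1.
Definition word_of (g : Bn) : 'rV['F_2]_n := permword (val g).2 (perm_of g)^-1.

Lemma bn_wordE x : val (bn_word x) = (1, x).
Proof. by rewrite val_insubd !inE. Qed.

Lemma bn_permE s : val (bn_perm s) = (s, 1).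
Proof. by rewrite val_insubd !inE. Qed.

Lemma bn_valM (g h : Bn) :
  val (g * h) = ((val g).1 * (val h).1,
                 (permword (val g).2 (val h).1 + (val h).2)%R).
Proof. by []. Qed.

Lemma bn_decomp (g : Bn) : g = bn_word (word_of g) * bn_perm (perm_of g).
Proof.
apply: val_inj; rewrite bn_valM bn_wordE bn_permE /= mul1g /word_of /perm_of.
case: g => -[s x] _ /=; congr (_, _).
by apply/rowP=> i; rewrite !mxE invgK permKV addr0.
Qed.

Lemma bn_mulE (x y : 'rV['F_2]_n) (s t : 'S_n) :
  (bn_word x * bn_perm s) * (bn_word y * bn_perm t)
  = bn_word (x + \row_i y ord0 (s i))%R * bn_perm (s * t).
Proof.
apply: val_inj; rewrite !(bn_valM, bn_wordE, bn_permE) /= !mul1g.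
congr (_, _); apply/rowP=> i.
by rewrite !mxE !invMg !permM !permKV !addr0.
Qed.

Lemma perm_of_mulr (g : Bn) (s : 'S_n) : perm_of (g * bn_perm s) = perm_of g * s.
Proof. by rewrite /perm_of bn_valM bn_permE. Qed.

Lemma word_of_mulr (g : Bn) (s : 'S_n) : word_of (g * bn_perm s) = word_of g.
Proof.
rewrite /word_of /perm_of bn_valM bn_permE /=.
by apply/rowP=> i; rewrite !mxE !invgK permM permK addr0.
Qed.

Lemma word_ofK (x : 'rV['F_2]_n) : word_of (bn_word x) = x.
Proof.
rewrite /word_of /perm_of bn_wordE /=.
by apply/rowP=> i; rewrite !mxE invgK perm1.
Qed.

Lemma perm_of_word (x : 'rV['F_2]_n) : perm_of (bn_word x) = 1.
Proof. by rewrite /perm_of bn_wordE. Qed.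

End Hyperoctahedral.

(* A representation by unitary matrices; matrices act on column vectors, so
   that this is a left module, with the standard inner product. *)
Record unitary_module (C : numClosedFieldType) (n : nat) := UnitaryModule {
  um_dim : nat;
  um_repr :> mx_representation C [set: 'S_n] um_dim;
  um_unitary : forall s, um_repr s \is unitarymx
}.

Section Hecke.
Variables (C : numClosedFieldType) (n : nat) (E : unitary_module C n).
Local Notation G := (Bn n).
Local Notation X := ('rV['F_2]_n).
Local Notation e := (um_dim E).

Definition equivariance_defect (h : 'S_n) (f : {ffun G -> 'cV[C]_e}) :
  {ffun G -> 'cV[C]_e} := [ffun g => f (g * bn_perm h)%g - E h^-1%g *m f g].

Fact equivariance_defect_is_linear h : linear (equivariance_defect h).
Proof.
move=> a f1 f2; apply/ffunP=> g; rewrite !ffunE mulmxDr -scalemxAr.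
by rewrite scalerBr opprD addrACA.
Qed.
HB.instance Definition _ h :=
  GRing.isLinear.Build C {ffun G -> 'cV[C]_e} {ffun G -> 'cV[C]_e} _ _
    (equivariance_defect_is_linear h).

Definition ind_space : {vspace {ffun G -> 'cV[C]_e}} :=
  (\bigcap_(h : 'S_n) lker (linfun (equivariance_defect h)))%VS.

Lemma ind_spaceP (f : {ffun G -> 'cV[C]_e}) :
  reflect (forall g h, f (g * bn_perm h)%g = E h^-1%g *m f g)
          (f \in ind_space).
Proof.
rewrite memvE; apply: (iffP subv_bigcapP) => [If g h | If h _].
  have := If h isT; rewrite -memvE memv_ker lfunE /= => /eqP/ffunP/(_ g).
  by rewrite !ffunE => /eqP; rewrite subr_eq0 => /eqP.
rewrite -memvE memv_ker lfunE /=; apply/eqP/ffunP=> g.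
by rewrite !ffunE If subrr.
Qed.

Definition Ind : vectType C := subvs_of ind_space.

(* The bundle Bn x_(S_n) E is trivialised by the representatives bn_word x of
   the points of X_n: the fibre E_x is E via v |-> [bn_word x, v], and the
   value at x of the section attached to f : Ind is f (bn_word x). *)
Definition value_at (f : Ind) (x : X) : 'cV[C]_e := vsval f (bn_word x).

Definition section_fun (phi : X -> 'cV[C]_e) : {ffun G -> 'cV[C]_e} :=
  [ffun g => E (perm_of g)^-1%g *m phi (word_of g)].

Definition section_of (phi : X -> 'cV[C]_e) : Ind :=
  vsproj ind_space (section_fun phi).

Lemma section_fun_ind phi : section_fun phi \in ind_space.
Proof.
apply/ind_spaceP => g h; rewrite !ffunE perm_of_mulr word_of_mulr.
by rewrite invMg repr_mxM ?inE // mulmxA.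
Qed.

Lemma section_ofK phi x : value_at (section_of phi) x = phi x.
Proof.
rewrite /value_at /section_of vsprojK ?section_fun_ind // ffunE.
by rewrite perm_of_word word_ofK invg1 repr_mx1 mul1mx.
Qed.

Lemma value_atK f : section_of (value_at f) = f.
Proof.
apply: val_inj; rewrite /= vsprojK ?section_fun_ind //.
apply/ffunP=> g; rewrite ffunE /value_at.
have /ind_spaceP If := subvsP f.
by rewrite [in RHS](bn_decomp g) If.
Qed.

Lemma value_at_inj f f' : value_at f =1 value_at f' -> f = f'.
Proof.
by move=> eqf; rewrite -[f]value_atK -[f']value_atK; congr section_of; apply/funext.
Qed.

Lemma value_at_linear a f1 f2 x :
  value_at (a *: f1 + f2) x = a *: value_at f1 x + value_at f2 x.
Proof. by rewrite /value_at /= !ffunE. Qed.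

Definition dotInd (f f' : Ind) : C :=
  (#|{: X}|%:R)^-1 * \sum_(x : X) ((value_at f x) ^t* *m value_at f' x) 0 0.

(* Over C, a linear map with nonnegative quadratic form is self-adjoint. *)
Definition psd_op (A : 'End(Ind)) : Prop := forall f, 0 <= dotInd f (A f).

Definition transl_fun (b : G) (f : {ffun G -> 'cV[C]_e}) :
  {ffun G -> 'cV[C]_e} := [ffun g => f (b^-1 * g)%g].

Definition transl (b : G) (f : Ind) : Ind :=
  vsproj ind_space (transl_fun b (vsval f)).

Lemma translE b f g : vsval (transl b f) g = vsval f (b^-1 * g)%g.
Proof.
rewrite vsprojK ?ffunE //; apply/ind_spaceP=> g' h; rewrite !ffunE mulgA.
by have /ind_spaceP -> := subvsP f.
Qed.

Fact transl_is_linear b : linear (transl b).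
Proof.
move=> a f1 f2; apply: val_inj; apply/ffunP=> g.
by rewrite [LHS]translE /= ![in RHS]ffunE !ffunE !translE.
Qed.
HB.instance Definition _ b :=
  GRing.isLinear.Build C Ind Ind _ _ (transl_is_linear b).

Definition hecke (A : 'End(Ind)) : Prop :=
  forall b f, A (transl b f) = transl b (A f).

(* Kernels, written in the trivialisation above as matrices in 'M_e. *)
Definition of_kernel_fun (k : X -> X -> 'M[C]_e) (f : Ind) : Ind :=
  section_of (fun x =>
    (#|{: X}|%:R)^-1 *: \sum_(y : X) k x y *m value_at f y).

Fact of_kernel_fun_is_linear k : linear (of_kernel_fun k).
Proof.
move=> a f1 f2; apply: value_at_inj => x.
rewrite value_at_linear !section_ofK scalerA mulrC -scalerA -scalerDr.
congr (_ *: _); rewrite scaler_sumr -big_split /=; apply: eq_bigr => y _.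
by rewrite value_at_linear mulmxDr -scalemxAr.
Qed.
HB.instance Definition _ k :=
  GRing.isLinear.Build C Ind Ind _ _ (of_kernel_fun_is_linear k).

Definition of_kernel (k : X -> X -> 'M[C]_e) : 'End(Ind) :=
  linfun (of_kernel_fun k).

(* Column j of K_A(x, y) is |X_n| times the value at x of the image under A
   of the section equal to the j-th basis vector at y and to 0 elsewhere. *)
Definition kernel_of (A : 'End(Ind)) (x y : X) : 'M[C]_e :=
  #|{: X}|%:R *:
  \matrix_(i, j) value_at (A (section_of (fun z =>
     if z == y then delta_mx j ord0 else 0))) x i ord0.


Lemma of_kernelE k f x : value_at (of_kernel k f) x =
  (#|{: X}|%:R)^-1 *: \sum_(y : X) k x y *m value_at f y.
Proof. by rewrite /of_kernel lfunE /= section_ofK. Qed.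

Lemma value_atZ a f x : value_at (a *: f) x = a *: value_at f x.
Proof. by rewrite /value_at /= ffunE. Qed.

Lemma value_at_sum I (r : seq I) (F : I -> Ind) x :
  value_at (\sum_(i <- r) F i) x = \sum_(i <- r) value_at (F i) x.
Proof.
apply: (big_morph (value_at^~ x)) => [f f'|]; by rewrite /value_at /= ffunE.
Qed.

Lemma card_words_neq0 : #|{: X}|%:R != 0 :> C.
Proof. by rewrite pnatr_eq0 -lt0n; apply/card_gt0P; exists 0. Qed.

Lemma kernel_ofK A : of_kernel (kernel_of A) = A.
Proof.
apply/lfunP=> f; apply: value_at_inj => x; rewrite of_kernelE.
pose d y j := section_of (fun z => if z == y then delta_mx j ord0 else 0).
have fE : f = \sum_(y : X) \sum_(j < e) value_at f y j ord0 *: d y j.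
  apply: value_at_inj => z; rewrite value_at_sum (bigD1 z) //=.
  rewrite [X in _ + X]big1 ?addr0 => [|y yz]; last first.
    rewrite value_at_sum big1 // => j _.
    by rewrite value_atZ section_ofK eq_sym (negPf yz) scaler0.
  rewrite value_at_sum [LHS]matrix_sum_delta; apply: eq_bigr => j _.
  by rewrite big_ord1 value_atZ section_ofK eqxx.
rewrite [in RHS]fE [in RHS]linear_sum. rewrite (value_at_sum _ (fun y => A (\sum_(j < e) value_at f y j ord0 *: d y j))) scaler_sumr; apply: eq_bigr => y _.
rewrite -scalemxAl scalerA mulVf ?card_words_neq0 // scale1r.
rewrite linear_sum value_at_sum; apply/colP=> i; rewrite mxE summxE.
by apply: eq_bigr => j _; rewrite mxE linearZ /= value_atZ mxE mulrC.
Qed.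

Lemma of_kernelK k x y : kernel_of (of_kernel k) x y = k x y.
Proof.
apply/matrixP=> i j; rewrite !mxE of_kernelE mxE mulrA mulfV ?card_words_neq0 //.
rewrite mul1r (bigD1 y) //= section_ofK eqxx big1 => [|z zy]; last first.
  by rewrite section_ofK (negPf zy) mulmx0.
by rewrite addr0 -colE mxE.
Qed.

Definition hamming (x y : X) : nat := #|[set i | x ord0 i != y ord0 i]%SET|.

Definition t_zonal (x y : X) : C := 1 - (2 * hamming x y)%:R / n%:R.

Definition schur_t (A : 'End(Ind)) : 'End(Ind) :=
  of_kernel (fun x y => t_zonal x y *: kernel_of A x y).

(* Irr(Bn), enumerated by the isotypic components of the regular
   representation; irr_repr W is the irreducible representation indexed by W,
   again acting on column vectors. *)
Definition IrrB : irrType C [set: G]%G :=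
  DecSocleType (regular_repr C [set: G]%G).

Section Isotypic.
Variable W : IrrB.
Local Notation V := 'cV[C]_(irr_degree W).

Definition irr_act (g : G) (v : V) : V := irr_repr W g *m v.
HB.instance Definition _ g := GRing.Linear.copy (irr_act g) (mulmx (irr_repr W g)).

Definition intertwining_defect (g : G) (phi : 'Hom(V, Ind)) : 'Hom(V, Ind) :=
  ((linfun (transl g) \o phi) - (phi \o linfun (irr_act g)))%VF.

Fact intertwining_defect_is_linear g : linear (intertwining_defect g).
Proof.
move=> a f1 f2; apply/lfunP=> v.
do ![rewrite lfunE /=].
rewrite linearP scalerBr opprD addrACA //.
Qed.
HB.instance Definition _ g :=
  GRing.isLinear.Build C 'Hom(V, Ind) 'Hom(V, Ind) _ _
    (intertwining_defect_is_linear g).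

Definition intertwiners : {vspace 'Hom(V, Ind)} :=
  (\bigcap_(g : G) lker (linfun (intertwining_defect g)))%VS.

Lemma intertwinersP (phi : 'Hom(V, Ind)) :
  reflect (forall g v, phi (irr_repr W g *m v) = transl g (phi v))
          (phi \in intertwiners).
Proof.
rewrite memvE; apply: (iffP subv_bigcapP) => [If g v | If g _].
  have := If g isT; rewrite -memvE memv_ker lfunE /= => /eqP/lfunP/(_ v).
  by do ![rewrite lfunE /=] => /eqP; rewrite subr_eq0 => /eqP ->.
rewrite -memvE memv_ker lfunE /=; apply/eqP/lfunP=> v.
by do ![rewrite lfunE /=]; rewrite /irr_act If subrr.
Qed.

(* The sum of the images of all intertwiners W -> Ind. *)
Definition isotypic : {vspace Ind} :=
  (\sum_(i < \dim intertwiners) limg (vbasis intertwiners)`_i)%VS.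

Lemma isotypic_sub (U : {vspace Ind}) :
  reflect (forall phi, phi \in intertwiners -> (limg phi <= U)%VS)
          (isotypic <= U)%VS.
Proof.
apply: (iffP subv_sumP) => [sU phi phiI | sU i _]; last first.
  by apply: sU; apply: vbasis_mem; apply: mem_nth; rewrite size_tuple.
rewrite (coord_vbasis phiI); apply/subvP=> _ /memv_imgP[v _ ->].
rewrite sum_lfunE; apply: memv_suml => i _; rewrite scale_lfunE memvZ //.
by apply: (subvP (sU i isT)); rewrite memv_img ?memvf.
Qed.

End Isotypic.

(* Projection onto the isotypic components of types in Omega, along those of
   the other types. *)
Definition z_proj (Omega : {set IrrB}) : 'End(Ind) :=
  daddv_pi (\sum_(W in Omega) isotypic W)%VS
           (\sum_(W in ~: Omega) isotypic W)%VS.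

Definition hecke_cut (Omega : {set IrrB}) (rho : 'End(Ind)) : Prop :=
  exists2 A, hecke A & rho = (z_proj Omega \o A \o z_proj Omega)%VF.

Definition Theta (Omega : {set IrrB}) (A : 'End(Ind)) : 'End(Ind) :=
  (z_proj Omega \o schur_t A \o z_proj Omega)%VF.

Definition D_rank (rho : 'End(Ind)) : nat := \dim (limg rho).
Definition r_rank (rho : 'End(Ind)) : nat := \rank (kernel_of rho 0 0).

End Hecke.

(* The condition at n = 0, where t_n is undefined, is dropped. *)
Definition asymptotic_realization (R : realType) (m : nat) (K L : 'M[R[i]]_m)
    (E : forall n, unitary_module R[i] n) (Omega : forall n, {set IrrB R[i] n})
    (rho : forall n, 'End(Ind (E n))) (Lam : nat -> R) : Prop :=
  [/\ forall n, (0 < n)%N ->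
        [/\ rho n != 0, psd_op (rho n), hecke_cut (Omega n) (rho n) &
            psd_op (Theta (Omega n) (rho n) - (Lam n)%:C%C *: rho n)],
      ((Gam K L)%:E <= limn_einf (fun n => (Lam n)%:E))%E &
      (limn_esup (fun n =>
         (log2 ((D_rank (rho n))%:R / (r_rank (rho n))%:R) / n%:R)%:E)
       <= (Phi K L)%:E)%E].

(* Main.v *)
Require Import Defs.
From HB Require Import structures.
From mathcomp Require Import all_boot all_order all_algebra all_fingroup.
From mathcomp Require Import mxrepresentation sesquilinear spectral.
From mathcomp Require Import all_classical all_reals all_analysis.
From mathcomp Require Import complex.
From mathcomp Require Import ring lra.

Set Implicit Arguments.
Unset Strict Implicit.
Unset Printing Implicit Defensive.

Import Order.TTheory GRing.Theory Num.Theory.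
Local Open Scope ring_scope.

(* Take E = (C^m)^(tensor n).  The Fourier transform over C_2^n turns elements of the
   Hecke algebra into S_n-invariant matrices, block diagonal along the dual points of
   {0,1}^n, and turns the multiplication by t_n into (1/n) times the sum of the n
   conjugations by bit flips; the kernel at (o, o) becomes the partial trace over the
   dual points.  The n-th tensor power sigma of K^(1/2) (+) L^(1/2) has Hilbert-Schmidt
   norm 1 and Rayleigh quotient exactly Gamma(K, L) for the normalized flip sum, while
   sigma^2 has entropy n (Ent K + Ent L) and partial trace (K + L)^(tensor n).

   The typical subspace of sigma^2 has dimension about 2^(n (Ent K + Ent L)).  The
   algebra of invariant matrices has dimension polynomial in n, so that subspace is
   contained in the range of a projection Q commuting with the whole algebra, of
   essentially the same rank.  Compressing sigma by Q, a Perron-Frobenius argument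
   yields a positive semidefinite P supported in Q whose compressed flip sum is at least
   n Lambda P; since Q is central, the flip sum of P has no cross terms between Q and
   1 - Q, and the inequality holds without the compression.  As long
   as the partial trace of P has rank well below 2^(n Ent(K + L)), its range carries
   little of the mass of sigma, and the argument can be repeated in its complement;
   adding up the matrices so obtained, the partial trace reaches that rank.  All errors
   are O(n^(-1/4)), and all types of B_n can be allowed in Omega.

   For the Delsarte exponent, let Y be P conjugated by the inverse square root of its
   partial trace.  The function v |-> tr (Y F_v Y F_v), where F_v flips the bits of v,
   is a dual certificate for the linear program. *)

(** * Positive semidefinite matrices *)

Section MatrixToolkit.
Local Open Scope sesquilinear_scope.
Variable C : numClosedFieldType.

Lemma adjM m n p (A : 'M[C]_(m, n)) (B : 'M[C]_(n, p)) :
  (A *m B)^t* = B^t* *m A^t*.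
Proof. by rewrite trmx_mul map_mxM. Qed.

Lemma adjD m n (A B : 'M[C]_(m, n)) : (A + B)^t* = A^t* + B^t*.
Proof. by rewrite linearD map_mxD. Qed.

Lemma adjN m n (A : 'M[C]_(m, n)) : (- A)^t* = - A^t*.
Proof. by rewrite linearN map_mxN. Qed.

Lemma adjZ m n a (A : 'M[C]_(m, n)) : (a *: A)^t* = a^* *: A^t*.
Proof. by rewrite linearZ map_mxZ. Qed.

Lemma adj0 m n : (0 : 'M[C]_(m, n))^t* = 0.
Proof. by rewrite linear0 map_mx0. Qed.

Lemma adj1 n : (1%:M : 'M[C]_n)^t* = 1%:M.
Proof. by rewrite trmx1 map_mx1. Qed.

Lemma adj_sum m n I (r : seq I) (P : pred I) (F : I -> 'M[C]_(m, n)) :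
  (\sum_(i <- r | P i) F i)^t* = \sum_(i <- r | P i) (F i)^t*.
Proof.
by apply: (big_morph (fun A : 'M[C]_(m, n) => A^t*)); [exact: adjD|exact: adj0].
Qed.

Lemma trace_adj n (A : 'M[C]_n) : \tr (A^t*) = (\tr A)^*.
Proof. by rewrite trace_map_mx mxtrace_tr. Qed.

(** The squared Hilbert-Schmidt norm. *)
Definition sqn m n (A : 'M[C]_(m, n)) : C := \tr (A *m A^t*).

Lemma sqnE m n (A : 'M[C]_(m, n)) : sqn A = \sum_i \sum_j `|A i j| ^+ 2.
Proof.
apply: eq_bigr => i _; rewrite mxE; apply: eq_bigr => j _.
by rewrite !mxE normCK.
Qed.

Lemma sqn_ge0 m n (A : 'M[C]_(m, n)) : 0 <= sqn A.
Proof. by rewrite sqnE; do 2![apply: sumr_ge0 => ? _]; rewrite exprn_ge0. Qed.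

Lemma sqn_eq0 m n (A : 'M[C]_(m, n)) : sqn A = 0 -> A = 0.
Proof.
rewrite sqnE => /psumr_eq0P A0; apply/matrixP => i j; rewrite mxE.
have /psumr_eq0P := A0 (fun i _ => sumr_ge0 _ (fun j _ => exprn_ge0 2 (normr_ge0 _))) i isT.
move=> /(_ (fun j _ => exprn_ge0 2 (normr_ge0 _)) j isT)/eqP.
by rewrite sqrf_eq0 normr_eq0 => /eqP.
Qed.

Lemma sqn_gt0 m n (A : 'M[C]_(m, n)) : A != 0 -> 0 < sqn A.
Proof.
rewrite lt_def sqn_ge0 andbT; apply: contra_neq; exact: sqn_eq0.
Qed.

Definition herm n (A : 'M[C]_n) := A^t* = A.

Definition psd n (A : 'M[C]_n) := forall v : 'rV[C]_n, 0 <= (v *m A *m v^t*) 0 0.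

Lemma psd0 n : psd (0 : 'M[C]_n).
Proof. by move=> v; rewrite mulmx0 mul0mx mxE. Qed.

Lemma psdD n (A B : 'M[C]_n) : psd A -> psd B -> psd (A + B).
Proof. by move=> pA pB v; rewrite mulmxDr mulmxDl mxE addr_ge0. Qed.

Lemma psdZ n a (A : 'M[C]_n) : 0 <= a -> psd A -> psd (a *: A).
Proof. by move=> a0 pA v; rewrite -scalemxAr -scalemxAl mxE mulr_ge0. Qed.

Lemma psd_sum n I (r : seq I) (P : pred I) (F : I -> 'M[C]_n) :
  (forall i, P i -> psd (F i)) -> psd (\sum_(i <- r | P i) F i).
Proof. by move=> pF; elim/big_ind: _ => //; [exact: psd0|exact: psdD]. Qed.

Lemma psd_conj m n (B : 'M[C]_(m, n)) (A : 'M[C]_n) :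
  psd A -> psd (B *m A *m B^t*).
Proof. by move=> pA v; have := pA (v *m B); rewrite adjM !mulmxA. Qed.

Lemma psd_sqr m n (A : 'M[C]_(m, n)) : psd (A *m A^t*).
Proof.
move=> v; rewrite mulmxA -mulmxA -adjM.
by have := sqn_ge0 (v *m A); rewrite /sqn trace_mx11.
Qed.

Lemma psd1 n : psd (1%:M : 'M[C]_n).
Proof. by rewrite -[1%:M]mulmx1 -[X in _ *m X]adj1; exact: psd_sqr. Qed.

Lemma mxE_delta n (A : 'M[C]_n) i j :
  A i j = ((delta_mx 0 i : 'rV[C]_n) *m A *m (delta_mx 0 j : 'rV[C]_n)^t*) 0 0.
Proof.
have -> : (delta_mx 0 j : 'rV[C]_n)^t* = delta_mx j 0.
  by rewrite trmx_delta map_delta_mx.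
by rewrite -rowE -colE !mxE.
Qed.

(* Polarization. *)
Lemma psd_herm n (A : 'M[C]_n) : psd A -> herm A.
Proof.
move=> pA; apply/matrixP => i j; rewrite !mxE.
set x : 'rV[C]_n := delta_mx 0 i; set y : 'rV[C]_n := delta_mx 0 j.
pose q (u v : 'rV[C]_n) := (u *m A *m v^t*) 0 0.
have qE c : q (x + c *: y) (x + c *: y)
    = q x x + c^* * A i j + c * A j i + c * c^* * q y y.
  rewrite (mxE_delta A i j) (mxE_delta A j i) -/x -/y /q adjD adjZ !mulmxDl !mulmxDr.
  rewrite -!scalemxAl -!scalemxAr !mxE; ring.
have real c : c^* * A i j + c * A j i \is Num.real.
  have -> : c^* * A i j + c * A j i =
    q (x + c *: y) (x + c *: y) - q x x - c * c^* * q y y by rewrite qE; ring.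
  have qr u : q u u \is Num.real by apply: ger0_real; exact: pA.
  by rewrite !rpredB // rpredM // ger0_real // mul_conjC_ge0.
have /CrealP r1 := real 1; have /CrealP ri := real 'i.
move: r1 ri; set a := A i j; set b := A j i.
rewrite conjC1 conjCi !mul1r !(rmorphD, rmorphM, rmorphN) /= conjCi => r1 ri.
have e1 : 'i * (a^* - b^*) = 'i * (b - a).
  by apply: etrans (etrans _ ri) _; ring.
have := mulfI (neq0Ci C) e1 => e2.
have : 2%:R * b^* = 2%:R * a.
  have -> : 2%:R * b^* = (a^* + b^*) - (a^* - b^*) by ring.
  by rewrite r1 e2; ring.
by move/(mulfI _); apply; rewrite pnatr_eq0.
Qed.

Lemma herm_spec n (A : 'M[C]_n) (U := spectralmx A) (d := spectral_diag A) :
  herm A -> [/\ U *m U^t* = 1%:M, U^t* *m U = 1%:M,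
                forall i, d 0 i \is Num.real & A = U^t* *m diag_mx d *m U].
Proof.
move=> hA; have hA' : A \is hermsymmx.
  by apply/is_hermitianmxP; rewrite scale1r hA.
have Uu : U \is unitarymx := spectral_unitarymx A.
split; first exact/unitarymxP.
- by have := Uu; rewrite -trmxC_unitary => /unitarymxP; rewrite trmxCK.
- move=> i; have /mxOverP := hermitian_spectral_diag_real hA'; exact.
- have /orthomx_spectralP := hermitian_normalmx hA'.
  by rewrite -/U -/d invmx_unitary.
Qed.

Lemma diag_form n (U : 'M[C]_n) (d : 'rV[C]_n) (v : 'rV[C]_n) :
  (v *m (U^t* *m diag_mx d *m U) *m v^t*) 0 0
  = \sum_i d 0 i * `|(v *m U^t*) 0 i| ^+ 2.
Proof.
rewrite !mulmxA -[_ *m U *m _]mulmxA -[U in U *m v^t*]trmxCK -adjM !mxE.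
apply: eq_bigr => i _; rewrite mul_mx_diag !mxE.
by rewrite normCK mulrA [d 0 i * _]mulrC.
Qed.

Lemma psd_diag n (U : 'M[C]_n) (d : 'rV[C]_n) :
  (forall i, 0 <= d 0 i) -> psd (U^t* *m diag_mx d *m U).
Proof.
move=> d0 v; rewrite diag_form; apply: sumr_ge0 => i _.
by rewrite mulr_ge0 ?exprn_ge0.
Qed.

Lemma tr_diag_mul n (U B : 'M[C]_n) (d : 'rV[C]_n) :
  \tr (U^t* *m diag_mx d *m U *m B) = \sum_i d 0 i * (U *m B *m U^t*) i i.
Proof.
rewrite -!mulmxA mxtrace_mulC -!mulmxA; apply: eq_bigr => i _.
by rewrite mul_diag_mx mxE !mulmxA.
Qed.

Lemma psd_diag_entry m n (B : 'M[C]_n) (U : 'M[C]_(m, n)) i :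
  psd B -> 0 <= (U *m B *m U^t*) i i.
Proof. by move=> pB; rewrite mxE_delta; exact: psd_conj. Qed.

Lemma psd_spec_ge0 n (A : 'M[C]_n) i : psd A -> 0 <= spectral_diag A 0 i.
Proof.
move=> pA; have [UU _ _ AE] := herm_spec (psd_herm pA).
have := psd_diag_entry (spectralmx A) i pA; rewrite {2}AE !mulmxA UU mul1mx.
by rewrite -mulmxA UU mulmx1 mxE eqxx mulr1n.
Qed.

(** In an eigenbasis of [A] the trace is a sum of products of eigenvalues of [A] with diagonal
    entries of [B], all nonnegative. *)
Lemma psd_tr_mul n (A B : 'M[C]_n) : psd A -> psd B -> 0 <= \tr (A *m B).
Proof.
move=> pA pB; have [UU _ _ ->] := herm_spec (psd_herm pA).
rewrite tr_diag_mul; apply: sumr_ge0 => i _.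
by rewrite mulr_ge0 ?psd_spec_ge0 ?psd_diag_entry.
Qed.

Lemma psd_tr_eq0 n (A : 'M[C]_n) : psd A -> \tr A = 0 -> A = 0.
Proof.
move=> pA; have [UU _ _ AE] := herm_spec (psd_herm pA).
have -> : \tr A = \sum_i spectral_diag A 0 i.
  rewrite {1}AE -[X in \tr X]mulmx1 tr_diag_mul; apply: eq_bigr => i _.
  by rewrite mulmx1 UU mxE eqxx mulr1.
move/psumr_eq0P => /(_ (fun i _ => psd_spec_ge0 i pA)) d0.
rewrite AE (_ : spectral_diag A = 0) ?linear0 ?mulmx0 ?mul0mx //.
by apply/rowP => i; rewrite d0 // mxE.
Qed.

End MatrixToolkit.

(** * Perron-Frobenius theory for completely positive maps *)

Section PerronFrobenius.
Local Open Scope sesquilinear_scope.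
Variable C : numClosedFieldType.

(** A completely positive map in Kraus form. The right factor carries no adjoint because the
    operators [G i] are taken Hermitian below, which makes the map self-adjoint for the trace
    form. *)
Definition kraus n (I : finType) (G : I -> 'M[C]_n) (X : 'M[C]_n) : 'M[C]_n :=
  \sum_i G i *m X *m G i.

Fact kraus_is_linear n I G : linear (@kraus n I G).
Proof.
move=> a X Y; rewrite /kraus scaler_sumr -big_split; apply: eq_bigr => i _ /=.
by rewrite mulmxDr mulmxDl -scalemxAr -scalemxAl.
Qed.
HB.instance Definition _ n I G :=
  GRing.isLinear.Build C 'M[C]_n 'M[C]_n _ (@kraus n I G) (@kraus_is_linear n I G).

Lemma mxvec_dot n (X Y : 'M[C]_n) : (mxvec X *m (mxvec Y)^t*) 0 0 = \tr (X *m Y^t*).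
Proof.
rewrite mxE (reindex _ (curry_mxvec_bij n n)) /= /mxtrace.
rewrite (eq_bigr (fun ij : 'I_n * 'I_n => X ij.1 ij.2 * (Y ij.1 ij.2)^*)) => [|[i j] _].
  rewrite -(pair_bigA _ (fun i j => X i j * (Y i j)^*)) /=; apply: eq_bigr => i _.
  by rewrite mxE; apply: eq_bigr => j _; rewrite !mxE.
by rewrite /= mxvecE mxE [_^T _ _]mxE mxvecE.
Qed.

Lemma tr_adj_swap n (X Y : 'M[C]_n) : \tr (X *m Y^t*) = (\tr (Y *m X^t*))^*.
Proof. by rewrite -trace_adj adjM trmxCK. Qed.

Lemma kraus_adj n (I : finType) (G : I -> 'M[C]_n) X :
  (forall i, herm (G i)) -> (kraus G X)^t* = kraus G (X^t*).
Proof.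
by move=> hG; rewrite adj_sum; apply: eq_bigr => i _; rewrite !adjM hG mulmxA.
Qed.

Lemma kraus_selfadj n (I : finType) (G : I -> 'M[C]_n) X Y : (forall i, herm (G i)) ->
  \tr (kraus G X *m Y^t*) = \tr (X *m (kraus G Y)^t*).
Proof.
move=> hG; rewrite kraus_adj // /kraus mulmx_suml mulmx_sumr !raddf_sum /=.
by apply: eq_bigr => i _; rewrite -!mulmxA mxtrace_mulC -!mulmxA.
Qed.

Lemma kraus_tr_ge0 n (I : finType) (G : I -> 'M[C]_n) X Y : (forall i, herm (G i)) ->
  psd X -> psd Y -> 0 <= \tr (kraus G X *m Y).
Proof.
move=> hG pX pY; apply: psd_tr_mul => //; apply: psd_sum => i _.
by rewrite -[X in _ *m X]hG; exact: psd_conj.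
Qed.

Lemma sqn_row n (v : 'rV[C]_n) : sqn v = \sum_i `|v 0 i| ^+ 2.
Proof. by rewrite sqnE big_ord1. Qed.

(** [l] is the largest entry of the spectral diagonal; [v != 0] makes the spectrum nonempty. In the
    equality case the nonnegative terms [(d k - d i) |w_i|^2] sum to 0, so [w] lives on the top
    eigenspace. *)
Lemma top_eigenvalue n (M : 'M[C]_n) (v : 'rV[C]_n) : herm M -> v != 0 ->
  exists l : C, [/\ l \is Num.real,
    exists2 w : 'rV[C]_n, w != 0 & w *m M = l *: w,
    (forall w : 'rV[C]_n, (w *m M *m w^t*) 0 0 <= l * sqn w) &
    (forall w : 'rV[C]_n, (w *m M *m w^t*) 0 0 = l * sqn w -> w *m M = l *: w)].
Proof.
move=> hM v0; have [i0 _] : exists i, v 0 i != 0 by apply/rV0Pn.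
have [] := herm_spec hM; set U := spectralmx M; set d := spectral_diag M.
move=> UU UU' dr ME.
have sqnU (w : 'rV[C]_n) : sqn w = \sum_i `|(w *m U^t*) 0 i| ^+ 2.
  by rewrite -(sqn_row (w *m U^t*)) /sqn adjM trmxCK mulmxA -[_ *m _ *m U]mulmxA UU' mulmx1.
have [k _ kmax] : exists2 k, true & forall i, d 0 i <= d 0 k.
  case: (real_arg_maxP (i0 := i0) (P := xpredT) (F := fun i => d 0 i)) => //.
  by move=> k _ kmax; exists k => // i; exact: kmax.
exists (d 0 k); split=> //.
- exists (row k U).
    have : sqn (row k U) = 1.
      rewrite /sqn trace_mx11; have -> : (row k U *m (row k U)^t*) 0 0 = (U *m U^t*) k k.
        by rewrite !mxE; apply: eq_bigr => j _; rewrite !mxE.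
      by rewrite UU mxE eqxx.
    by apply: contra_eq_neq => ->; rewrite /sqn mul0mx mxtrace0 eq_sym oner_eq0.
  rewrite ME -row_mul !mulmxA UU mul1mx; apply/rowP => j.
  by rewrite [LHS]mxE mul_diag_mx !mxE.
- move=> w; rewrite ME diag_form sqnU mulr_sumr; apply: ler_sum => i _.
  by rewrite ler_wpM2r ?exprn_ge0.
move=> w; rewrite [X in w *m X]ME diag_form sqnU mulr_sumr => /eqP.
rewrite eq_sym -subr_eq0 -sumrB => /eqP/psumr_eq0P w0.
have wi i : (d 0 k - d 0 i) * `|(w *m U^t*) 0 i| ^+ 2 = 0.
  rewrite mulrBl w0 // => j _; rewrite -mulrBl mulr_ge0 ?exprn_ge0 //.
  by rewrite subr_ge0.
have wE : w *m U^t* *m diag_mx d = d 0 k *: (w *m U^t*).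
  apply/rowP => i; rewrite mul_mx_diag [LHS]mxE [RHS]mxE.
  move/eqP: (wi i); rewrite mulf_eq0 sqrf_eq0 normr_eq0 => /orP[|/eqP->].
    by rewrite subr_eq0 mulrC => /eqP ->.
  by rewrite mulr0 mul0r.
by rewrite !mulmxA wE -scalemxAl -mulmxA UU' mulmx1.
Qed.

(* Replacing a top Hermitian eigenvector by its absolute value does not decrease
   the Rayleigh quotient, because the cross terms between the positive and the
   negative part are nonnegative. *)
Lemma perron_frobenius n (I : finType) (G : I -> 'M[C]_n) (Z : 'M[C]_n) (mu : C) :
  (forall i, herm (G i)) -> Z != 0 -> mu * sqn Z <= \tr (kraus G Z *m Z^t*) ->
  exists P l, [/\ psd P, P != 0, mu <= l & kraus G P = l *: P].
Proof.
(* Vectorization turns the map on matrices into one Hermitian matrix [M], whose quadratic form is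
   the trace pairing. *)
move=> hG Z0 muZ; pose M := lin_mx (kraus G).
have mulM X : mxvec X *m M = mxvec (kraus G X) by rewrite mul_vec_lin.
have quadM X : (mxvec X *m M *m (mxvec X)^t*) 0 0 = \tr (kraus G X *m X^t*).
  by rewrite mulM mxvec_dot.
have sqnM (X : 'M[C]_n) : sqn (mxvec X) = sqn X.
  by rewrite /sqn trace_mx11 mxvec_dot.
have hM : herm M.
  apply/matrixP => i j; rewrite mxE [M^T _ _]mxE (mxE_delta M i j) (mxE_delta M j i).
  rewrite -[delta_mx 0 i]vec_mxK -[delta_mx 0 j]vec_mxK !mulM !mxvec_dot.
  by rewrite kraus_selfadj // [LHS]/= -tr_adj_swap.
have vZ0 : mxvec Z != 0 by apply: contra_neq Z0 => /(congr1 vec_mx); rewrite mxvecK linear0.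
have [l [lr [w w0 wM] lmax leq]] := top_eigenvalue hM vZ0.
have mul : mu <= l.
  by rewrite -(ler_pM2r (sqn_gt0 Z0)) (le_trans muZ) // -quadM -sqnM.
pose X := vec_mx w.
have X0 : X != 0 by apply: contra_neq w0 => /(congr1 mxvec); rewrite vec_mxK linear0.
have XM : kraus G X = l *: X.
  by apply: (can_inj mxvecK); rewrite -mulM vec_mxK wM linearZ /= vec_mxK.
(* The eigenspace of the real [l] is closed under adjoints: take [X + X^*], or [i X] when this
   vanishes and [X] is anti-Hermitian. *)
have [H [H0 hH HM]] : exists H, [/\ H != 0, herm H & kraus G H = l *: H].
  have XtM : kraus G (X^t*) = l *: X^t*.
    by rewrite -kraus_adj // XM adjZ (CrealP lr).
  have [e|ne] := eqVneq (X + X^t*) 0; last first.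
    exists (X + X^t*); rewrite linearD /= XM XtM scalerDr; split=> //.
    by rewrite /herm adjD trmxCK addrC.
  exists ('i *: X); split; first by rewrite scaler_eq0 (negPf (neq0Ci C)).
    rewrite /herm adjZ conjCi; have -> : X^t* = - X by apply/eqP; rewrite -addr_eq0 addrC e.
    by rewrite scalerN scaleNr opprK.
  by rewrite linearZ /= XM !scalerA mulrC.
have [] := herm_spec hH; set U := spectralmx H; set d := spectral_diag H.
move=> UU UU' dr HE.
(* [P] is the absolute value of [H], so [P + H] and [P - H] are both positive semidefinite. *)
pose P := U^t* *m diag_mx (\row_i `|d 0 i|) *m U.
have hP : herm P by apply/psd_herm/psd_diag => i; rewrite mxE.
have sqnD (c : 'rV[C]_n) : sqn (U^t* *m diag_mx c *m U) = \sum_i `|c 0 i| ^+ 2.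
  rewrite /sqn !adjM trmxCK -!mulmxA mxtrace_mulC -!mulmxA UU mulmx1.
  rewrite [U *m _]mulmxA UU mul1mx; apply: eq_bigr => i _.
  by rewrite mul_diag_mx !mxE eqxx mulr1n normCK.
have sqnP : sqn P = sqn H.
  by rewrite HE !sqnD; apply: eq_bigr => i _; rewrite mxE normr_id.
have pPH (s : C) : s ^+ 2 = 1 -> s \is Num.real -> psd (P + s *: H).
  move=> s2 sr; rewrite /P HE scalemxAl scalemxAr -mulmxDl -mulmxDr -linearZ -linearD.
  apply: psd_diag => i; rewrite !mxE.
  have : `|s * d 0 i| = `|d 0 i|.
    rewrite normrM (_ : `|s| = 1) ?mul1r //.
    by apply/eqP; rewrite -(@eqrXn2 _ 2) // ?expr1n -?normrX ?s2 ?normr1.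
  move=> <-; have sdr : s * d 0 i \is Num.real by rewrite rpredM.
  by rewrite -[X in _ + X]opprK subr_ge0 -normrN real_ler_norm ?rpredN.
(* Twice the gain in passing from [H] to [P] equals [<G(P+H), P-H> + <G(P-H), P+H>], which is
   nonnegative. As [l] is maximal, equality holds and [P] is itself an eigenvector. *)
have quadP : \tr (kraus G P *m P^t*) = l * sqn P.
  apply/eqP; rewrite eq_le -{1}quadM -[sqn P]sqnM lmax andTb sqnM sqnP.
  have -> : l * sqn H = \tr (kraus G H *m H^t*) by rewrite HM -scalemxAl mxtraceZ.
  rewrite hP hH -subr_ge0.
  have p1 := pPH 1 (expr1n _ _) (rpred1 _).
  have p2 := pPH (-1) (sqrr_sign _ 1) (rpredN1 _).
  rewrite -(pmulr_rge0 _ (ltr0n C 2)).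
  have -> : 2%:R * (\tr (kraus G P *m P) - \tr (kraus G H *m H)) =
      \tr (kraus G (P + 1 *: H) *m (P + -1 *: H)) +
      \tr (kraus G (P + -1 *: H) *m (P + 1 *: H)).
    rewrite !scale1r !scaleN1r (raddfD (kraus G)) (raddfB (kraus G)).
    rewrite mulmxDl mulmxBl !mulmxDr !mulmxN !(raddfD, raddfN) /=; ring.
  by rewrite addr_ge0 // kraus_tr_ge0.
exists P, l; split=> //.
- by apply: psd_diag => i; rewrite mxE.
- apply: contra_neq H0 => P0; apply: sqn_eq0; rewrite -sqnP P0.
  by rewrite /sqn mul0mx mxtrace0.
- apply: (can_inj mxvecK); rewrite -mulM linearZ /=; apply: leq.
  by rewrite quadM sqnM.
Qed.

End PerronFrobenius.

(** * Orthogonal projections, ranks and inverse square roots *)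

Section Projections.
Local Open Scope sesquilinear_scope.
Variable C : numClosedFieldType.

(** The row spaces of [Q] and [1 - Q] are orthogonal, so [Q] equals [Q] times its adjoint. *)
Lemma proj_ortho_herm m n (V : 'M[C]_(m, n)) : herm (proj_ortho V).
Proof.
set Q := proj_ortho V.
have QV : (Q <= V)%MS by rewrite -[Q]mul1mx proj_ortho_sub.
have := proj_ortho_compl_sub V 1%:M; rewrite mul1mx -/Q => QV'.
have : Q *m (1%:M - Q)^t* = 0.
  apply/orthomx1P; apply: submx_trans QV _; rewrite orthomx_sym.
  exact: submx_trans QV' _.
move: (Q) => P; rewrite adjD adjN adj1 mulmxBr mulmx1 => /eqP.
by rewrite subr_eq0 => /eqP PE; rewrite /herm {1}PE adjM trmxCK -PE.
Qed.

(** Invariance under [A] gives [Q A Q = Q A]; the adjoint of the same relation for the adjoint of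
    [A] gives [Q A Q = A Q]. *)
Lemma proj_ortho_comm m n (V : 'M[C]_(m, n)) (A : 'M[C]_n) :
  (V *m A <= V)%MS -> (V *m A^t* <= V)%MS ->
  proj_ortho V *m A = A *m proj_ortho V.
Proof.
move=> VA VA'; set Q := proj_ortho V.
have hQ : Q^t* = Q := proj_ortho_herm V.
have QV : (Q <= V)%MS by rewrite -[Q]mul1mx proj_ortho_sub.
have e1 : Q *m A *m Q = Q *m A.
  by apply: proj_ortho_id; apply: submx_trans (submxMr _ QV) VA.
have e2 : Q *m A^t* *m Q = Q *m A^t*.
  by apply: proj_ortho_id; apply: submx_trans (submxMr _ QV) VA'.
move: (Q) hQ e1 e2 => P hP e1 /(congr1 (fun A : 'M[C]_n => A^t*)) /=.
by rewrite !adjM trmxCK hP mulmxA e1.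
Qed.

(** In a full-rank factorization [A = D B], idempotence forces [B D = 1], and the trace is
    cyclic. *)
Lemma mxrank_idem n (A : 'M[C]_n) : A *m A = A -> (\rank A)%:R = \tr A.
Proof.
move=> AA; set B := row_base A; set D := col_base A.
have AE : D *m B = A by exact: mulmx_base.
have BD : B *m D = 1%:M.
  have : D *m (B *m D *m B) = D *m B by rewrite mulmxA [D *m (B *m D)]mulmxA -mulmxA !AE AA.
  move/(row_full_inj (col_base_full A)) => e.
  apply: (row_free_inj (row_base_free A)); rewrite mul1mx -/B.
  exact: e.
by rewrite -{2}AE mxtrace_mulC BD mxtrace1.
Qed.

Lemma proj_ortho_rank m n (V : 'M[C]_(m, n)) : \rank (proj_ortho V) = \rank V.
Proof. by rewrite proj_orthoE. Qed.

Lemma proj_ortho_tr m n (V : 'M[C]_(m, n)) : \tr (proj_ortho V) = (\rank V)%:R.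
Proof. by rewrite -mxrank_idem ?proj_ortho_rank // proj_ortho_proj. Qed.

Lemma psd_idem n (Q : 'M[C]_n) : herm Q -> Q *m Q = Q -> psd Q.
Proof. by move=> hQ QQ; rewrite -QQ -{2}hQ; exact: psd_sqr. Qed.

Lemma compl_idem n (Q : 'M[C]_n) : herm Q -> Q *m Q = Q ->
  herm (1%:M - Q) /\ (1%:M - Q) *m (1%:M - Q) = 1%:M - Q.
Proof.
move=> hQ QQ; split; first by rewrite /herm adjD adjN adj1 hQ.
by rewrite mulmxBl mul1mx mulmxBr mulmx1 QQ subrr subr0.
Qed.

(** Cauchy-Schwarz between [Y] and its range projection [E], in the linearized form
    [|Y - c E|^2 >= 0]. *)
Lemma tr_sqr_rank n (Y : 'M[C]_n) (c : C) : herm Y -> c \is Num.real ->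
  2 * c * \tr Y <= c ^+ 2 * (\rank Y)%:R + \tr (Y *m Y).
Proof.
move=> hY cr; have YE : Y *m proj_ortho Y = Y by rewrite proj_ortho_id.
have EE : proj_ortho Y *m proj_ortho Y = proj_ortho Y := proj_ortho_proj Y.
move: (proj_ortho_herm Y) (proj_ortho_tr Y) YE EE.
move: (proj_ortho Y) => E hE trE YE EE.
have EY : E *m Y = Y by have := congr1 (fun M : 'M[C]_n => M^t*) YE; rewrite /= adjM hE hY.
have := sqn_ge0 (Y - c *: E); rewrite /sqn adjD adjN adjZ hE hY (CrealP cr).
rewrite mulmxBl !mulmxBr -!scalemxAl -!scalemxAr YE EY EE.
rewrite !raddfB /= !mxtraceZ trE => ge0.
by rewrite -subr_ge0; apply: le_trans ge0 _; rewrite le_eqVlt; apply/orP; left; apply/eqP; ring.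
Qed.

Lemma psd_inv_sqrt n (A : 'M[C]_n) : psd A ->
  exists H : 'M[C]_n, [/\ herm H, (H *m A *m H) *m (H *m A *m H) = H *m A *m H &
    \rank (H *m A *m H) = \rank A].
Proof.
move=> pA; have [] := herm_spec (psd_herm pA).
set U := spectralmx A; set d := spectral_diag A => UU UU' dr AE.
have d0 i : 0 <= d 0 i := psd_spec_ge0 i pA.
pose f (c : 'rV[C]_n) : 'M[C]_n := U^t* *m diag_mx c *m U.
have fM a b : f a *m f b = f (\row_i (a 0 i * b 0 i)).
  rewrite /f !mulmxA -[_ *m U *m _]mulmxA UU mulmx1 -[_ *m diag_mx a *m _]mulmxA.
  by rewrite mulmx_diag.
pose s : 'rV[C]_n := \row_i sqrtC (d 0 i).
(* Since [0^-1 = 0], this is the pseudo-inverse square root, and [H A H] is the projection onto the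
   range of [A]. *)
pose h : 'rV[C]_n := \row_i (sqrtC (d 0 i))^-1.
have AE' : A = f d by [].
have sh i : s 0 i * h 0 i = (d 0 i != 0)%:R.
  rewrite !mxE; have [->|di] := eqVneq (d 0 i) 0; first by rewrite sqrtC0 mul0r.
  by rewrite divff // sqrtC_eq0.
have ss i : s 0 i * s 0 i = d 0 i by rewrite !mxE -expr2 sqrtCK.
have HAH : f h *m A *m f h = f (\row_i (d 0 i != 0)%:R).
  rewrite AE' !fM; congr f; apply/rowP => i.
  rewrite [LHS]mxE [X in X * _]mxE [RHS]mxE -ss.
  have -> : h 0 i * (s 0 i * s 0 i) * h 0 i = (s 0 i * h 0 i) * (s 0 i * h 0 i) by ring.
  by rewrite ss sh; case: (_ != _); rewrite ?mulr1 ?mulr0.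
exists (f h); split.
- apply/psd_herm/psd_diag => i; rewrite mxE invr_ge0 sqrtC_ge0 //.
- rewrite HAH fM; congr f; apply/rowP => i; rewrite !mxE.
  by case: (_ != _); rewrite ?mulr1 ?mulr0.
apply/eqP; rewrite eqn_leq; apply/andP; split.
  by rewrite (leq_trans (mxrankM_maxl _ _)) // mxrankM_maxr.
rewrite HAH; have -> : A = f s *m f (\row_i (d 0 i != 0)%:R) *m f s.
  rewrite AE' !fM; congr f; apply/rowP => i.
  rewrite [RHS]mxE [X in X * _]mxE [X in _ * X * _]mxE.
  by have [->|_] := eqVneq (d 0 i) 0; rewrite ?mulr0 ?mul0r // mulr1 ss.
by rewrite (leq_trans (mxrankM_maxl _ _)) // mxrankM_maxr.
Qed.

End Projections.

(** * Matrices indexed by a finite type *)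

Section FinIndexed.
Local Open Scope sesquilinear_scope.
Variables (C : numClosedFieldType).

Section OneType.
Variable T : finType.
Implicit Types (A B : 'M[C]_#|T|) (x y z : T).

Definition fmx (f : T -> T -> C) : 'M[C]_#|T| :=
  \matrix_(i, j) f (enum_val i) (enum_val j).

Definition ment A x y : C := A (enum_rank x) (enum_rank y).

Lemma fmxE f x y : ment (fmx f) x y = f x y.
Proof. by rewrite /ment mxE !enum_rankK. Qed.

Lemma mentP A B : (forall x y, ment A x y = ment B x y) -> A = B.
Proof.
move=> AB; apply/matrixP => k l; rewrite -[k]enum_valK -[l]enum_valK; exact: AB.
Qed.

Lemma sum_rank (F : 'I_#|T| -> C) : \sum_i F i = \sum_(x : T) F (enum_rank x).
Proof. by rewrite (reindex _ (onW_bij _ (@enum_rank_bij T))). Qed.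

Lemma mentM A B x y : ment (A *m B) x y = \sum_z ment A x z * ment B z y.
Proof. by rewrite /ment mxE sum_rank. Qed.

Lemma mentD A B x y : ment (A + B) x y = ment A x y + ment B x y.
Proof. by rewrite /ment mxE. Qed.

Lemma mentN A x y : ment (- A) x y = - ment A x y.
Proof. by rewrite /ment mxE. Qed.

Lemma mentZ a A x y : ment (a *: A) x y = a * ment A x y.
Proof. by rewrite /ment mxE. Qed.

Lemma ment_sum I (r : seq I) P (F : I -> 'M[C]_#|T|) x y :
  ment (\sum_(i <- r | P i) F i) x y = \sum_(i <- r | P i) ment (F i) x y.
Proof. by rewrite /ment summxE. Qed.

Lemma ment0 x y : ment 0 x y = 0.
Proof. by rewrite /ment mxE. Qed.

Lemma ment1 x y : ment 1%:M x y = (x == y)%:R.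
Proof. by rewrite /ment mxE (inj_eq enum_rank_inj). Qed.

Lemma ment_adj A x y : ment (A^t*) x y = (ment A y x)^*.
Proof. by rewrite /ment !mxE. Qed.

Lemma ment_tr A : \tr A = \sum_x ment A x x.
Proof. exact: sum_rank. Qed.

Definition pmx (f : T -> T) := fmx (fun x y => (f x == y)%:R).

Lemma pmxl f A x y : ment (pmx f *m A) x y = ment A (f x) y.
Proof.
rewrite mentM (bigD1 (f x)) //= fmxE eqxx mul1r big1 ?addr0 // => z zx.
by rewrite fmxE eq_sym (negPf zx) mul0r.
Qed.

Lemma pmxr f A x y : ment (A *m (pmx f)^t*) x y = ment A x (f y).
Proof.
rewrite mentM (bigD1 (f y)) //= ment_adj fmxE eqxx conjC1 mulr1 big1 ?addr0 //.
by move=> z zx; rewrite ment_adj fmxE eq_sym (negPf zx) conjC0 mulr0.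
Qed.

End OneType.

(** Pulling back along [h] is conjugation by the incidence matrix of [h]. *)
Lemma psd_fmx_sum (T U : finType) (h : U -> T) (A : 'M[C]_#|T|) :
  psd A -> psd (fmx (fun x y => ment A (h x) (h y))).
Proof.
move=> pA; pose B : 'M[C]_(#|U|, #|T|) := \matrix_(i, j) (enum_rank (h (enum_val i)) == j)%:R.
rewrite (_ : fmx _ = B *m A *m B^t*); first exact: psd_conj.
apply/matrixP => i j; rewrite !mxE (bigD1 (enum_rank (h (enum_val j)))) //= !mxE eqxx conjC1 mulr1.
rewrite (bigD1 (enum_rank (h (enum_val i)))) //= !mxE eqxx mul1r !big1 ?addr0 //.
  by move=> k kh; rewrite !mxE eq_sym (negPf kh) conjC0 mulr0.
by move=> k kh; rewrite !mxE eq_sym (negPf kh) mul0r.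
Qed.

End FinIndexed.

(** * Matrices indexed by words *)

Section Words.
Local Open Scope sesquilinear_scope.
Variables (C : numClosedFieldType) (n m : nat).
Local Notation W := {ffun 'I_n -> bool * 'I_m}.
Local Notation A := {ffun 'I_n -> 'I_m}.
Local Notation B := {ffun 'I_n -> bool}.

(* A word consists of a dual point [bits w] of {0,1}^n and of the index [lets w] of a
   basis vector of (C^m)^(tensor n). *)
Definition bits (w : W) : B := [ffun i => (w i).1].
Definition lets (w : W) : A := [ffun i => (w i).2].
Definition zipw (u : B) (a : A) : W := [ffun i => (u i, a i)].
Definition permf T (s : 'S_n) (w : {ffun 'I_n -> T}) : {ffun 'I_n -> T} :=
  [ffun i => w (s i)].
Definition unitb (i : 'I_n) : B := [ffun k => k == i].
Definition addb (u v : B) : B := [ffun i => u i (+) v i].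
Definition shiftw (v : B) (w : W) : W := zipw (addb v (bits w)) (lets w).

Lemma bits_zip u a : bits (zipw u a) = u.
Proof. by apply/ffunP => i; rewrite !ffunE. Qed.

Lemma lets_zip u a : lets (zipw u a) = a.
Proof. by apply/ffunP => i; rewrite !ffunE. Qed.

Lemma zip_bits_lets w : zipw (bits w) (lets w) = w.
Proof. by apply/ffunP => i; rewrite !ffunE; case: (w i). Qed.

Lemma permf_inj T s : injective (@permf T s).
Proof.
move=> w w' /ffunP e; apply/ffunP => i; have := e (s^-1 i)%g.
by rewrite !ffunE permKV.
Qed.

Lemma permfM T s t (w : {ffun 'I_n -> T}) : permf s (permf t w) = permf (s * t)%g w.
Proof. by apply/ffunP => i; rewrite !ffunE permM. Qed.

Lemma bits_perm s w : bits (permf s w) = permf s (bits w).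
Proof. by apply/ffunP => i; rewrite !ffunE. Qed.

Lemma lets_perm s w : lets (permf s w) = permf s (lets w).
Proof. by apply/ffunP => i; rewrite !ffunE. Qed.

Lemma zip_perm s u a : zipw (permf s u) (permf s a) = permf s (zipw u a).
Proof. by apply/ffunP => i; rewrite !ffunE. Qed.

Lemma bits_shift v w : bits (shiftw v w) = addb v (bits w).
Proof. by rewrite bits_zip. Qed.

Lemma lets_shift v w : lets (shiftw v w) = lets w.
Proof. by rewrite lets_zip. Qed.

Lemma addbb_ffun u v : addb u (addb u v) = v.
Proof. by apply/ffunP => i; rewrite !ffunE addbA addbb. Qed.

Lemma addb_ffunC u v : addb u v = addb v u.
Proof. by apply/ffunP => i; rewrite !ffunE addbC. Qed.

Lemma addb_ffunA u v w : addb u (addb v w) = addb (addb u v) w.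
Proof. by apply/ffunP => i; rewrite !ffunE addbA. Qed.

Lemma addb_inj u : injective (addb u).
Proof. exact: can_inj (addbb_ffun u). Qed.

Lemma shiftwK v : involutive (shiftw v).
Proof.
by move=> w; rewrite /shiftw bits_zip lets_zip addbb_ffun zip_bits_lets.
Qed.

Lemma shift_perm s i w :
  shiftw (unitb i) (permf s w) = permf s (shiftw (unitb (s i)) w).
Proof. by apply/ffunP => k; rewrite !ffunE (inj_eq perm_inj). Qed.

Lemma sum_words (F : W -> C) : \sum_w F w = \sum_u \sum_a F (zipw u a).
Proof.
rewrite pair_bigA /= (reindex (fun p => zipw p.1 p.2)) //=.
exists (fun w => (bits w, lets w)) => [[u a] _|w _] /=.
  by rewrite bits_zip lets_zip.
by rewrite zip_bits_lets.
Qed.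

Definition blocked (X : 'M[C]_#|W|) :=
  forall w w', bits w != bits w' -> ment X w w' = 0.

Lemma blockedM X Y : blocked X -> blocked Y -> blocked (X *m Y).
Proof.
move=> bX bY w w' ww'; rewrite mentM big1 // => z _.
have [e|ne] := eqVneq (bits w) (bits z); first by rewrite bY ?mulr0 // -e.
by rewrite bX ?mul0r.
Qed.

(* The Fourier transforms of the elements of the Hecke algebra of (C^m)^(tensor n). *)
Definition inB (X : 'M[C]_#|W|) := blocked X /\
  (forall s w w', ment X (permf s w) (permf s w') = ment X w w').

Lemma inBM X Y : inB X -> inB Y -> inB (X *m Y).
Proof.
move=> [bX sX] [bY sY]; split=> [|s w w']; first exact: blockedM.
rewrite !mentM (reindex_inj (@permf_inj _ s)); apply: eq_bigr => z _.
by rewrite sX sY.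
Qed.

Lemma inB_adj X : inB X -> inB (X^t*).
Proof.
move=> [bX sX]; split=> [w w' ww'|s w w']; rewrite !ment_adj ?sX //.
by rewrite bX ?conjC0 // eq_sym.
Qed.

Lemma inB1 : inB 1%:M.
Proof.
split=> [w w' ww'|s w w']; rewrite !ment1 ?(inj_eq (@permf_inj _ s)) //.
by have [e|//] := eqVneq w w'; rewrite e eqxx in ww'.
Qed.

Lemma inBD X Y : inB X -> inB Y -> inB (X + Y).
Proof.
move=> [bX sX] [bY sY]; split=> [w w' ww'|s w w']; rewrite !mentD ?sX ?sY //.
by rewrite bX // bY // addr0.
Qed.

Lemma inBZ a X : inB X -> inB (a *: X).
Proof.
move=> [bX sX]; split=> [w w' ww'|s w w']; rewrite !mentZ ?sX //.
by rewrite bX // mulr0.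
Qed.

Definition shiftmx (v : B) : 'M[C]_#|W| := pmx C (shiftw v).

Lemma shiftmx_herm v : herm (shiftmx v).
Proof.
apply: mentP => w w'; rewrite ment_adj !fmxE rmorph_nat; congr (_%:R).
by congr nat_of_bool; apply/eqP/eqP => <-; rewrite shiftwK.
Qed.

Definition conj_shift v X := shiftmx v *m X *m shiftmx v.

Lemma conj_shiftE v X w w' :
  ment (conj_shift v X) w w' = ment X (shiftw v w) (shiftw v w').
Proof. by rewrite /conj_shift -[X in _ *m X]shiftmx_herm pmxr pmxl. Qed.

Lemma shiftmxK v : shiftmx v *m shiftmx v = 1%:M.
Proof.
apply: mentP => w w'; rewrite pmxl fmxE ment1 shiftwK //.
Qed.

(** The Fourier-side form of multiplication by [n t_n]; see [t_zonal_kernel]. *)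
Definition flip_sum X := \sum_i conj_shift (unitb i) X.

Fact flip_sum_is_linear : linear flip_sum.
Proof.
move=> a X Y; rewrite /flip_sum scaler_sumr -big_split; apply: eq_bigr => i _ /=.
by rewrite /conj_shift mulmxDr mulmxDl -scalemxAr -scalemxAl.
Qed.
HB.instance Definition _ :=
  GRing.isLinear.Build C 'M[C]_#|W| 'M[C]_#|W| _ flip_sum flip_sum_is_linear.

Lemma flip_sumE X w w' :
  ment (flip_sum X) w w' = \sum_i ment X (shiftw (unitb i) w) (shiftw (unitb i) w').
Proof. by rewrite ment_sum; apply: eq_bigr => i _; rewrite conj_shiftE. Qed.

Lemma inB_flip X : inB X -> inB (flip_sum X).
Proof.
move=> [bX sX]; split=> [w w' ww'|s w w']; rewrite !flip_sumE.
  by rewrite big1 // => i _; rewrite bX // !bits_shift (inj_eq (@addb_inj _)).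
rewrite [RHS](reindex_inj (@perm_inj _ s)); apply: eq_bigr => i _.
by rewrite !shift_perm sX.
Qed.

Lemma psd_conj_shift v X : psd X -> psd (conj_shift v X).
Proof. by rewrite /conj_shift -{2}(shiftmx_herm v); exact: psd_conj. Qed.

Lemma psd_flip X : psd X -> psd (flip_sum X).
Proof. by move=> pX; apply: psd_sum => i _; exact: psd_conj_shift. Qed.

(** Pinching to the diagonal blocks combined with the sum over S_n, left unnormalized. It maps into
    the algebra [inB], is a bimodule map over it, commutes with [flip_sum] and preserves positivity,
    so it makes an arbitrary positive eigenvector invariant. *)
Definition avg (X : 'M[C]_#|W|) : 'M[C]_#|W| :=
  fmx (fun w w' => (bits w == bits w')%:R *
                   \sum_(s : 'S_n) ment X (permf s w) (permf s w')).

Lemma inB_avg X : inB (avg X).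
Proof.
split=> [w w' /negPf ww'|s w w']; rewrite !fmxE ?ww' ?mul0r //.
rewrite !bits_perm (inj_eq (@permf_inj _ s)); congr (_ * _).
rewrite [RHS](reindex_inj (mulIg s)); apply: eq_bigr => t _.
by rewrite !permfM.
Qed.

Lemma avgMl X Y : inB Y -> avg (Y *m X) = Y *m avg X.
Proof.
move=> [bY sY]; apply: mentP => w w'; rewrite fmxE mentM mulr_sumr.
under eq_bigr => s _.
  rewrite mentM (reindex_inj (@permf_inj _ s)) /= mulr_sumr.
  under eq_bigr => z _ do rewrite sY.
  over.
rewrite exchange_big; apply: eq_bigr => z _ /=.
rewrite fmxE -!mulr_sumr mulrCA; have [e|ne] := eqVneq (bits w) (bits z).
  by rewrite e.
by rewrite bY // !mul0r.
Qed.

Lemma avg_adj X : avg (X^t*) = (avg X)^t*.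
Proof.
apply: mentP => w w'; rewrite ment_adj !fmxE rmorphM rmorph_sum rmorph_nat eq_sym.
by congr (_ * _); apply: eq_bigr => s _; rewrite ment_adj.
Qed.

Lemma avgMr X Y : inB Y -> avg (X *m Y) = avg X *m Y.
Proof.
move=> BY; rewrite -[LHS]trmxCK -avg_adj adjM avgMl; last exact: inB_adj.
by rewrite adjM avg_adj !trmxCK.
Qed.

Lemma avg_flip X : avg (flip_sum X) = flip_sum (avg X).
Proof.
apply: mentP => w w'; rewrite flip_sumE fmxE.
under [RHS]eq_bigr => i _ do
  rewrite fmxE !bits_shift (inj_eq (@addb_inj _)).
rewrite -mulr_sumr; congr (_ * _).
rewrite [RHS]exchange_big; apply: eq_bigr => s _; rewrite flip_sumE /=.
rewrite [RHS](reindex_inj (@perm_inj _ s)); apply: eq_bigr => i _.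
by rewrite !shift_perm.
Qed.

Lemma avgZ a X : avg (a *: X) = a *: avg X.
Proof.
apply: mentP => w w'; rewrite mentZ !fmxE mulrCA; congr (_ * _).
by rewrite mulr_sumr; apply: eq_bigr => s _; rewrite mentZ.
Qed.

Definition bitproj (u : B) : 'M[C]_#|W| :=
  fmx (fun w w' => (w == w')%:R * (bits w == u)%:R).

Lemma bitproj_herm u : herm (bitproj u).
Proof.
apply: mentP => w w'; rewrite ment_adj !fmxE -natrM rmorph_nat natrM eq_sym.
by case: eqP => [->|_]; rewrite ?mul0r.
Qed.

Lemma bitprojMl u Y w w' : ment (bitproj u *m Y) w w' = (bits w == u)%:R * ment Y w w'.
Proof.
rewrite mentM (bigD1 w) //= fmxE eqxx mul1r big1 ?addr0 // => z /negPf zw.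
by rewrite fmxE eq_sym zw !mul0r.
Qed.

Lemma bitprojMr u Y w w' : ment (Y *m bitproj u) w w' = (bits w' == u)%:R * ment Y w w'.
Proof.
rewrite mentM (bigD1 w') //= fmxE eqxx mul1r big1 ?addr0 => [|z /negPf zw].
  by rewrite mulrC.
by rewrite fmxE zw mul0r mulr0.
Qed.

Lemma psd_avg X : psd X -> psd (avg X).
Proof.
move=> pX; have -> : avg X = \sum_u \sum_s
    bitproj u *m (pmx C (permf s) *m X *m (pmx C (permf s))^t*) *m bitproj u.
  apply: mentP => w w'; rewrite fmxE ment_sum.
  rewrite (bigD1 (bits w)) //= ment_sum [X in _ + X]big1 ?addr0 => [|u /negPf uw].
    rewrite mulr_sumr; apply: eq_bigr => s _.
    by rewrite bitprojMr bitprojMl pmxr pmxl eqxx mul1r eq_sym.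
  rewrite ment_sum big1 // => s _.
  by rewrite bitprojMr bitprojMl [bits w == u]eq_sym uw mul0r mulr0.
apply: psd_sum => u _; apply: psd_sum => s _; rewrite -{2}bitproj_herm.
by do 2!apply: psd_conj.
Qed.

Lemma tr_avg X : \tr (avg X) = n`!%:R * \tr X.
Proof.
rewrite !ment_tr; under eq_bigr => w _ do rewrite fmxE eqxx mul1r.
rewrite exchange_big /= (eq_bigr (fun=> \tr X)) => [|s _].
  by rewrite sumr_const card_Sn mulr_natl ment_tr.
by rewrite ment_tr [RHS](reindex_inj (@permf_inj _ s)).
Qed.

(** The embedding [Y |-> 1 (x) Y], with the identity on the dual points; [ptrace] is its adjoint for
    the trace form ([tr_lift]). *)
Definition liftw (Y : 'M[C]_#|A|) : 'M[C]_#|W| :=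
  fmx (fun w w' => (bits w == bits w')%:R * ment Y (lets w) (lets w')).

Definition ptrace (X : 'M[C]_#|W|) : 'M[C]_#|A| :=
  fmx (fun a b => \sum_u ment X (zipw u a) (zipw u b)).

Lemma liftwM Y Z : liftw Y *m liftw Z = liftw (Y *m Z).
Proof.
apply: mentP => w w'; rewrite fmxE !mentM sum_words (bigD1 (bits w)) //=.
rewrite [X in _ + X]big1 ?addr0 => [|u /negPf uw].
  rewrite mulr_sumr; apply: eq_bigr => a _.
  by rewrite !fmxE bits_zip lets_zip eqxx mul1r mulrCA.
by rewrite big1 // => a _; rewrite !fmxE bits_zip eq_sym uw !mul0r.
Qed.

Lemma liftw_adj Y : (liftw Y)^t* = liftw (Y^t*).
Proof.
apply: mentP => w w'; rewrite ment_adj !fmxE rmorphM rmorph_nat eq_sym.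
by rewrite ment_adj.
Qed.

Lemma liftw1 : liftw 1%:M = 1%:M.
Proof.
apply: mentP => w w'; rewrite fmxE !ment1 -natrM mulnb; congr (_%:R).
congr nat_of_bool; apply/andP/eqP => [[/eqP e1 /eqP e2]|-> //].
by rewrite -(zip_bits_lets w) e1 e2 zip_bits_lets.
Qed.

Lemma liftwB Y Z : liftw (Y - Z) = liftw Y - liftw Z.
Proof.
by apply: mentP => w w'; rewrite mentD mentN !fmxE mentD mentN mulrBr.
Qed.

Definition perm_inv (Y : 'M[C]_#|A|) :=
  forall s a b, ment Y (permf s a) (permf s b) = ment Y a b.

Lemma blocked_lift Y : blocked (liftw Y).
Proof. by move=> w w' /negPf ww'; rewrite fmxE ww' mul0r. Qed.

Lemma inB_lift Y : perm_inv Y -> inB (liftw Y).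
Proof.
move=> sY; split=> [|s w w']; first exact: blocked_lift.
by rewrite !fmxE !bits_perm !lets_perm sY (inj_eq (@permf_inj _ s)).
Qed.

Lemma perm_inv_ptrace X : inB X -> perm_inv (ptrace X).
Proof.
move=> [_ sX] s a b; rewrite !fmxE (reindex_inj (@permf_inj _ s)).
by apply: eq_bigr => u _; rewrite !zip_perm sX.
Qed.

Lemma tr_lift Y X : \tr (liftw Y *m X) = \tr (Y *m ptrace X).
Proof.
rewrite !ment_tr sum_words exchange_big; apply: eq_bigr => a _ /=.
rewrite mentM; under eq_bigr => u _.
  rewrite mentM sum_words (bigD1 u) //= [X in _ + X]big1 ?addr0 => [|v /negPf vu].
    under eq_bigr => b _ do rewrite fmxE !bits_zip !lets_zip eqxx mul1r.
    over.
  by rewrite big1 // => b _; rewrite fmxE !bits_zip eq_sym vu !mul0r.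
by rewrite exchange_big; apply: eq_bigr => b _; rewrite fmxE mulr_sumr.
Qed.

Lemma tr_ptrace X : \tr (ptrace X) = \tr X.
Proof. by rewrite -[ptrace X]mul1mx -tr_lift liftw1 mul1mx. Qed.

Lemma ptrace_lift Y X : ptrace (liftw Y *m X) = Y *m ptrace X.
Proof.
apply: mentP => a b; rewrite fmxE mentM; under eq_bigr => u _.
  rewrite mentM sum_words (bigD1 u) //= [X in _ + X]big1 ?addr0 => [|v /negPf vu].
    under eq_bigr => c _ do rewrite fmxE !bits_zip !lets_zip eqxx mul1r.
    over.
  by rewrite big1 // => c _; rewrite fmxE !bits_zip eq_sym vu !mul0r.
by rewrite exchange_big; apply: eq_bigr => c _; rewrite fmxE mulr_sumr.
Qed.

Lemma ptrace_adj X : ptrace (X^t*) = (ptrace X)^t*.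
Proof.
apply: mentP => a b; rewrite ment_adj !fmxE rmorph_sum.
by apply: eq_bigr => u _; rewrite ment_adj.
Qed.

Lemma ptraceD X Y : ptrace (X + Y) = ptrace X + ptrace Y.
Proof.
apply: mentP => a b; rewrite mentD !fmxE -big_split.
by apply: eq_bigr => u _; rewrite mentD.
Qed.

Lemma psd_ptrace X : psd X -> psd (ptrace X).
Proof.
move=> pX; rewrite (_ : ptrace X =
    \sum_u fmx (fun a b => ment X (zipw u a) (zipw u b))).
  by apply: psd_sum => u _; exact: psd_fmx_sum.
by apply: mentP => a b; rewrite fmxE ment_sum; apply: eq_bigr => u _; rewrite fmxE.
Qed.

Lemma shiftmx_lift v Y : liftw Y *m shiftmx v = shiftmx v *m liftw Y.
Proof.
rewrite -[in LHS]shiftmx_herm; apply: mentP => w w'; rewrite pmxl pmxr !fmxE.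
rewrite !bits_shift !lets_shift; congr (_%:R * _); congr nat_of_bool.
by apply/eqP/eqP => [->|<-]; rewrite addbb_ffun.
Qed.

Lemma flip_lift X Y : flip_sum (X *m liftw Y) = flip_sum X *m liftw Y.
Proof.
rewrite /flip_sum mulmx_suml; apply: eq_bigr => i _.
by rewrite /conj_shift -!mulmxA shiftmx_lift.
Qed.

Lemma flip_lift_l X Y : flip_sum (liftw Y *m X) = liftw Y *m flip_sum X.
Proof.
rewrite /flip_sum mulmx_sumr; apply: eq_bigr => i _.
by rewrite /conj_shift !mulmxA -shiftmx_lift.
Qed.

Lemma conj_shiftD u v X : conj_shift (addb u v) X = conj_shift u (conj_shift v X).
Proof.
apply: mentP => w w'; rewrite !conj_shiftE; congr (ment X _ _);
by rewrite /shiftw bits_zip lets_zip addb_ffunA [addb v u]addb_ffunC.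
Qed.

End Words.

(** * One positive solution inside prescribed projections *)

Section Step.
Local Open Scope sesquilinear_scope.
Variables (C : numClosedFieldType) (n m : nat).
Local Notation W := {ffun 'I_n -> bool * 'I_m}.
Local Notation A := {ffun 'I_n -> 'I_m}.

Lemma tr_sqr_expand k (X Y : 'M[C]_k) (t : C) : herm X -> herm Y -> t \is Num.real ->
  0 <= t ^+ 2 * \tr (X *m X) - 2 * t * \tr (X *m Y) + \tr (Y *m Y).
Proof.
move=> hX hY tr; have := sqn_ge0 (t *: X - Y).
rewrite /sqn adjD adjN adjZ hX hY (CrealP tr) mulmxBl !mulmxBr.
rewrite -!scalemxAl -!scalemxAr !raddfB /= !mxtraceZ [\tr (Y *m X)]mxtrace_mulC => ge0.
by apply: le_trans ge0 _; rewrite le_eqVlt; apply/orP; left; apply/eqP; ring.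
Qed.

Lemma flip_selfadj (X Y : 'M[C]_#|W|) :
  \tr (flip_sum X *m Y) = \tr (X *m flip_sum Y).
Proof.
rewrite /flip_sum mulmx_suml mulmx_sumr !raddf_sum /=; apply: eq_bigr => i _.
by rewrite /conj_shift -!mulmxA mxtrace_mulC -!mulmxA.
Qed.

(** Each of the [n] flips is an isometry for the Hilbert-Schmidt norm. Per flip, the cross term
    [2 <F sg, d>] is at most [t + eta / t] by the arithmetic-geometric inequality with free
    parameter [t], and [<F d, d>] is at least [- eta]. *)
Lemma flip_rayleigh (sg Z : 'M[C]_#|W|) (t eta : C) (d := sg - Z) :
  herm sg -> herm Z -> \tr (sg *m sg) = 1 -> \tr (d *m d) <= eta -> 0 < t ->
  \tr (flip_sum sg *m sg) - n%:R * (t + eta / t + eta) <= \tr (flip_sum Z *m Z).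
Proof.
move=> hsg hZ sg1 deta t0; have hd : herm d by rewrite /herm adjD adjN hsg hZ.
have hF i X : herm X -> herm (conj_shift (unitb i) X : 'M[C]_#|W|).
  by move=> hX; rewrite /herm /conj_shift !adjM hX !shiftmx_herm mulmxA.
have FF i (X : 'M[C]_#|W|) :
    \tr (conj_shift (unitb i) X *m conj_shift (unitb i) X) = \tr (X *m X).
  rewrite /conj_shift -!mulmxA [shiftmx _ _ _ *m (shiftmx _ _ _ *m _)]mulmxA shiftmxK mul1mx.
  by rewrite mxtrace_mulC -!mulmxA shiftmxK mulmx1.
have ZE : Z = sg - d by rewrite opprB addrCA subrr addr0.
clearbody d; rewrite {}ZE.
rewrite (linearB (@flip_sum C n m)) mulmxBl !mulmxBr !raddfB /=.
rewrite [\tr (flip_sum d *m sg)]flip_selfadj [\tr (d *m flip_sum sg)]mxtrace_mulC.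
rewrite lerBlDr -subr_ge0; set x := \tr (flip_sum sg *m sg).
rewrite (_ : _ - _ = n%:R * (t + eta / t + eta)
   - 2 * \tr (flip_sum sg *m d) + \tr (flip_sum d *m d)); last by ring.
rewrite /flip_sum !mulmx_suml !raddf_sum /= mulr_natl -[X in _ *+ X]card_ord.
rewrite -sumr_const mulr_sumr -sumrB -big_split; apply: sumr_ge0 => i _ /=.
have tr : t \is Num.real by rewrite ger0_real ?ltW.
have := tr_sqr_expand (hF i _ hsg) hd tr; rewrite FF sg1 mulr1.
set a := \tr (_ *m d) => ha.
have := tr_sqr_expand (hF i _ hd) hd (rpredN1 _); rewrite FF.
set b := \tr (conj_shift _ d *m d); rewrite sqrrN expr1n mul1r => hb.
have ha' : 0 <= t - 2 * a + eta / t.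
  rewrite -(pmulr_rge0 _ t0); apply: le_trans ha _.
  rewrite !mulrDr mulrN [t * (eta / t)]mulrC divfK ?gt_eqF // -expr2.
  by rewrite mulrA [t * 2]mulrC lerD2l.
have hb' : 0 <= b + eta.
  rewrite -(pmulr_rge0 _ (ltr0n C 2)); apply: le_trans hb _.
  rewrite [X in X <= _](_ : _ = 2 * (b + \tr (d *m d))); last by ring.
  by rewrite ler_wpM2l ?ler0n // lerD2l.
rewrite (_ : _ + b = (t - 2 * a + eta / t) + (b + eta)); last by ring.
exact: addr_ge0.
Qed.

(** The first identity is Pythagoras. For the second, with [N = 1 - R], the difference of the two
    sides is [tr (N sg N sg)], a trace of a product of positive matrices. *)
Lemma compression_defect k (R sg : 'M[C]_k) (d := sg - R *m sg *m R) :
  herm R -> R *m R = R -> herm sg ->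
  \tr (d *m d) = \tr (sg *m sg) - \tr (R *m sg *m R *m (R *m sg *m R)) /\
  \tr (d *m d) <= 2 * \tr ((1%:M - R) *m (sg *m sg)).
Proof.
move=> hR RR hsg.
have hC := compl_idem hR RR; move: hC; set N := 1%:M - R => -[hN NN].
have Zsg : \tr (R *m sg *m R *m (R *m sg *m R)) = \tr (R *m sg *m R *m sg).
  by rewrite !mulmxA -[_ *m R *m R]mulmxA RR mxtrace_mulC !mulmxA RR.
have sgZ : \tr (sg *m (R *m sg *m R)) = \tr (R *m sg *m R *m sg).
  by rewrite mxtrace_mulC.
have e1 : \tr (d *m d) = \tr (sg *m sg) - \tr (R *m sg *m R *m sg).
  by rewrite mulmxBl !mulmxBr !raddfB /= sgZ Zsg; ring.
split; first by rewrite Zsg e1.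
have ge0 : 0 <= \tr (N *m (sg *m N *m sg)).
  apply: psd_tr_mul; first exact: psd_idem.
  by rewrite -{2}hsg; apply: psd_conj; exact: psd_idem.
have e2 : \tr (N *m (sg *m N *m sg)) = 2 * \tr (N *m (sg *m sg)) - \tr (d *m d).
  rewrite e1 /N !(mulmxBl, mulmxBr, mulmx1, mul1mx) !raddfB /= !mulmxA.
  have -> : \tr (sg *m R *m sg) = \tr (R *m sg *m sg).
    by rewrite -mulmxA mxtrace_mulC.
  by ring.
by rewrite -subr_ge0 -e2.
Qed.


Lemma idem_mul k (N M : 'M[C]_k) : N *m N = N -> M *m M = M -> N *m M = M *m N ->
  (N *m M) *m (N *m M) = N *m M.
Proof.
move=> NN MM c.
by rewrite -mulmxA [M *m (N *m M)]mulmxA -c -mulmxA MM mulmxA NN.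
Qed.

Lemma herm_sandwich k (N M : 'M[C]_k) : herm N -> herm M -> herm (N *m M *m N).
Proof. by move=> hN hM; rewrite /herm !adjM hN hM mulmxA. Qed.

Section OneStep.
Variables (Q sg : 'M[C]_#|W|) (Pi : 'M[C]_#|A|) (L t eta : C).
Hypotheses (QB : inB Q) (hQ : herm Q) (QQ : Q *m Q = Q).
Hypothesis Qcomm : forall X, inB X -> Q *m X = X *m Q.
Hypotheses (hPi : herm Pi) (PiPi : Pi *m Pi = Pi) (invPi : perm_inv Pi).
Hypotheses (psg : psd sg) (sg1 : \tr (sg *m sg) = 1).
Hypothesis def_eta : 2 * (\tr ((1%:M - Q) *m (sg *m sg)) +
                          \tr ((1%:M - liftw Pi) *m (sg *m sg))) <= eta.
Hypotheses (eta1 : eta < 1) (t0 : 0 < t) (L0 : 0 <= L).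
Hypothesis def_L :
  L = 0 \/ L <= \tr (flip_sum sg *m sg) - n%:R * (t + eta / t + eta).

Let P1 := liftw Pi.
Let R := Q *m P1.

Let hP1 : herm P1. Proof. by rewrite /herm liftw_adj hPi. Qed.
Let PP1 : P1 *m P1 = P1. Proof. by rewrite liftwM PiPi. Qed.
Let P1B : inB P1. Proof. exact: inB_lift. Qed.
Let RB : inB R. Proof. exact: inBM. Qed.
Let QP1 : Q *m P1 = P1 *m Q. Proof. exact: Qcomm. Qed.
Let hR : herm R. Proof. by rewrite /herm adjM hQ hP1 -QP1. Qed.
Let RR : R *m R = R.
Proof. exact: idem_mul. Qed.

Let hsg : herm sg. Proof. exact: psd_herm. Qed.

(** A union bound for commuting projections: the difference of the two sides is
    [tr ((1 - Q)(1 - P1) sg^2) >= 0]. *)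
Let tr_compl : \tr ((1%:M - R) *m (sg *m sg)) <=
  \tr ((1%:M - Q) *m (sg *m sg)) + \tr ((1%:M - P1) *m (sg *m sg)).
Proof.
have [hQ' QQ'] := compl_idem hQ QQ; have [hP' PP'] := compl_idem hP1 PP1.
have cQP : (1%:M - Q) *m (1%:M - P1) = (1%:M - P1) *m (1%:M - Q).
  rewrite !(mulmxBl, mulmxBr, mul1mx, mulmx1) QP1.
  by rewrite !opprB addrACA [RHS]addrACA [- _ + _]addrC.
have : 0 <= \tr ((1%:M - Q) *m (1%:M - P1) *m (sg *m sg)).
  apply: psd_tr_mul; last by rewrite -{2}hsg; exact: psd_sqr.
  apply: psd_idem; first by rewrite /herm adjM hQ' hP' -cQP.
  exact: idem_mul.
move=> ge0; rewrite -subr_ge0; apply: le_trans ge0 _; rewrite le_eqVlt; apply/orP; left.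
apply/eqP; rewrite /R !(mulmxBl, mulmxBr, mul1mx, mulmx1) !raddfB /= !mulmxA; ring.
Qed.

Let Z := R *m sg *m R.
(** The additional Kraus operator [R] adds the compression by [R] to the compressed flip sum. This
    shifts the eigenvalue by 1, so it is positive even for [L = 0], and the eigenvector is then
    forced into the range of [R]. *)
Let G (k : unit + 'I_n) := if k is inr i then R *m shiftmx C m (unitb i) *m R else R.

Let hG k : herm (G k).
Proof.
case: k => [[]|i]; first exact: hR.
by apply: herm_sandwich; [exact: hR|exact: shiftmx_herm].
Qed.

Let krausE X : kraus G X = R *m X *m R + R *m flip_sum (R *m X *m R) *m R.
Proof.
rewrite /kraus big_sumType /= (big_pred1 tt) => [|[]] //=; congr (_ + _).
rewrite /flip_sum mulmx_sumr mulmx_suml; apply: eq_bigr => i _.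
by rewrite /conj_shift !mulmxA.
Qed.

Lemma one_step : exists P,
  [/\ psd P, P != 0, inB P & [/\ Q *m P = P, P1 *m P = P & psd (flip_sum P - L *: P)]].
Proof.
have QR : Q *m R = R by rewrite /R mulmxA QQ.
have P1R : P1 *m R = R by rewrite /R QP1 mulmxA PP1.
have RE : R = Q *m P1 by [].
have [dd dd2] := compression_defect hR RR hsg; rewrite -/Z in dd dd2.
clearbody R.
have hZ : herm Z := herm_sandwich hR hsg.
have pZ : psd Z by rewrite /Z -{2}hR; exact: psd_conj.
have RZ : R *m Z = Z by rewrite /Z !mulmxA RR.
have ZR : Z *m R = Z by rewrite /Z -mulmxA RR.
clearbody Z.
have ddeta : \tr ((sg - Z) *m (sg - Z)) <= eta.
  apply: le_trans dd2 (le_trans _ def_eta); rewrite ler_wpM2l ?ler0n //.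
rewrite sg1 in dd.
have sqnZ : sqn Z = \tr (Z *m Z) by rewrite /sqn hZ.
(* By Pythagoras the squared norm of [Z] is [1 - |sg - Z|^2 >= 1 - eta]. *)
have Z0 : Z != 0.
  apply/eqP => Z0; have le1 : 1 <= eta.
    by apply: le_trans ddeta; rewrite dd Z0 mulmx0 mxtrace0 subr0.
  by have := lt_le_trans eta1 le1; rewrite ltxx.
have Zle1 : \tr (Z *m Z) <= 1.
  rewrite -subr_ge0 -dd; have hd : herm (sg - Z) by rewrite /herm adjD adjN hsg hZ.
  by have := sqn_ge0 (sg - Z); rewrite /sqn hd.
have rayleigh : (L + 1) * sqn Z <= \tr (kraus G Z *m Z^t*).
  rewrite krausE RZ ZR hZ mulmxDl raddfD /= sqnZ mulrDl mul1r addrC lerD2l.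
  rewrite -mulmxA RZ -mulmxA [X in _ <= X]mxtrace_mulC -mulmxA ZR.
  (* [L = 0] costs nothing because the flip sum preserves positivity; otherwise [sqn Z <= 1] and
     [0 <= L] allow dropping the norm. *)
  case: def_L => [->|leL].
    by rewrite mul0r; apply: psd_tr_mul => //; exact: psd_flip.
  apply: le_trans (_ : L <= _); first by rewrite ler_piMr.
  apply: le_trans leL _.
  exact: flip_rayleigh.
have [P0 [l [pP0 P00 lL eP0]]] := perron_frobenius hG Z0 rayleigh.
have l0 : l != 0 by rewrite gt_eqF // (lt_le_trans _ lL) // ltr_wpDl.
have RP0 : R *m P0 = P0.
  apply: (scalerI l0); rewrite scalemxAr -eP0 krausE mulmxDr.
  by rewrite !mulmxA RR.
have P0R : P0 *m R = P0.
  by have := congr1 (fun X : 'M[C]_#|W| => X^t*) RP0; rewrite /= adjM hR (psd_herm pP0).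
have eS : R *m flip_sum P0 *m R = (l - 1) *: P0.
  by rewrite scalerBl scale1r -eP0 krausE RP0 P0R addrAC subrr add0r.
pose P := avg P0; have BP : inB P := inB_avg P0.
have pP : psd P := psd_avg pP0.
have RP : R *m P = P by rewrite /P -avgMl // RP0.
have eSP : R *m flip_sum P *m R = (l - 1) *: P.
  by rewrite /P -avg_flip -avgMl // -avgMr // eS avgZ.
have QP : Q *m P = P by rewrite -RP mulmxA QR.
have P1P : P1 *m P = P by rewrite -RP mulmxA P1R.
have PP1' : P *m P1 = P.
  by have := congr1 (fun X : 'M[C]_#|W| => X^t*) P1P; rewrite /= adjM hP1 (psd_herm pP).
have SP1 : flip_sum P *m P1 = flip_sum P by rewrite -flip_lift PP1'.
have hS : herm (flip_sum P) by apply/psd_herm/psd_flip.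
have P1S : P1 *m flip_sum P = flip_sum P.
  by have := congr1 (fun X : 'M[C]_#|W| => X^t*) SP1; rewrite /= adjM hP1 hS.
have QS : Q *m flip_sum P = flip_sum P *m Q by apply/Qcomm/inB_flip.
have QSP : Q *m flip_sum P = (l - 1) *: P.
  have RS : R *m flip_sum P = Q *m flip_sum P by rewrite RE -mulmxA P1S.
  rewrite -eSP RS RE [RHS]mulmxA -[Q *m flip_sum P *m Q]mulmxA -QS.
  by rewrite [Q *m (Q *m _)]mulmxA QQ -mulmxA SP1.
exists P; split=> //.
- apply: contra_neq P00 => P0'; apply: psd_tr_eq0 => //.
  have := tr_avg P0; rewrite -/P P0' mxtrace0 => /esym/eqP.
  by rewrite mulf_eq0 pnatr_eq0 -leqn0 leqNgt fact_gt0 => /eqP.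
- split=> //; have [hQ' QQ'] := compl_idem hQ QQ.
  (* Since [Q] commutes with the flip sum of [P], that matrix splits into [(l - 1) P] on the range
     of [Q] and a positive block on the complement; the inequality thus holds without
     compression. *)
  have -> : flip_sum P - L *: P =
      (l - 1 - L) *: P + (1%:M - Q) *m flip_sum P *m (1%:M - Q)^t*.
    have c : (1%:M - Q) *m flip_sum P = flip_sum P *m (1%:M - Q).
      by rewrite mulmxBl mulmxBr mul1mx mulmx1 QS.
    rewrite hQ' c -mulmxA QQ' mulmxBr mulmx1 -QS QSP.
    by rewrite [(l - 1 - L) *: P]scalerBl [RHS]addrC addrA subrK.
  apply: psdD; last by apply/psd_conj/psd_flip.
  by apply: psdZ => //; rewrite subr_ge0 lerBrDr.
Qed.

End OneStep.
End Step.

(** * Adding solutions until the partial trace has large rank *)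

Section Growth.
Local Open Scope sesquilinear_scope.
Variables (C : numClosedFieldType) (n m : nat).
Local Notation W := {ffun 'I_n -> bool * 'I_m}.
Local Notation A := {ffun 'I_n -> 'I_m}.

Definition permmx (T : finType) (s : 'S_n) : 'M[C]_#|{: {ffun 'I_n -> T}}| := pmx C (@permf n T s).

Lemma permmx_adj (T : finType) s :
  (permmx T s)^t* = permmx T s^-1%g.
Proof.
apply: mentP => x y; rewrite ment_adj !fmxE rmorph_nat; congr (_%:R).
congr nat_of_bool; apply/eqP/eqP => <-; rewrite permfM ?mulVg ?mulgV;
  by apply/ffunP => i; rewrite ffunE perm1.
Qed.

(** Restates invariance as commutation, the form in which it passes to range projections through
    [proj_ortho_comm]. *)
Lemma permmx_comm (T : finType) (X : 'M[C]_#|{: {ffun 'I_n -> T}}|) :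
  (forall s x y, ment X (permf s x) (permf s y) = ment X x y) <->
  (forall s, permmx T s *m X = X *m permmx T s).
Proof.
split=> [inv s|comm s x y].
  apply: mentP => x y; rewrite pmxl -[permmx _ s in RHS]trmxCK permmx_adj.
  rewrite pmxr -(inv s^-1%g) permfM mulVg.
  by congr (ment X _ _); apply/ffunP => i; rewrite ffunE perm1.
have := congr1 (fun Y => ment (Y *m (permmx T s)^t*) x y) (comm s).
rewrite /= pmxr pmxl => ->; rewrite -mulmxA permmx_adj.
rewrite -(permmx_adj T s) mentM (bigD1 y) //= -[permmx T s *m _]mulmx1.
have -> : permmx T s *m (permmx T s)^t* = 1%:M.
  by apply: mentP => u v; rewrite pmxr fmxE ment1 (inj_eq (@permf_inj _ _ s)).
rewrite mulmx1 ment1 eqxx mulr1 big1 ?addr0 // => z /negPf zy.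
by rewrite ment1 zy mulr0.
Qed.

(** With [E] the range projection of [X], [E (X + Y) = X] puts the range of [X] inside that of
    [X + Y]. Equality would put [Y] inside the range of [X], to which it is orthogonal. *)
Lemma mxrank_ortho_add k (X Y : 'M[C]_k) : herm X ->
  proj_ortho X *m Y = 0 -> herm Y -> Y != 0 -> (\rank X < \rank (X + Y)%R)%N.
Proof.
move=> hX EY hY Y0.
have XE : X *m proj_ortho X = X by rewrite proj_ortho_id.
have hE := proj_ortho_herm X.
have EX : proj_ortho X *m X = X.
  have := congr1 (fun Z : 'M[C]_k => Z^t*) XE.
  by move: (proj_ortho X) hE => E hE; rewrite /= adjM hE hX.
have YE : Y *m proj_ortho X = 0.
  have := congr1 (fun Z : 'M[C]_k => Z^t*) EY.
  by move: (proj_ortho X) hE => E hE; rewrite /= adjM hE hY adj0.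
have XXY : (X <= (X + Y)%R)%MS.
  have e : proj_ortho X *m (X + Y) = X by rewrite mulmxDr EX EY addr0.
  by apply/submxP; exists (proj_ortho X); rewrite e.
rewrite ltn_neqAle (mxrankS XXY) andbT (mxrank_leqif_sup XXY).2.
apply: contra Y0 => XYX; have YX : (Y <= X)%MS.
  by rewrite -[Y](addKr X) addmx_sub // eqmx_opp.
by rewrite -(proj_ortho_id YX) YE.
Qed.

(** Solutions form a convex cone, so they can be added. Applying [one_step] with [Pi] the complement
    of the range of the current partial trace yields a solution whose partial trace is orthogonal to
    that range, so the rank grows. Hypothesis [small] keeps the step available while the rank is
    below [N]. *)
Lemma rank_growth (Q sg : 'M[C]_#|W|) (L t eta : C) (N : nat) :
  inB Q -> herm Q -> Q *m Q = Q -> (forall X, inB X -> Q *m X = X *m Q) ->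
  psd sg -> \tr (sg *m sg) = 1 ->
  (forall E : 'M[C]_#|A|, herm E -> E *m E = E -> (\rank E < N)%N ->
     2 * (\tr ((1%:M - Q) *m (sg *m sg)) + \tr (liftw E *m (sg *m sg))) <= eta) ->
  eta < 1 -> 0 < t -> 0 <= L ->
  L = 0 \/ L <= \tr (flip_sum sg *m sg) - n%:R * (t + eta / t + eta) ->
  exists P, [/\ psd P, inB P, Q *m P = P, psd (flip_sum P - L *: P) &
                (N <= \rank (ptrace P))%N].
Proof.
move=> QB hQ QQ Qc psg sg1 small eta1 t0 L0 defL.
suff H k : (k <= N)%N -> exists P,
    [/\ psd P, inB P, Q *m P = P, psd (flip_sum P - L *: P) & (k <= \rank (ptrace P))%N].
  exact: H.
elim: k => [_|k IH kN].
  exists 0; rewrite mulmx0 linear0 scaler0 subr0; split=> //; try exact: psd0.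
  by split=> [w w' _|s w w']; rewrite !ment0.
have [P [pP BP QP SP kP]] := IH (ltnW kN).
have [kP'|kP'] := ltnP k (\rank (ptrace P)); first by exists P.
have rkP : \rank (ptrace P) = k by apply/eqP; rewrite eqn_leq kP kP'.
pose K := ptrace P; have pK : psd K := psd_ptrace pP.
have hK : herm K := psd_herm pK.
have hE := proj_ortho_herm K; have EE := proj_ortho_proj K; rewrite /= in EE.
have invE : perm_inv (proj_ortho K).
  have cK := (permmx_comm K).1 (perm_inv_ptrace BP).
  apply/(permmx_comm _).2 => s; apply/esym/proj_ortho_comm; rewrite ?permmx_adj -cK;
  exact: submxMl.
have rkE : (\rank (proj_ortho K) < N)%N by rewrite proj_ortho_rank rkP.
have EK : proj_ortho K *m K = K.
  have := congr1 (fun Z : 'M[C]_#|A| => Z^t*) (proj_ortho_id (submx_refl K)).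
  by move: (proj_ortho K) hE => E hE; rewrite /= adjM hE hK.
have [hPi PiPi] := compl_idem hE EE.
have liftE : 1%:M - liftw (1%:M - proj_ortho K) = liftw (proj_ortho K).
  by rewrite liftwB liftw1 opprB addrC subrK.
have invPi : perm_inv (1%:M - proj_ortho K).
  by move=> s a b; rewrite !mentD !mentN invE !ment1 (inj_eq (@permf_inj _ _ s)).
have bound := small _ hE EE rkE; rewrite -liftE in bound.
have [P' [pP' P'0 BP' [QP' PP' SP']]] :=
  one_step QB hQ QQ Qc hPi PiPi invPi psg sg1 bound eta1 t0 L0 defL.
exists (P + P'); split.
- exact: psdD.
- exact: inBD.
- by rewrite mulmxDr QP QP'.
- by rewrite linearD /= scalerDr opprD addrACA; exact: psdD.
rewrite ptraceD -rkP; apply: mxrank_ortho_add => //.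
- by rewrite -PP' ptrace_lift mulmxA mulmxBr mulmx1 EE subrr mul0mx.
- exact/psd_herm/psd_ptrace.
- apply: contra_neq P'0 => K0; apply: psd_tr_eq0 => //.
  by rewrite -tr_ptrace K0 mxtrace0.
Qed.

End Growth.

(** * The algebra of invariant block-diagonal matrices *)

Section CentralCover.
Local Open Scope sesquilinear_scope.
Variables (C : numClosedFieldType) (n m : nat).
Local Notation J := (bool * 'I_m)%type.
Local Notation W := {ffun 'I_n -> bool * 'I_m}.
Local Notation B := {ffun 'I_n -> bool}.
Local Notation Ty := {ffun J * J -> 'I_n.+1}.

Lemma same_count_perm (T : eqType) (w z : {ffun 'I_n -> T}) :
  (forall x, \sum_i (w i == x) = \sum_i (z i == x))%N -> exists s, z = permf s w.
Proof.
move=> cnt; pose tu (v : {ffun 'I_n -> T}) := [tuple v i | i < n].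
have cntE v x : count_mem x (tu v) = (\sum_i (v i == x))%N.
  rewrite -sum1_count big_map big_mkcond /= big_enum /=.
  by apply: eq_bigr => i _; case: (_ == _).
have : perm_eq (tu z) (tu w) by apply/allP => x _ /=; rewrite !cntE cnt.
case/tuple_permP => s e; exists s; apply/ffunP => i; rewrite ffunE.
have := congr1 (fun t => nth (z i) t i) e.
by rewrite -!tnth_nth !tnth_mktuple.
Qed.

Definition paircount (w w' : W) (p : J * J) : nat := \sum_i ((w i, w' i) == p).

(** The joint type of two words, a complete invariant of the S_n-orbit of the pair
    ([pairtype_orbit]). Counts are at most [n], so [inord] loses nothing. *)
Definition pairtype (w w' : W) : Ty := [ffun p => inord (paircount w w' p)].

Lemma pairtype_perm s w w' : pairtype (permf s w) (permf s w') = pairtype w w'.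
Proof.
apply/ffunP => p; rewrite !ffunE /paircount [in RHS](reindex_inj (@perm_inj _ s)).
by congr inord; apply: eq_bigr => i _; rewrite !ffunE.
Qed.

Lemma pairtype_orbit w w' z z' : pairtype w w' = pairtype z z' ->
  exists s, z = permf s w /\ z' = permf s w'.
Proof.
move=> e; have cnt p : paircount w w' p = paircount z z' p.
  have le v v' : (paircount v v' p < n.+1)%N.
    rewrite ltnS -[X in (_ <= X)%N](card_ord n) -sum1_card.
    by apply: leq_sum => i _; case: (_ == _).
  by have := congr1 (fun f : Ty => nat_of_ord (f p)) e; rewrite !ffunE !inordK.
have [|s /ffunP zs] := @same_count_perm _ [ffun i => (w i, w' i)] [ffun i => (z i, z' i)].
  by move=> p; under eq_bigr do rewrite ffunE; under [RHS]eq_bigr do rewrite ffunE; exact: cnt.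
by exists s; split; apply/ffunP => i; have := zs i; rewrite !ffunE => -[].
Qed.

Definition typemx (tau : Ty) : 'M[C]_#|W| :=
  fmx (fun w w' => ((bits w == bits w') && (pairtype w w' == tau))%:R).

Lemma inB_typemx tau : inB (typemx tau).
Proof.
split=> [w w' /negPf ww'|s w w']; rewrite !fmxE ?ww' //.
by rewrite !bits_perm (inj_eq (@permf_inj _ _ s)) pairtype_perm.
Qed.

(** An invariant matrix is constant on orbits of pairs, so its coefficients are read off at any
    representative. The dimension of the algebra is thus bounded by the number of types. *)
Lemma typemx_span X : inB X -> exists c : Ty -> C, X = \sum_tau c tau *: typemx tau.
Proof.
move=> [bX sX].
exists (fun tau => if [pick p : W * W | pairtype p.1 p.2 == tau] is Some p
                   then ment X p.1 p.2 else 0).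
apply: mentP => w w'; rewrite ment_sum (bigD1 (pairtype w w')) //=.
rewrite [X in _ + X]big1 ?addr0 => [|tau /negPf ne]; last first.
  by rewrite mentZ fmxE [_ == tau]eq_sym ne andbF mulr0.
rewrite mentZ fmxE eqxx andbT; have [e|ne] := eqVneq (bits w) (bits w'); last first.
  by rewrite mulr0 bX.
rewrite mulr1; case: pickP => [[z z'] /= /eqP ez|/(_ (w, w'))]; last by rewrite eqxx.
by have [s [-> ->]] := pairtype_orbit ez; rewrite sX.
Qed.

Lemma inBP (X : 'M[C]_#|W|) :
  (forall u, @bitproj C n m u *m X = X *m @bitproj C n m u) ->
  (forall s, permmx C _ s *m X = X *m permmx C _ s) -> inB X.
Proof.
move=> cb cp; split; last exact/permmx_comm.
move=> w w' ww'; have := congr1 (fun Y => ment Y w w') (cb (bits w)).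
by rewrite /= bitprojMl bitprojMr eqxx eq_sym (negPf ww') mul1r mul0r.
Qed.

Lemma inB_bitproj (X : 'M[C]_#|W|) u : inB X -> @bitproj C n m u *m X = X *m @bitproj C n m u.
Proof.
move=> [bX _]; apply: mentP => w w'; rewrite bitprojMl bitprojMr.
by have [->//|/bX->] := eqVneq (bits w) (bits w'); rewrite !mulr0.
Qed.

Lemma inB_permmx (X : 'M[C]_#|W|) s : inB X -> permmx C _ s *m X = X *m permmx C _ s.
Proof. by move=> [_ sX]; exact: (permmx_comm _).1. Qed.

(* The algebra of [inB] matrices has dimension polynomial in [n], so the smallest
   invariant subspace containing the range of [T] is not much larger than it. *)
Lemma central_cover (T : 'M[C]_#|W|) : inB T -> exists Q : 'M[C]_#|W|,
  [/\ inB Q, herm Q, Q *m Q = Q, (forall X, inB X -> Q *m X = X *m Q) &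
      T *m Q = T /\ (\rank Q <= #|{: Ty}| * \rank T)%N].
Proof.
move=> BT; pose V := (\sum_tau <<T *m typemx tau>>)%MS.
have TV tau : (T *m typemx tau <= V)%MS.
  by apply: (sumsmx_sup tau) => //; rewrite genmxE.
have TX X : inB X -> (T *m X <= V)%MS.
  move=> /typemx_span[c ->]; rewrite mulmx_sumr; apply: summx_sub => tau _.
  by rewrite -scalemxAr scalemx_sub.
have VX X : (forall tau, (T *m typemx tau *m X <= V)%MS) -> (V *m X <= V)%MS.
  move=> TBX; rewrite sumsmxMr; apply/sumsmx_subP => tau _.
  by apply: submx_trans (TBX tau); rewrite submxMr // genmxE.
have VB X : inB X -> (V *m X <= V)%MS.
  move=> BX; apply: VX => tau; rewrite -mulmxA; apply: TX.
  by apply: inBM => //; exact: inB_typemx.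
(* [V] is spanned by row spaces of elements of the algebra, so the commutant preserves it. Applied
   to bit projections and permutations, this puts the projection onto [V] in the algebra, while [VB]
   makes it commute with the algebra. *)
have Vcomm D : (forall X, inB X -> D *m X = X *m D) -> (V *m D <= V)%MS.
  move=> cD; apply: VX => tau; rewrite -cD; last by apply: inBM => //; exact: inB_typemx.
  exact: submx_trans (submxMl _ _) (TV tau).
exists (proj_ortho V); split.
- apply: inBP => [u|s].
    apply/esym/proj_ortho_comm; rewrite ?bitproj_herm; apply: Vcomm => X;
    exact: inB_bitproj.
  apply/esym/proj_ortho_comm; rewrite ?permmx_adj; apply: Vcomm => X;
  exact: inB_permmx.
- exact: proj_ortho_herm.
- exact: proj_ortho_proj.
- move=> X BX; apply: proj_ortho_comm; apply: VB => //; exact: inB_adj.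
split.
  by apply: proj_ortho_id; rewrite -[T]mulmx1; apply: TX; exact: inB1.
rewrite proj_ortho_rank; apply: leq_trans (_ : \sum_(tau : Ty) \rank T <= _)%N; last first.
  by rewrite sum_nat_const.
apply: (big_rec2 (fun (M : 'M[C]_#|W|) k => (\rank M <= k)%N)) => [|tau k M _ Mk].
  by rewrite mxrank0.
apply: leq_trans (mxrank_adds_leqif _ _).1 _; rewrite leq_add //.
by rewrite genmxE mxrankM_maxl.
Qed.

End CentralCover.

(** * Tensor powers and typical subspaces *)

Section TensorPowers.
Local Open Scope sesquilinear_scope.
Variables (C : numClosedFieldType) (n : nat).

Section Letters.
Variable J : finType.
Local Notation W := {ffun 'I_n -> J}.

Lemma sum_prod2 (F : 'I_n -> J -> J -> C) :
  \sum_(w : W) \sum_(w' : W) \prod_i F i (w i) (w' i) = \prod_i \sum_x \sum_y F i x y.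
Proof.
rewrite bigA_distr_bigA /=; apply: eq_bigr => w _.
by rewrite -(bigA_distr_bigA (fun i y => F i (w i) y)).
Qed.

Definition tens (s : J -> J -> C) : 'M[C]_#|{: W}| :=
  fmx (fun w w' : W => \prod_i s (w i) (w' i)).

Lemma tensM s t : tens s *m tens t = tens (fun x y => \sum_z s x z * t z y).
Proof.
apply: mentP => w w'; rewrite mentM fmxE bigA_distr_bigA.
by apply: eq_bigr => z _; rewrite !fmxE -big_split.
Qed.

Lemma eq_tens s t : (forall x y, s x y = t x y) -> tens s = tens t.
Proof. by move=> st; apply: mentP => w w'; rewrite !fmxE; apply: eq_bigr. Qed.

Lemma tens_adj s : (tens s)^t* = tens (fun x y => (s y x)^*).
Proof. by apply: mentP => w w'; rewrite ment_adj !fmxE rmorph_prod. Qed.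

Definition dmx (T : finType) (f : T -> C) : 'M[C]_#|T| := fmx (fun x y => (x == y)%:R * f x).

Lemma tens_diag (f : J -> C) :
  tens (fun x y => (x == y)%:R * f x) = dmx (fun w : W => \prod_i f (w i)).
Proof.
apply: mentP => w w'; rewrite !fmxE big_split /=; congr (_ * _).
have [->|ne] := eqVneq w w'; first by rewrite big1 // => i _; rewrite eqxx.
have [i wi] : exists i, w i != w' i.
  apply/existsP; apply: contraNT ne; rewrite negb_exists => /forallP e.
  by apply/eqP/ffunP => i; apply/eqP; have := e i; rewrite negbK.
by rewrite (bigD1 i) //= (negPf wi) mul0r.
Qed.

Lemma eq_dmx (T : finType) (f g : T -> C) : f =1 g -> dmx f = dmx g.
Proof. by move=> fg; apply: mentP => x y; rewrite !fmxE fg. Qed.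

Lemma dmx1 (T : finType) : dmx (fun _ : T => 1) = 1%:M.
Proof. by apply: mentP => x y; rewrite fmxE ment1 mulr1. Qed.

Lemma dmxMl (T : finType) (f : T -> C) X x y : ment (dmx f *m X) x y = f x * ment X x y.
Proof.
rewrite mentM (bigD1 x) //= fmxE eqxx mul1r big1 ?addr0 // => z /negPf zx.
by rewrite fmxE eq_sym zx !mul0r.
Qed.

Lemma dmxMr (T : finType) (f : T -> C) X x y : ment (X *m dmx f) x y = f y * ment X x y.
Proof.
rewrite mentM (bigD1 y) //= fmxE eqxx mul1r big1 ?addr0 => [|z /negPf zy].
  by rewrite mulrC.
by rewrite fmxE zy mul0r mulr0.
Qed.

Lemma dmxM (T : finType) (f g : T -> C) : dmx f *m dmx g = dmx (fun x => f x * g x).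
Proof. by apply: mentP => x y; rewrite dmxMl !fmxE mulrCA. Qed.

Lemma tr_dmxM (T : finType) (f : T -> C) (X : 'M[C]_#|T|) :
  \tr (dmx f *m X) = \sum_x f x * ment X x x.
Proof. by rewrite ment_tr; apply: eq_bigr => x _; rewrite dmxMl. Qed.

Lemma tr_dmx (T : finType) (f : T -> C) : \tr (dmx f) = \sum_x f x.
Proof.
by rewrite -[dmx f]mulmx1 tr_dmxM; apply: eq_bigr => x _; rewrite ment1 eqxx mulr1.
Qed.

Lemma dmx_herm (T : finType) (f : T -> C) : (forall x, f x \is Num.real) -> herm (dmx f).
Proof.
move=> fr; apply: mentP => x y; rewrite ment_adj !fmxE rmorphM rmorph_nat /= (CrealP (fr y)).
by rewrite eq_sym; case: eqP => [->|_] //; rewrite !mul0r.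
Qed.

Lemma psd_dmx (T : finType) (f : T -> C) : (forall x, 0 <= f x) -> psd (dmx f).
Proof.
move=> f0; have -> : dmx f = dmx (fun x => sqrtC (f x)) *m (dmx (fun x => sqrtC (f x)))^t*.
  have -> : (dmx (fun x => sqrtC (f x)))^t* = dmx (fun x => sqrtC (f x)).
    by apply: dmx_herm => x; rewrite ger0_real // sqrtC_ge0.
  rewrite dmxM; apply: mentP => x y; rewrite !fmxE; congr (_ * _).
  by rewrite -expr2 sqrtCK.
exact: psd_sqr.
Qed.

Lemma ment_diag_ge0 (T : finType) (X : 'M[C]_#|T|) x : psd X -> 0 <= ment X x x.
Proof. by move=> pX; rewrite /ment mxE_delta; exact: pX. Qed.

Section Framed.
Variables (T : finType) (U : 'M[C]_#|T|).

(** The matrix with eigenvalues [f] in the frame formed by the rows of [U]. *)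
Definition framed (f : T -> C) : 'M[C]_#|T| := U^t* *m dmx f *m U.

Lemma eq_framed f g : f =1 g -> framed f = framed g.
Proof. by move=> fg; rewrite /framed (eq_dmx fg). Qed.

Lemma framedD f g : framed f + framed g = framed (fun x => f x + g x).
Proof.
rewrite /framed -mulmxDl -mulmxDr; congr (_ *m _ *m _).
by apply: mentP => x y; rewrite mentD !fmxE mulrDr.
Qed.

Lemma psd_framed f : (forall x, 0 <= f x) -> psd (framed f).
Proof. by move=> f0; rewrite /framed -{2}[U]trmxCK; apply/psd_conj/psd_dmx. Qed.

Lemma herm_framed f : (forall x, f x \is Num.real) -> herm (framed f).
Proof. by move=> /dmx_herm hf; rewrite /herm /framed !adjM hf trmxCK mulmxA. Qed.

Lemma tr_framedM f X : \tr (framed f *m X) = \sum_x f x * ment (U *m X *m U^t*) x x.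
Proof. by rewrite /framed -!mulmxA mxtrace_mulC -!mulmxA tr_dmxM mulmxA. Qed.

Hypothesis UU : U *m U^t* = 1%:M.

Lemma framedM f g : framed f *m framed g = framed (fun x => f x * g x).
Proof.
by rewrite /framed !mulmxA -[_ *m U *m _]mulmxA UU mulmx1 -[_ *m dmx f *m _]mulmxA dmxM.
Qed.

Lemma tr_framed f : \tr (framed f) = \sum_x f x.
Proof. by rewrite /framed mxtrace_mulC mulmxA UU mul1mx tr_dmx. Qed.

End Framed.

End Letters.

Lemma tens_mx m (M N : 'M[C]_m) :
  tens (fun x y => M x y) *m tens (fun x y => N x y) = tens (fun x y => (M *m N) x y).
Proof. by rewrite tensM; apply: eq_tens => x y; rewrite mxE. Qed.

Lemma tens_mx_adj m (M : 'M[C]_m) :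
  (tens (fun x y => M x y))^t* = tens (fun x y => (M^t*) x y).
Proof. by rewrite tens_adj; apply: eq_tens => x y; rewrite !mxE. Qed.

Lemma tens_mx1 m : tens (fun x y => (1%:M : 'M[C]_m) x y) = 1%:M.
Proof.
rewrite -(dmx1 {ffun 'I_n -> 'I_m}).
have -> : dmx (fun _ : {ffun 'I_n -> 'I_m} => 1) = dmx (fun w => \prod_(i < n) 1).
  by apply: mentP => x y; rewrite !fmxE big1.
rewrite -(tens_diag (fun=> 1)); apply: eq_tens => x y; by rewrite mxE mulr1.
Qed.

Section Blocks.
Variable m : nat.
Local Notation J := (bool * 'I_m)%type.
Local Notation W := {ffun 'I_n -> bool * 'I_m}.

(** The direct sum [M (+) N], the bit of a letter selecting the summand. *)
Definition blk (M N : 'M[C]_m) (x y : J) : C :=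
  (x.1 == y.1)%:R * (if x.1 then N else M) x.2 y.2.

Definition tens2 (M N : 'M[C]_m) : 'M[C]_#|W| := tens (blk M N).

Lemma blkM M N M' N' x y :
  \sum_z blk M N x z * blk M' N' z y = blk (M *m M') (N *m N') x y.
Proof.
rewrite -(pair_bigA _ (fun b k => blk M N x (b, k) * blk M' N' (b, k) y)) /=.
rewrite (bigD1 x.1) //= [X in _ + X]big1 ?addr0 => [|b /negPf bx]; last first.
  by rewrite big1 // => k _; rewrite /blk /= eq_sym bx !mul0r.
rewrite {3}/blk; under eq_bigr => k _ do rewrite /blk /= eqxx mul1r mulrCA.
by rewrite -mulr_sumr; case: x.1; rewrite mxE.
Qed.

Lemma tens2M M N M' N' : tens2 M N *m tens2 M' N' = tens2 (M *m M') (N *m N').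
Proof. by rewrite /tens2 tensM; apply: eq_tens => x y; rewrite blkM. Qed.

Lemma tens2_adj M N : (tens2 M N)^t* = tens2 (M^t*) (N^t*).
Proof.
rewrite /tens2 tens_adj; apply: eq_tens => x y.
rewrite /blk rmorphM rmorph_nat eq_sym.
by case: eqP => [->|_]; rewrite ?mul0r // !mul1r; case: y.1; rewrite !mxE.
Qed.

Lemma tens2_diag (d e : 'rV[C]_m) : tens2 (diag_mx d) (diag_mx e) =
  dmx (fun w : W => \prod_i (if (w i).1 then e 0 (w i).2 else d 0 (w i).2)).
Proof.
rewrite -(tens_diag (fun x : J => if x.1 then e 0 x.2 else d 0 x.2)).
apply: eq_tens => -[b i] [c j]; rewrite /blk /= xpair_eqE.
case: eqP => [_|_] /=; last by rewrite !mul0r.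
by case: b; rewrite mxE; case: eqP => _; rewrite ?mulr1n ?mulr0n ?mulr0 ?mul1r ?mul0r.
Qed.

Lemma tens2_1 : tens2 1%:M 1%:M = 1%:M.
Proof.
rewrite -diag_const_mx tens2_diag -dmx1; apply: mentP => x y; rewrite !fmxE.
by congr (_ * _); rewrite big1 // => i _; case: ifP; rewrite !mxE.
Qed.

Lemma inB_tens2 M N : inB (tens2 M N).
Proof.
split=> [w w' ww'|s w w']; rewrite !fmxE.
  have [i wi] : exists i, (w i).1 != (w' i).1.
    apply/existsP; apply: contraNT ww'; rewrite negb_exists => /forallP e.
    by apply/eqP/ffunP => i; apply/eqP; have := e i; rewrite negbK !ffunE.
  by rewrite (bigD1 i) //= /blk (negPf wi) !mul0r.
rewrite [RHS](reindex_inj (@perm_inj _ s)); apply: eq_bigr => i _.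
by rewrite !ffunE.
Qed.

Lemma inB_dmx (f : W -> C) : (forall s w, f (permf s w) = f w) -> inB (dmx f).
Proof.
move=> fs; split=> [w w' ww'|s w w']; rewrite !fmxE ?fs ?(inj_eq (@permf_inj _ _ s)) //.
by have [e|_] := eqVneq w w'; [rewrite e eqxx in ww'|rewrite mul0r].
Qed.

Lemma ptrace_tens2 M N : ptrace (tens2 M N) = tens (fun x y => (M + N) x y).
Proof.
apply: mentP => a b; rewrite !fmxE.
have -> : \prod_i (M + N) (a i) (b i)
    = \prod_(i < n) \sum_(c : bool) (if c then N else M) (a i) (b i).
  by apply: eq_bigr => i _; rewrite big_bool mxE addrC.
rewrite bigA_distr_bigA; apply: eq_bigr => u _; rewrite fmxE; apply: eq_bigr => i _.
by rewrite !ffunE /blk /= eqxx mul1r.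
Qed.

(** The flip at [i] swaps [M] and [N] in that coordinate only. It contributes [tr (N M) + tr (M N)],
    and every other coordinate contributes the factor 1. *)
Lemma tr_tens2_flip M N : \tr (M *m M) + \tr (N *m N) = 1 ->
  \tr (flip_sum (tens2 M N) *m tens2 M N) = n%:R * (2 * \tr (M *m N)).
Proof.
move=> MN1; rewrite /flip_sum mulmx_suml raddf_sum /=.
rewrite mulr_natl -[in RHS](card_ord n) -sumr_const; apply: eq_bigr => i _.
have bsum (P Q P' Q' : 'M[C]_m) : \sum_x \sum_y blk P Q x y * blk P' Q' y x
    = \tr (P *m P') + \tr (Q *m Q').
  under eq_bigr => x _ do rewrite blkM.
  rewrite -(pair_bigA _ (fun b k => blk (P *m P') (Q *m Q') (b, k) (b, k))) /=.
  rewrite big_bool addrC; congr (_ + _); apply: eq_bigr => k _;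
  by rewrite /blk /= mul1r.
pose F k : J -> J -> C := if k == i then blk N M else blk M N.
have FE w w' : ment (conj_shift (unitb i) (tens2 M N)) w w' = \prod_k F k (w k) (w' k).
  rewrite conj_shiftE fmxE; apply: eq_bigr => k _.
  rewrite /F !ffunE /=; case: eqP => _ //=; rewrite /blk /=.
  by congr (_ * _); [congr (_%:R); case: (w k).1; case: (w' k).1|case: (w k).1].
rewrite ment_tr.
under eq_bigr => w _.
  rewrite mentM; under eq_bigr => w' _ do rewrite FE fmxE -big_split /=.
  over.
rewrite (sum_prod2 (fun k x y => F k x y * blk M N y x)).
rewrite (bigD1 i) //= [X in _ * X]big1 ?mulr1 => [|k /negPf ki].
  by rewrite /F eqxx bsum [\tr (N *m M)]mxtrace_mulC; ring.
by rewrite /F ki bsum.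
Qed.

End Blocks.
End TensorPowers.

(** * The weak law of large numbers for log-probabilities *)

Section WeakLaw.
Variables (R : realType) (J : finType) (p : J -> R) (n : nat).
Hypotheses (p0 : forall x, 0 <= p x) (p1 : \sum_x p x = 1) (n0 : (0 < n)%N).
Local Notation W := {ffun 'I_n -> J}.

Definition wprod (w : W) : R := \prod_i p (w i).

Lemma wprod_ge0 w : 0 <= wprod w.
Proof. by apply: prodr_ge0. Qed.

Lemma sum_wprod : \sum_w wprod w = 1.
Proof. by rewrite -(bigA_distr_bigA (fun _ => p)) big1. Qed.

(** Variance of a sum of independent centered variables: the mixed terms factor through the mean
    0. *)
Lemma sum_wprod_sqr (g : J -> R) : \sum_x p x * g x = 0 ->
  \sum_w wprod w * (\sum_i g (w i)) ^+ 2 = n%:R * \sum_x p x * g x ^+ 2.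
Proof.
move=> pg0; have E2 i j : \sum_(w : W) wprod w * (g (w i) * g (w j)) =
    if i == j then \sum_x p x * g x ^+ 2 else 0.
  pose F k x := p x * ((if k == i then g x else 1) * (if k == j then g x else 1)).
  have -> : \sum_(w : W) wprod w * (g (w i) * g (w j)) = \prod_k \sum_x F k x.
    rewrite bigA_distr_bigA; apply: eq_bigr => w _; rewrite !big_split /=.
    congr (_ * (_ * _)); rewrite -big_mkcond /= big_pred1_eq //.
  have F1 k : k != i -> k != j -> \sum_x F k x = 1.
    move=> /negPf ki /negPf kj; rewrite /F ki kj -[RHS]p1.
    by apply: eq_bigr => x _; rewrite !mulr1.
  have [e|ij] := eqVneq i j.
    rewrite (bigD1 i) //= [X in _ * X]big1 ?mulr1 => [|k ki]; last by apply: (F1 k ki); rewrite -e.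
    by apply: eq_bigr => x _; rewrite /F -e eqxx expr2.
  rewrite (bigD1 i) //= [X in X * _](_ : _ = 0) ?mul0r // -[RHS]pg0.
  by apply: eq_bigr => x _; rewrite /F eqxx (negPf ij) mulr1.
under eq_bigr => w _.
  rewrite expr2 mulr_suml mulr_sumr.
  under eq_bigr => i _ do rewrite mulr_sumr mulr_sumr.
  over.
rewrite exchange_big /=.
under eq_bigr => i _.
  rewrite exchange_big /=.
  under eq_bigr => j _ do rewrite E2.
  rewrite -big_mkcond /= (big_pred1 i) => [|j]; last by rewrite eq_sym.
  over.
by rewrite sumr_const card_ord mulr_natl.
Qed.

(** In nats; the conversion to [Ent], which is in bits, is made in [entropy_pair] and
    [entropy_sum]. *)
Definition entropy : R := - \sum_x p x * ln (p x).
Definition varentropy : R := \sum_x p x * (ln (p x) + entropy) ^+ 2.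

Lemma varentropy_ge0 : 0 <= varentropy.
Proof. by apply: sumr_ge0 => x _; rewrite mulr_ge0 ?sqr_ge0. Qed.

Lemma ln_prod (I : finType) (F : I -> R) : (forall i, 0 < F i) ->
  ln (\prod_i F i) = \sum_i ln (F i).
Proof.
move=> F0; suff [] : 0 < \prod_i F i /\ ln (\prod_i F i) = \sum_i ln (F i) by [].
apply: (big_ind2 (fun x y => 0 < x /\ ln x = y)) => [|x1 x2 y1 y2 [x10 <-] [y10 <-]|//].
  by rewrite ln1.
by rewrite mulr_gt0 // lnM.
Qed.

(** Chebyshev's inequality for [ln (wprod w)]. Words of probability 0 are treated apart, since
    [ln 0 = 0] breaks the additivity of the logarithm there. *)
Lemma atypical_mass (bad : pred W) (eps : R) : 0 < eps ->
  (forall w, bad w -> 0 < wprod w ->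
     (n%:R * eps) ^+ 2 <= (ln (wprod w) + n%:R * entropy) ^+ 2) ->
  \sum_(w | bad w) wprod w <= varentropy / (n%:R * eps ^+ 2).
Proof.
move=> eps0 badP; pose g x := ln (p x) + entropy.
have pg : \sum_x p x * g x = 0.
  rewrite /g; under eq_bigr do rewrite mulrDr.
  by rewrite big_split /= -mulr_suml p1 mul1r /entropy subrr.
have nR : 0 < n%:R :> R by rewrite ltr0n.
rewrite ler_pdivlMr ?mulr_gt0 ?exprn_gt0 // mulrC.
rewrite -(ler_pM2l nR) mulrA mulrA -expr2 -exprMn -sum_wprod_sqr // mulr_sumr.
rewrite big_mkcond /=; apply: ler_sum => w _.
case: ifP => [bw|_]; last by rewrite mulr_ge0 ?wprod_ge0 ?sqr_ge0.
have [w0|w0] := eqVneq (wprod w) 0; first by rewrite w0 mulr0 mul0r.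
have wpos : 0 < wprod w by rewrite lt_def w0 wprod_ge0.
rewrite mulrC ler_wpM2l ?wprod_ge0 //; apply: le_trans (badP w bw wpos) _.
rewrite le_eqVlt; apply/orP; left; apply/eqP; congr (_ ^+ 2).
rewrite big_split /= sumr_const card_ord mulr_natl; congr (_ + _).
rewrite /wprod ln_prod // => i; rewrite lt_def p0 andbT.
by apply: contraNneq w0 => e; rewrite /wprod (bigD1 i) //= e mul0r.
Qed.

Lemma low_mass (eps : R) : 0 < eps ->
  \sum_(w | wprod w < expR (- (n%:R * (entropy + eps)))) wprod w
  <= varentropy / (n%:R * eps ^+ 2).
Proof.
move=> eps0; apply: atypical_mass => // w lt0 w0.
have : ln (wprod w) < - (n%:R * (entropy + eps)).
  by rewrite -ltr_expR lnK // posrE.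
rewrite mulrDr opprD => ltw.
rewrite -[in leRHS]sqrrN ler_sqr ?nnegrE ?mulr_ge0 ?ler0n ?(ltW eps0) //.
  by lra.
have : 0 <= n%:R * eps by rewrite mulr_ge0 ?ler0n ?ltW.
by lra.
Qed.

Lemma high_mass (eps : R) : 0 < eps ->
  \sum_(w | expR (- (n%:R * (entropy - eps))) < wprod w) wprod w
  <= varentropy / (n%:R * eps ^+ 2).
Proof.
move=> eps0; apply: atypical_mass => // w lt0 w0.
have : - (n%:R * (entropy - eps)) < ln (wprod w).
  by rewrite -ltr_expR lnK // posrE.
rewrite mulrBr opprB => ltw.
rewrite ler_sqr ?nnegrE ?mulr_ge0 ?ler0n ?(ltW eps0) //.
  by lra.
have : 0 <= n%:R * eps by rewrite mulr_ge0 ?ler0n ?ltW.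
by lra.
Qed.

(** Each word counted has at least the threshold probability, and the total probability is 1. *)
Lemma card_typical (eps : R) :
  #|[pred w | expR (- (n%:R * (entropy + eps))) <= wprod w]|%:R
  <= expR (n%:R * (entropy + eps)).
Proof.
rewrite -[X in _ <= X]mul1r -ler_pdivrMr ?expR_gt0 // -expRN -[X in _ <= X]sum_wprod.
rewrite -sum1_card natr_sum mulr_suml big_mkcond /=; apply: ler_sum => w _.
by rewrite inE; case: ifP => [|_]; rewrite ?mul1r // wprod_ge0.
Qed.

End WeakLaw.

(** * Spectral data and typical subspaces of a Horn pair *)

Section HornFamily.
Local Open Scope sesquilinear_scope.
Variable R : realType.
Local Notation C := R[i].

Definition eigv m (A : 'M[C]_m) (i : 'I_m) : R := complex.Re (spectral_diag A 0 i).

Lemma spectral_diagE m (A : 'M[C]_m) i :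
  herm A -> spectral_diag A 0 i = (eigv A i)%:C%C.
Proof. by move=> /herm_spec[_ _ dr _]; rewrite /eigv RRe_real. Qed.

Lemma mxfunE m (f : R -> R) (A : 'M[C]_m) : mxfun f A =
  (spectralmx A)^t* *m diag_mx (\row_i (f (eigv A i))%:C%C) *m spectralmx A.
Proof.
rewrite /mxfun (invmx_unitary (spectral_unitarymx A)).
by rewrite (_ : map_mx _ _ = \row_i (f (eigv A i))%:C%C) //; apply/rowP => i; rewrite !mxE.
Qed.

Lemma hermE m (A : 'M[C]_m) : herm A ->
  A = (spectralmx A)^t* *m diag_mx (\row_i (eigv A i)%:C%C) *m spectralmx A.
Proof.
move=> hA; have [_ _ _ {1}->] := herm_spec hA.
rewrite (_ : spectral_diag A = \row_i (eigv A i)%:C%C) //.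
by apply/rowP => i; rewrite mxE spectral_diagE.
Qed.

Lemma mxfun_mul m (f g : R -> R) (A : 'M[C]_m) :
  mxfun f A *m mxfun g A = mxfun (fun x => f x * g x) A.
Proof.
have /unitarymxP UU := spectral_unitarymx A.
rewrite !mxfunE -!mulmxA; congr (_ *m _).
rewrite !mulmxA -[_ *m spectralmx A *m _]mulmxA UU mulmx1 mulmx_diag.
congr (diag_mx _ *m _); apply/rowP => i; rewrite !mxE.
by rewrite -rmorphM.
Qed.

Lemma mxfun_id m (A : 'M[C]_m) : herm A -> mxfun id A = A.
Proof. by move=> hA; rewrite mxfunE -hermE. Qed.

Lemma tr_mxfun m f (A : 'M[C]_m) : \tr (mxfun f A) = (\sum_i f (eigv A i))%:C%C.
Proof.
rewrite mxfunE -[X in \tr X]mulmx1 tr_diag_mul raddf_sum; apply: eq_bigr => i _.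
have /unitarymxP UU := spectral_unitarymx A.
by rewrite mulmx1 UU !mxE eqxx mulr1.
Qed.

Lemma EntE m (A : 'M[C]_m) : herm A -> Ent A = - \sum_i eigv A i * log2 (eigv A i).
Proof.
move=> hA; rewrite /Ent -{1}(mxfun_id hA) mxfun_mul tr_mxfun.
by congr (- _).
Qed.

Lemma eigv_ge0 m (A : 'M[C]_m) i : psd A -> 0 <= eigv A i.
Proof.
move=> pA; rewrite -(ler0c (eigv A i)) -spectral_diagE ?psd_spec_ge0 //.
exact: psd_herm.
Qed.

Lemma sum_eigv m (A : 'M[C]_m) : herm A -> (\sum_i eigv A i)%:C%C = \tr A.
Proof. by move=> hA; rewrite -(tr_mxfun id) mxfun_id. Qed.

Lemma mxsqrt_sqr m (A : 'M[C]_m) : psd A -> mxsqrt A *m mxsqrt A = A.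
Proof.
move=> pA; rewrite /mxsqrt mxfun_mul -[RHS](mxfun_id (psd_herm pA)) !mxfunE.
rewrite (_ : (\row_i _) = \row_i (eigv A i)%:C%C) //; apply/rowP => i; rewrite !mxE.
by rewrite -expr2 sqr_sqrtr ?eigv_ge0.
Qed.

Lemma psd_mxsqrt m (A : 'M[C]_m) : psd (mxsqrt A).
Proof.
by rewrite /mxsqrt mxfunE; apply: psd_diag => i; rewrite mxE ler0c sqrtr_ge0.
Qed.

Section Pair.
Variables (m : nat) (K L : 'M[C]_m).
Hypotheses (pK : psd K) (pL : psd L) (trKL : \tr (K + L) = 1).

(** The eigenvalue distribution of [K (+) L]; [sum_law] is that of [K + L]. *)
Definition pair_law (x : bool * 'I_m) : R := if x.1 then eigv L x.2 else eigv K x.2.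
Definition sum_law : 'I_m -> R := eigv (K + L).

Let hK : herm K. Proof. exact: psd_herm. Qed.
Let hL : herm L. Proof. exact: psd_herm. Qed.
Let pKL : psd (K + L). Proof. exact: psdD. Qed.
Let hKL : herm (K + L). Proof. exact: psd_herm. Qed.

Lemma pair_law_ge0 x : 0 <= pair_law x.
Proof. by rewrite /pair_law; case: ifP; rewrite eigv_ge0. Qed.

Lemma sum_law_ge0 x : 0 <= sum_law x.
Proof. exact: eigv_ge0. Qed.

Lemma sum_pair (F : R -> R) :
  \sum_x F (pair_law x) = \sum_i F (eigv K i) + \sum_i F (eigv L i).
Proof.
rewrite -(pair_bigA _ (fun b i => F (pair_law (b, i)))) /=.
by rewrite big_bool addrC.
Qed.

Lemma sum_pair_law : \sum_x pair_law x = 1.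
Proof.
apply: complexI; rewrite (sum_pair id) rmorphD /=.
have -> : (1%:C)%C = 1 :> C by []. 
by rewrite -trKL raddfD /= -!sum_eigv.
Qed.

Lemma sum_sum_law : \sum_x sum_law x = 1.
Proof. by apply: complexI; rewrite sum_eigv. Qed.

Let ln2 : ln 2 != 0 :> R.
Proof. by rewrite gt_eqF // ln_gt0 // ltr1n. Qed.

Lemma entropy_pair : entropy pair_law = (Ent K + Ent L) * ln 2.
Proof.
rewrite /entropy (sum_pair (fun x => x * ln x)) !EntE // -opprD mulNr; congr (- _).
rewrite mulrDl !mulr_suml; congr (_ + _); apply: eq_bigr => i _;
by rewrite /log2 -!mulrA mulVf ?mulr1.
Qed.

Lemma entropy_sum : entropy sum_law = Ent (K + L) * ln 2.
Proof.
rewrite /entropy EntE // mulNr; congr (- _).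
rewrite !mulr_suml; apply: eq_bigr => i _;
by rewrite /log2 -!mulrA mulVf ?mulr1.
Qed.

Variable n : nat.
Hypothesis n0 : (0 < n)%N.
Local Notation W := {ffun 'I_n -> bool * 'I_m}.
Local Notation A := {ffun 'I_n -> 'I_m}.

(** The matrix sigma of the argument: a square root of the n-th tensor power of [K (+) L], diagonal
    in the product basis [frame]. *)
Definition amplitude : 'M[C]_#|W| := tens2 n (mxsqrt K) (mxsqrt L).
Definition frame : 'M[C]_#|W| := tens2 n (spectralmx K) (spectralmx L).

Lemma frame_unitary : frame *m frame^t* = 1%:M.
Proof.
rewrite /frame tens2_adj tens2M; have /unitarymxP -> := spectral_unitarymx K.
by have /unitarymxP -> := spectral_unitarymx L; exact: tens2_1.
Qed.

Lemma tens2_frame (f : R -> R) : tens2 n (mxfun f K) (mxfun f L) =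
  framed frame (fun w => (\prod_i f (pair_law (w i)))%:C%C).
Proof.
rewrite !mxfunE -!tens2M tens2_diag -tens2_adj -/frame /framed.
rewrite (eq_dmx (g := fun w : W => (\prod_i f (pair_law (w i)))%:C%C)) // => w.
rewrite rmorph_prod; by apply: eq_bigr => i _; rewrite /pair_law; case: ifP; rewrite mxE.
Qed.

Lemma amplitude_sqr : amplitude *m amplitude = tens2 n K L.
Proof. by rewrite tens2M !mxsqrt_sqr. Qed.

Lemma tens2_KL : tens2 n K L =
  framed frame (fun w => (wprod pair_law w)%:C%C).
Proof. by rewrite -(tens2_frame id) !mxfun_id. Qed.

Lemma psd_amplitude : psd amplitude.
Proof.
rewrite /amplitude tens2_frame; apply: psd_framed => w.
by rewrite ler0c; apply: prodr_ge0 => i _; exact: sqrtr_ge0.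
Qed.

Lemma tr_amplitude_sqr : \tr (amplitude *m amplitude) = 1.
Proof.
rewrite amplitude_sqr tens2_KL (tr_framed frame_unitary) -rmorph_sum sum_wprod //.
exact: sum_pair_law.
Qed.

Lemma tr_amplitude_flip :
  \tr (flip_sum amplitude *m amplitude) = (n%:R * Gam K L)%:C%C.
Proof.
rewrite tr_tens2_flip ?mxsqrt_sqr // -?raddfD //.
rewrite /Gam !rmorphM /= rmorph_nat; congr (_ * _).
have -> : (2%:C)%C = 2 :> C by rewrite (rmorph_nat (real_complex R) 2).
have tr0 := psd_tr_mul (psd_mxsqrt K) (psd_mxsqrt L).
by rewrite (RRe_real (ger0_real tr0)).
Qed.

Section Typical.
Variable eps : R.
Hypothesis eps0 : 0 < eps.

Definition typical (w : W) :=
  expR (- (n%:R * (entropy pair_law + eps))) <= wprod pair_law w.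

Definition typical_proj : 'M[C]_#|W| := framed frame (fun w => (typical w)%:R).

Lemma inB_typical_proj : inB typical_proj.
Proof.
apply: inBM; last exact: inB_tens2.
apply: inBM; first by apply: inB_adj; exact: inB_tens2.
apply: inB_dmx => s w; congr (_%:R); rewrite /typical; congr (nat_of_bool (_ <= _)).
rewrite /wprod [RHS](reindex_inj (@perm_inj _ s)).
by apply: eq_bigr => i _; rewrite ffunE.
Qed.

Lemma herm_typical_proj : herm typical_proj.
Proof. by apply: herm_framed => w; rewrite realn. Qed.

Lemma typical_proj_idem : typical_proj *m typical_proj = typical_proj.
Proof.
rewrite (framedM frame_unitary); apply: eq_framed => w.
by rewrite -natrM mulnb andbb.
Qed.

Lemma rank_typical_proj :
  (\rank typical_proj)%:R <= expR (n%:R * (entropy pair_law + eps)) :> R.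
Proof.
apply: le_trans (card_typical n pair_law_ge0 sum_pair_law eps).
rewrite -lecR !rmorph_nat (mxrank_idem typical_proj_idem) (tr_framed frame_unitary).
rewrite -sum1_card natr_sum [in leRHS]big_mkcond /=.
by apply: ler_sum => w _; rewrite inE /typical; case: ifP => _ /=; exact: lexx.
Qed.

(** [Q] contains the typical subspace, so [1 - Q] sees only the atypical part [Y] of the square of
    the amplitude, whose trace is the mass of improbable words. *)
Lemma atypical_defect (Q : 'M[C]_#|W|) : herm Q -> Q *m Q = Q ->
  typical_proj *m Q = typical_proj ->
  \tr ((1%:M - Q) *m (amplitude *m amplitude))
  <= (varentropy pair_law / (n%:R * eps ^+ 2))%:C%C.
Proof.
move=> hQ QQ TQ; have QT : Q *m typical_proj = typical_proj.
  have := congr1 (fun M : 'M[C]_#|W| => M^t*) TQ.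
  by rewrite /= adjM hQ herm_typical_proj.
pose Y := framed frame (fun w => ((~~ typical w)%:R * wprod pair_law w)%:C%C).
have pY : psd Y.
  apply: psd_framed => w.
  by rewrite ler0c mulr_ge0 ?ler0n ?wprod_ge0 // => x; exact: pair_law_ge0.
have -> : amplitude *m amplitude = typical_proj *m (amplitude *m amplitude) + Y.
  rewrite amplitude_sqr tens2_KL (framedM frame_unitary) framedD.
  apply: eq_framed => w.
  by case: typical => /=; rewrite ?mul1r ?mul0r ?addr0 ?add0r.
have -> : \tr ((1%:M - Q) *m (typical_proj *m (amplitude *m amplitude) + Y)) =
    \tr Y - \tr (Q *m Y).
  move: (amplitude *m amplitude) (typical_proj) QT (Y) => M T QT Z.
  by rewrite mulmxDr mulmxA mulmxBl mul1mx QT subrr mul0mx add0r mulmxBl mul1mx raddfB.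
apply: le_trans (_ : \tr Y <= _).
  have : 0 <= \tr (Q *m Y) by apply: psd_tr_mul => //; exact: psd_idem.
  by rewrite lerBlDr lerDl.
rewrite (tr_framed frame_unitary) -rmorph_sum lecR.
apply: le_trans (low_mass pair_law_ge0 sum_pair_law n0 eps0).
rewrite [in leRHS]big_mkcond /=; apply: ler_sum => w _; rewrite /typical ltNge.
by case: (expR _ <= _); rewrite /= ?mul0r ?mul1r.
Qed.

(** In the eigenbasis of the n-th tensor power of [K + L], the diagonal entries of [E] lie in
    [[0, 1]] and add up to its rank. Eigenvalues above the threshold have small total mass; each of
    the others is at most the threshold, which is multiplied by the rank. *)
Lemma small_defect (E : 'M[C]_#|A|) : herm E -> E *m E = E ->
  \tr (liftw E *m (amplitude *m amplitude))
  <= (varentropy sum_law / (n%:R * eps ^+ 2)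
      + (\rank E)%:R * expR (- (n%:R * (entropy sum_law - eps))))%:C%C.
Proof.
move=> hE EE; rewrite tr_lift amplitude_sqr ptrace_tens2.
set th := expR _.
pose U := tens n (fun x y => spectralmx (K + L) x y).
have UU : U *m U^t* = 1%:M.
  rewrite /U tens_mx_adj tens_mx; have /unitarymxP -> := spectral_unitarymx (K + L).
  exact: tens_mx1.
have UU' : U^t* *m U = 1%:M := mulmx1C UU.
have -> : tens n (fun x y => (K + L) x y) = framed U (fun w => (wprod sum_law w)%:C%C).
  rewrite {1}(hermE hKL) -!tens_mx -tens_mx_adj -/U /framed.
  rewrite (@eq_tens _ _ _ _ (fun x y => (x == y)%:R * (sum_law x)%:C%C)) => [|x y].
    rewrite tens_diag (eq_dmx (g := fun w : A => (wprod sum_law w)%:C%C)) // => w.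
    by rewrite rmorph_prod.
  by rewrite !mxE; case: eqP => [->|_]; rewrite ?mulr1n ?mul1r // mulr0n mul0r.
rewrite mxtrace_mulC tr_framedM; set q := U *m E *m U^t*.
have qE : q = U *m E *m U^t* by [].
clearbody q; clearbody U.
have q0 w : 0 <= ment q w w.
  by apply: ment_diag_ge0; rewrite qE; apply/psd_conj/psd_idem.
have q1 w : ment q w w <= 1.
  have := @ment_diag_ge0 _ _ (U *m (1%:M - E) *m U^t*) w.
  rewrite mulmxBr mulmxBl mulmx1 UU -qE mentD mentN ment1 eqxx subr_ge0; apply.
  rewrite -[1%:M]UU -{1}[U]mulmx1 qE -mulmxBl -mulmxBr; apply/psd_conj.
  by have [h1 h2] := compl_idem hE EE; exact: psd_idem.
have trq : \sum_w ment q w w = (\rank E)%:R.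
  by rewrite -ment_tr qE mxtrace_mulC mulmxA UU' mul1mx mxrank_idem.
apply: le_trans (_ : \sum_w (((if th < wprod sum_law w then wprod sum_law w else 0)%:C)%C
   + th%:C%C * ment q w w) <= _).
  apply: ler_sum => w _.
  have w0 : 0 <= wprod sum_law w by apply: wprod_ge0; exact: sum_law_ge0.
  case: ltP => [lt|le].
    apply: le_trans (_ : (wprod sum_law w)%:C%C * 1 <= _).
      by rewrite ler_wpM2l ?ler0c.
    by rewrite mulr1 lerDl mulr_ge0 // ler0c expR_ge0.
  by rewrite add0r ler_wpM2r // lecR.
rewrite big_split /= -rmorph_sum -mulr_sumr trq rmorphD /= lerD //.
  rewrite lecR -big_mkcond /=.
  by have h := high_mass sum_law_ge0 sum_sum_law n0 eps0; exact: h.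
by rewrite mulrC rmorphM /= rmorph_nat.
Qed.

End Typical.

Lemma horn_family (eps t eta : R) (N : nat) :
  0 < eps -> 0 < t -> eta < 1 ->
  2 * (varentropy pair_law / (n%:R * eps ^+ 2) + (varentropy sum_law / (n%:R * eps ^+ 2)
      + N%:R * expR (- (n%:R * (entropy sum_law - eps))))) <= eta ->
  exists (Lam : R) (P : 'M[C]_#|W|),
  [/\ Gam K L - (t + eta / t + eta) <= Lam, psd P, inB P,
      psd (flip_sum P - (n%:R * Lam)%:C%C *: P) &
      (N < \rank (ptrace P))%N /\ (\rank P)%:R <=
       #|{: {ffun (bool * 'I_m) * (bool * 'I_m) -> 'I_n.+1}}|%:R
       * expR (n%:R * (entropy pair_law + eps))].
Proof.
move=> eps0 t0 eta1 etaP.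
have [Q [QB hQ QQ Qc [TQ rkQ]]] := central_cover (inB_typical_proj eps).
(* The cut-off at 0 provides the hypothesis [0 <= L] of [rank_growth]; where it acts, the
   alternative [L = 0] applies. *)
pose Lam := Num.max 0 (Gam K L - (t + eta / t + eta)).
have Lam0 : 0 <= Lam by rewrite le_max lexx.
have small (E : 'M[C]_#|A|) : herm E -> E *m E = E -> (\rank E < N.+1)%N ->
   2 * (\tr ((1%:M - Q) *m (amplitude *m amplitude)) +
        \tr (liftw E *m (amplitude *m amplitude))) <= eta%:C%C.
  move=> hE EE rkE; apply: le_trans (_ : (2 * (varentropy pair_law / (n%:R * eps ^+ 2)
     + (varentropy sum_law / (n%:R * eps ^+ 2)
      + N%:R * expR (- (n%:R * (entropy sum_law - eps))))))%:C%C <= _); last by rewrite lecR.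
  rewrite rmorphM /= (_ : (2%:C)%C = 2 :> C); last by rewrite (rmorph_nat (real_complex R) 2).
  rewrite ler_wpM2l ?ler0n // rmorphD /= lerD //; first exact: atypical_defect.
  apply: le_trans (small_defect eps0 hE EE) _.
  by rewrite lecR lerD2l ler_wpM2r ?expR_ge0 // ler_nat -ltnS.
have [P [pP BP QP SP NP]] : exists P, [/\ psd P, inB P, Q *m P = P,
    psd (flip_sum P - (n%:R * Lam)%:C%C *: P) & (N < \rank (ptrace P))%N].
  apply: (@rank_growth C n m Q amplitude (n%:R * Lam)%:C%C t%:C%C eta%:C%C) => //.
  - exact: psd_amplitude.
  - exact: tr_amplitude_sqr.
  - by have := eta1; rewrite -ltcR.
  - by rewrite -ltcR in t0.
  - by rewrite ler0c mulr_ge0 // ler0n.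
  rewrite tr_amplitude_flip /Lam /Num.max; case: ifP => _; last first.
    by left; rewrite mulr0.
  right; rewrite mulrBr rmorphB /= lerD2l lerN2 rmorphM /= rmorph_nat.
  by rewrite !rmorphD /= fmorph_div.
exists Lam, P; split=> //; first by rewrite le_max lexx orbT.
split=> //; apply: le_trans (_ : (#|{: {ffun (bool * 'I_m) * (bool * 'I_m) -> 'I_n.+1}}|
    * \rank (typical_proj eps))%N%:R <= _).
  rewrite ler_nat; apply: leq_trans rkQ; rewrite -QP; exact: mxrankM_maxl.
by rewrite natrM ler_wpM2l ?ler0n // rank_typical_proj.
Qed.

End Pair.
End HornFamily.

(** * The Delsarte linear program *)

Section DelsarteBound.
Variables (R : realType) (n : nat).
Local Notation B := {ffun 'I_n -> bool}.

(** The Walsh character [(-1)^(v . x)]. *)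
Definition chi (v x : B) : R := \prod_i (if v i && x i then -1 else 1).
Definition wt (x : B) : nat := \sum_i x i.
Definition zerob : B := [ffun=> false].

Lemma chiC v x : chi v x = chi x v.
Proof. by apply: eq_bigr => i _; rewrite andbC. Qed.

Lemma chi0 x : chi zerob x = 1.
Proof. by rewrite /chi big1 // => i _; rewrite ffunE. Qed.

Lemma chiD u v x : chi (addb u v) x = chi u x * chi v x.
Proof.
rewrite -big_split; apply: eq_bigr => i _; rewrite ffunE /=.
by case: (u i) (v i) (x i) => [] [] []; rewrite /= ?mulrNN ?mulr1 ?mul1r.
Qed.

Lemma chi_perm s v x : chi (permf s v) (permf s x) = chi v x.
Proof.
by rewrite /chi [RHS](reindex_inj (@perm_inj _ s)); apply: eq_bigr => i _; rewrite !ffunE.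
Qed.

Lemma wt_perm s x : wt (permf s x) = wt x.
Proof.
by rewrite /wt [RHS](reindex_inj (@perm_inj _ s)); apply: eq_bigr => i _; rewrite !ffunE.
Qed.

Lemma wt_le x : (wt x <= n)%N.
Proof.
rewrite -[X in (_ <= X)%N](card_ord n) -sum1_card.
by apply: leq_sum => i _; case: (x i).
Qed.

Lemma wt_eq0 x : (wt x == 0)%N = (x == zerob).
Proof.
rewrite sum_nat_eq0; apply/forallP/eqP => [h|-> i]; last by rewrite ffunE.
by apply/ffunP => i; rewrite ffunE; have := h i; case: (x i).
Qed.

Lemma wt_orbit x y : wt x = wt y -> exists s, y = permf s x.
Proof.
move=> e; apply: same_count_perm => -[].
  have E (z : B) : (\sum_i (z i == true) = wt z)%N by apply: eq_bigr => i _; case: (z i).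
  by rewrite !E.
have E (z : B) : (\sum_i (z i == false) = n - wt z)%N.
  apply/eqP; rewrite -(eqn_add2r (wt z)) subnK ?wt_le // -big_split /=.
  rewrite (eq_bigr (fun=> 1%N)) => [|i _]; last by case: (z i).
  by rewrite sum_nat_const card_ord muln1.
by rewrite !E e.
Qed.

Lemma wt_surj i : (i <= n)%N -> exists x, wt x = i.
Proof.
move=> ile; exists [ffun k : 'I_n => (k < i)%N]; rewrite /wt.
under eq_bigr do rewrite ffunE.
transitivity (\sum_(k < n | (k < i)%N) 1)%N.
  by rewrite [RHS]big_mkcond; apply: eq_bigr => k _; case: (k < i)%N.
by rewrite -(big_ord_widen n (fun=> 1%N)) // sum1_card card_ord.
Qed.

Lemma sum_chi_unit x : \sum_i chi (unitb i) x = n%:R - (2 * wt x)%:R.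
Proof.
have E i : chi (unitb i) x = 1 - 2 * (x i)%:R.
  rewrite /chi (bigD1 i) //= big1 => [|k /negPf ki]; rewrite ffunE ?ki // eqxx mulr1 /=.
  by case: (x i) => /=; lra.
under eq_bigr do rewrite E.
rewrite sumrB sumr_const card_ord -mulr_sumr natrM; congr (_ - _ * _).
by rewrite natr_sum.
Qed.

(** The generating polynomial is a product over coordinates of [1 + X] or [1 - X]; expanding it over
    all words [v] gives the terms [chi v x X^(wt v)]. *)
Lemma krawtchouk_chi j x : \sum_(v | wt v == j) chi v x = krawtchouk R n j (wt x).
Proof.
have sz : (\sum_(i : 'I_n) ~~ x i = n - wt x)%N.
  apply/eqP; rewrite -(eqn_add2r (wt x)) subnK ?wt_le // -big_split /=.
  rewrite (eq_bigr (fun=> 1%N)) => [|i _]; last by case: (x i).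
  by rewrite sum_nat_const card_ord muln1.
have polE : (1 + 'X) ^+ (n - wt x) * (1 - 'X) ^+ wt x =
    \sum_(v : B) (chi v x)%:P * 'X^(wt v) :> {poly R}.
  transitivity (\prod_(i < n) (1 + (if x i then -1 else 1)%:P * 'X) : {poly R}).
    rewrite -sz /wt -!prodrXr -big_split /=; apply: eq_bigr => i _.
    case: (x i); rewrite /= ?expr0 ?expr1 ?mul1r ?mulr1 ?polyCN ?polyC1 ?mulN1r ?mul1r //.
  transitivity (\prod_(i < n) \sum_(b : bool)
     (if b && x i then -1 else 1)%:P * 'X^b : {poly R}).
    apply: eq_bigr => i _; rewrite big_bool /= expr1 expr0 mulr1 addrC.
    by rewrite polyC1.
  rewrite bigA_distr_bigA; apply: eq_bigr => v _; rewrite big_split /=.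
  by rewrite /chi rmorph_prod /wt prodrXr.
rewrite /krawtchouk polE coef_sum big_mkcond /=; apply: eq_bigr => v _.
by rewrite coefCM coefXn eq_sym; case: eqP; rewrite ?mulr1 ?mulr0.
Qed.

Section Dual.
Variables (d : int) (A : 'I_n.+1 -> R).
Hypothesis fA : LP_feasible d A.

Definition sphere_card (i : nat) : nat := #|[pred x : B | wt x == i]|.

(** Distributes [A i] uniformly over the sphere of weight [i], making the linear program one about
    functions on the cube; [spread_hat] is the Fourier transform. *)
Definition spread (x : B) : R := A (inord (wt x)) / (sphere_card (wt x))%:R.

Definition spread_hat (v : B) : R := \sum_x spread x * chi v x.

Lemma sphere_card_gt0 i : (i <= n)%N -> (0 < sphere_card i)%N.
Proof. by move=> /wt_surj[x xi]; apply/card_gt0P; exists x; rewrite inE xi. Qed.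

Lemma sum_spread (f : nat -> R) :
  \sum_x spread x * f (wt x) = \sum_(i < n.+1) A i * f i.
Proof.
have wtlt x : (wt x < n.+1)%N by rewrite ltnS wt_le.
rewrite (partition_big (fun x => Ordinal (wtlt x)) xpredT) //=.
apply: eq_bigr => i _.
rewrite (eq_bigr (fun=> A i / (sphere_card i)%:R * f i)) => [|x /eqP<-]; last first.
  rewrite /spread /=; congr (A _ / _ * _); apply: val_inj; rewrite /= inordK //.
rewrite sumr_const (_ : #|_| = sphere_card i); last by apply: eq_card => x; rewrite !inE.
rewrite -[LHS]mulr_natr [LHS]mulrAC mulfVK //.
by rewrite pnatr_eq0 -lt0n sphere_card_gt0 // -ltnS.
Qed.

Lemma spread_hat0 : spread_hat zerob = \sum_i A i.
Proof.
rewrite /spread_hat; under eq_bigr do rewrite chi0.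
by rewrite (sum_spread (fun=> 1)); apply: eq_bigr => i _; rewrite mulr1.
Qed.

(** The transform is constant on spheres, and its sum over the sphere of weight [j] is the j-th
    Krawtchouk constraint. *)
Lemma spread_hat_ge0 v : 0 <= spread_hat v.
Proof.
have inv w : wt w = wt v -> spread_hat w = spread_hat v.
  move=> /esym/wt_orbit[s ->]; rewrite /spread_hat (reindex_inj (@permf_inj _ _ s)).
  by apply: eq_bigr => x _; rewrite chi_perm /spread wt_perm.
have h : (sphere_card (wt v))%:R * spread_hat v = \sum_(w | wt w == wt v) spread_hat w.
  rewrite (eq_bigr (fun=> spread_hat v)) => [|w /eqP/inv //].
  by rewrite sumr_const mulr_natl.
rewrite -(pmulr_rge0 _ (_ : 0 < (sphere_card (wt v))%:R)); last first.
  by rewrite ltr0n sphere_card_gt0 ?wt_le.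
rewrite h exchange_big /=.
under eq_bigr do rewrite -mulr_sumr krawtchouk_chi.
rewrite (sum_spread (fun i => krawtchouk R n (wt v) i)).
have wtlt : (wt v < n.+1)%N by rewrite ltnS wt_le.
by have [_ _ _ /(_ (Ordinal wtlt))] := fA.
Qed.

Lemma spread_ge0 x : 0 <= spread x.
Proof. by have [_ A0 _ _] := fA; rewrite divr_ge0 ?A0 ?ler0n. Qed.

Lemma spread0 : spread zerob = 1.
Proof.
have w0 : wt zerob = 0%N by apply/eqP; rewrite wt_eq0.
have [A0 _ _ _] := fA; rewrite /spread w0.
have -> : inord 0 = ord0 :> 'I_n.+1 by apply: val_inj; rewrite /= inordK.
rewrite A0 /sphere_card (eq_card (B := pred1 zerob)) ?card1 ?divr1 // => x.
by rewrite !inE wt_eq0.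
Qed.

Lemma spread_small x : x != zerob -> (wt x)%:Z < d -> spread x = 0.
Proof.
move=> x0 xd; have [_ _ Ad _] := fA; rewrite /spread Ad ?mul0r // inordK ?ltnS ?wt_le //.
by rewrite lt0n wt_eq0.
Qed.

(* Linear programming duality, with the test function (t - tau) * hat c. *)
Lemma delsarte_dual (c : B -> R) (Lam : R) :
  (forall v, 0 <= c v) -> (forall x, 0 <= \sum_v c v * chi v x) ->
  (forall v, n%:R * Lam * c v <= \sum_i c (addb (unitb i) v)) ->
  n%:R - 2 * d%:~R <= n%:R * Lam ->
  (n%:R * Lam - (n%:R - 2 * d%:~R)) * c zerob * \sum_i A i
  <= 2 * d%:~R * \sum_v c v.
Proof.
move=> c0 chat0 cL Ld; set tau := n%:R - 2 * d%:~R.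
pose chat x := \sum_v c v * chi v x.
pose dc v := \sum_i c (addb (unitb i) v) - tau * c v.
have dc_ge v : (n%:R * Lam - tau) * c v <= dc v by rewrite mulrBl lerD2r.
have dc0 v : 0 <= dc v by apply: le_trans (dc_ge v); rewrite mulr_ge0 ?subr_ge0.
(* Parseval. The number [tau] is the value of [n t] at distance [d], and [dc] has transform
   [(n t - tau) chat] because multiplying by [n t] convolves with the sum over unit vectors. *)
have E : \sum_x spread x * ((2 * d%:~R - (2 * wt x)%:R) * chat x)
    = \sum_v dc v * spread_hat v.
  have chatE x : (2 * d%:~R - (2 * wt x)%:R) * chat x = \sum_v dc v * chi v x.
    have -> : 2 * d%:~R - (2 * wt x)%:R = \sum_i chi (unitb i) x - tau.
      by rewrite sum_chi_unit /tau; ring.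
    rewrite mulrBl /dc; under [RHS]eq_bigr do rewrite mulrBl -mulrA.
    rewrite sumrB -mulr_sumr; congr (_ - _); rewrite mulr_suml.
    under [RHS]eq_bigr do rewrite mulr_suml.
    rewrite [RHS]exchange_big /=; apply: eq_bigr => i _.
    rewrite [RHS](reindex_inj (@addb_inj _ (unitb i))) /chat mulr_sumr.
    by apply: eq_bigr => v _; rewrite addbb_ffun chiD; ring.
  under eq_bigr do rewrite chatE mulr_sumr.
  rewrite exchange_big; apply: eq_bigr => v _; rewrite mulr_sumr.
  by apply: eq_bigr => x _; rewrite mulrCA.
apply: le_trans (_ : \sum_v dc v * spread_hat v <= _).
  rewrite (bigD1 zerob) //= -[X in X <= _]addr0 lerD //.
    by rewrite spread_hat0 ler_wpM2r // -spread_hat0 spread_hat_ge0.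
  by apply: sumr_ge0 => v _; rewrite mulr_ge0 ?spread_hat_ge0.
rewrite -E (bigD1 zerob) //= -[X in _ <= X]addr0 lerD //.
  have w0 : wt zerob = 0%N by apply/eqP; rewrite wt_eq0.
  rewrite spread0 mul1r w0 muln0 subr0.
  have -> : chat zerob = \sum_v c v by apply: eq_bigr => v _; rewrite chiC chi0 mulr1.
  exact: lexx.
(* Away from the origin, either [spread] vanishes below weight [d] or the factor [2 d - 2 wt x] is
   nonpositive. *)
apply: sumr_le0 => x x0; have [xd|xd] := ltP (wt x)%:Z d.
  by rewrite spread_small // mul0r.
rewrite mulr_ge0_le0 ?spread_ge0 // mulr_le0_ge0 //.
rewrite subr_le0 natrM ler_wpM2l // -[leRHS]/((wt x)%:Z%:~R) ler_int //.
exact: chat0.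
Qed.

End Dual.
End DelsarteBound.

(** * The dual certificate built from a positive solution *)

Section CorrelationFunction.
Local Open Scope sesquilinear_scope.
Variables (R : realType) (n m : nat).
Local Notation C := R[i].
Local Notation W := {ffun 'I_n -> bool * 'I_m}.
Local Notation A := {ffun 'I_n -> 'I_m}.
Local Notation B := {ffun 'I_n -> bool}.

Definition correlation (Y : 'M[C]_#|W|) (v : B) : R :=
  complex.Re (\tr (Y *m conj_shift v Y)).

Lemma correlationE Y v : psd Y -> (correlation Y v)%:C%C = \tr (Y *m conj_shift v Y).
Proof.
move=> pY; have := psd_tr_mul pY (psd_conj_shift v pY).
by move=> /ger0_real /RRe_real.
Qed.

Lemma correlation_ge0 Y v : psd Y -> 0 <= correlation Y v.
Proof.
move=> pY; rewrite -(ler0c (correlation Y v)) correlationE //.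
exact: psd_tr_mul pY (psd_conj_shift v pY).
Qed.

Lemma conj_shift0 (Y : 'M[C]_#|W|) : conj_shift (zerob n) Y = Y.
Proof.
apply: mentP => w w'; rewrite conj_shiftE; congr (ment Y _ _);
by apply/ffunP => i; rewrite !ffunE /=; case: (_ i).
Qed.

Definition twist (x : B) : 'M[C]_#|W| := dmx (fun w => (chi R x (bits w))%:C%C).

Lemma twist_comm x Y : blocked Y -> twist x *m Y = Y *m twist x.
Proof.
move=> bY; apply: mentP => w w'; rewrite dmxMl dmxMr.
by have [->//|/bY->] := eqVneq (bits w) (bits w'); rewrite !mulr0.
Qed.

(** On the block of a dual point [u], replacing [v] by [u + v] factors the character into [chi u x],
    the outer twist, and [chi v x], which stays inside the partial trace. *)
Lemma sum_chi_shift x (Y : 'M[C]_#|W|) : blocked Y ->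
  \sum_v (chi R v x)%:C%C *: conj_shift v Y = twist x *m liftw (ptrace (twist x *m Y)).
Proof.
move=> bY; apply: mentP => w w'; rewrite ment_sum dmxMl fmxE.
have [e|ne] := eqVneq (bits w) (bits w'); last first.
  rewrite mul0r mulr0 big1 // => v _; rewrite mentZ conj_shiftE bY ?mulr0 //.
  by rewrite !bits_shift (inj_eq (@addb_inj _ _)).
rewrite mul1r fmxE mulr_sumr (reindex_inj (@addb_inj _ (bits w))).
apply: eq_bigr => v _; rewrite mentZ conj_shiftE dmxMl.
rewrite bits_zip chiD rmorphM /= chiC [chi R v x]chiC -mulrA.
have E z : bits z = bits w -> shiftw (addb (bits w) v) z = zipw v (lets z).
  by move=> zw; rewrite /shiftw addb_ffunC zw addbb_ffun.
by rewrite !E.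
Qed.

(** A squared norm on the right makes the Fourier transform of the correlation nonnegative, as dual
    feasibility demands. *)
Lemma sum_correlation_chi Y x : psd Y -> blocked Y ->
  (\sum_v correlation Y v * chi R v x)%:C%C = sqn (ptrace (twist x *m Y)).
Proof.
move=> pY BY; have -> : (\sum_v correlation Y v * chi R v x)%:C%C =
    \tr (Y *m \sum_v (chi R v x)%:C%C *: conj_shift v Y).
  rewrite rmorph_sum mulmx_sumr raddf_sum; apply: eq_bigr => v _.
  by rewrite rmorphM /= correlationE // -scalemxAr mxtraceZ mulrC.
rewrite sum_chi_shift // mulmxA -twist_comm // mxtrace_mulC tr_lift /sqn.
congr (\tr (_ *m _)); rewrite -ptrace_adj; congr ptrace.
rewrite adjM (psd_herm pY) twist_comm //; congr (_ *m _).
by apply/esym/dmx_herm => w; apply/complex_realP; eexists.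
Qed.

(** The operator inequality is tested against the positive matrix [conj_shift v Y]. *)
Lemma correlation_flip Y v L : psd Y -> psd (flip_sum Y - L%:C%C *: Y) ->
  L * correlation Y v <= \sum_i correlation Y (addb (unitb i) v).
Proof.
move=> pY pS; rewrite -lecR rmorphM rmorph_sum /= correlationE //.
under [leRHS]eq_bigr do rewrite correlationE // conj_shiftD.
have -> : \sum_i \tr (Y *m conj_shift (unitb i) (conj_shift v Y)) =
    \tr (flip_sum Y *m conj_shift v Y).
  by rewrite flip_selfadj /flip_sum mulmx_sumr raddf_sum.
rewrite -subr_ge0 -mxtraceZ scalemxAl -raddfB -mulmxBl.
exact: psd_tr_mul pS (psd_conj_shift v pY).
Qed.

(* Normalizing the partial trace to a projection turns the ratio of the two
   Hilbert-Schmidt norms in the dual bound into the ratio of the two ranks. *)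
Lemma LP_le (P : 'M[C]_#|W|) (Lam : R) (d : int) :
  psd P -> inB P -> psd (flip_sum P - (n%:R * Lam)%:C%C *: P) ->
  (0 < \rank (ptrace P))%N -> (n%:R - 2 * d%:~R) < n%:R * Lam ->
  LP R n d <= 2 * d%:~R / (n%:R * Lam - (n%:R - 2 * d%:~R))
              * ((\rank P)%:R / (\rank (ptrace P))%:R).
Proof.
move=> pP BP pS r0 ltL; have [A fA ->] := LP_attained R n d.
have [H [hH HH rkH]] := psd_inv_sqrt (psd_ptrace pP).
set E := H *m ptrace P *m H in HH rkH.
have hlH : herm (liftw H) by rewrite /herm liftw_adj hH.
pose Y := liftw H *m P *m liftw H.
have pY : psd Y by rewrite /Y -{2}hlH; exact: psd_conj.
have EY : ptrace Y = E.
  rewrite /Y -mulmxA ptrace_lift -[P *m _]trmxCK ptrace_adj adjM (psd_herm pP).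
  by rewrite hlH ptrace_lift adjM -ptrace_adj (psd_herm pP) hH mulmxA.
have bY : blocked Y.
  by apply: blockedM; [apply: blockedM BP.1; exact: blocked_lift|exact: blocked_lift].
have pSY : psd (flip_sum Y - (n%:R * Lam)%:C%C *: Y).
  have -> : flip_sum Y - (n%:R * Lam)%:C%C *: Y =
      liftw H *m (flip_sum P - (n%:R * Lam)%:C%C *: P) *m (liftw H)^t*.
    by rewrite hlH mulmxBr mulmxBl -scalemxAr -scalemxAl flip_lift flip_lift_l.
  exact: psd_conj.
have hE : herm E by rewrite -EY; apply/psd_herm/psd_ptrace.
set r := \rank (ptrace P) in r0 rkH *; set D := \rank P.
have D0 : (0 < D)%N.
  rewrite lt0n mxrank_eq0; apply: contraTneq r0 => P0.
  rewrite /r P0 (_ : ptrace _ = 0) ?mxrank0 //.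
  by apply: mentP => a b; rewrite fmxE ment0 big1 // => u _; rewrite ment0.
have trE : \tr E = r%:R by rewrite -mxrank_idem // rkH.
(* At the trivial character the squared norm is that of the projection [E], namely its rank. *)
have sum_c : \sum_v correlation Y v = r%:R.
  apply: complexI; have := sum_correlation_chi (zerob n) pY bY.
  have -> : twist (zerob n) *m Y = Y.
    by apply: mentP => w w'; rewrite dmxMl chi0 mul1r.
  rewrite EY /sqn hE HH trE rmorph_nat => <-; congr (_%:C%C).
  by apply: eq_bigr => v _; rewrite chiC chi0 mulr1.
(* Cauchy-Schwarz with [tr Y = r] and [rank Y <= D]; the optimal constant in [tr_sqr_rank] is then
   [r / D]. *)
have c0 : r%:R ^+ 2 / D%:R <= correlation Y (zerob n).
  rewrite -lecR correlationE // conj_shift0.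
  have DR : (D%:R : C) != 0 by rewrite pnatr_eq0 -lt0n.
  have cr : (r%:R / D%:R : C) \is Num.real by rewrite realE divr_ge0 ?ler0n.
  have := tr_sqr_rank (psd_herm pY) cr.
  rewrite -(tr_ptrace Y) EY trE => le1.
  have le2 : (r%:R / D%:R : C) ^+ 2 * (\rank Y)%:R <= r%:R ^+ 2 / D%:R.
    apply: le_trans (_ : (r%:R / D%:R : C) ^+ 2 * D%:R <= _).
      rewrite ler_wpM2l ?exprn_ge0 ?divr_ge0 ?ler0n // ler_nat.
      by rewrite (leq_trans (mxrankM_maxl _ _)) // mxrankM_maxr.
    by rewrite le_eqVlt; apply/orP; left; apply/eqP; field.
  rewrite fmorph_div rmorphXn /= !rmorph_nat.
  have := le_trans le1 (lerD le2 (lexx _)).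
  rewrite (_ : 2 * (r%:R / D%:R) * r%:R = r%:R ^+ 2 / D%:R + r%:R ^+ 2 / D%:R :> C).
    by rewrite lerD2l.
  by field.
have chat0 x : 0 <= \sum_v correlation Y v * chi R v x.
  by rewrite -(ler0c (\sum_v _)) sum_correlation_chi // sqn_ge0.
have dual := delsarte_dual fA (fun v => correlation_ge0 v pY) chat0
  (fun v => correlation_flip v pY pSY) (ltW ltL).
have gap : 0 < n%:R * Lam - (n%:R - 2 * d%:~R) by rewrite subr_gt0.
have rR : 0 < r%:R :> R by rewrite ltr0n.
have DR : 0 < D%:R :> R by rewrite ltr0n.
have A0 : 0 <= \sum_i A i by have [_ Age _ _] := fA; apply: sumr_ge0.
rewrite sum_c in dual; rewrite mulrAC ler_pdivlMr // mulrA ler_pdivlMr //.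
rewrite -(ler_pM2r (divr_gt0 rR DR)).
apply: le_trans (_ : (n%:R * Lam - (n%:R - 2 * d%:~R)) * (r%:R ^+ 2 / D%:R) * \sum_i A i <= _).
  by rewrite le_eqVlt; apply/orP; left; apply/eqP; ring.
apply: le_trans (_ : 2 * d%:~R * r%:R <= _); last first.
  by rewrite le_eqVlt; apply/orP; left; apply/eqP; field; rewrite gt_eqF.
by apply: le_trans dual; rewrite ler_wpM2r // ler_wpM2l // ltW.
Qed.

End CorrelationFunction.

(** * Translation to the Hecke algebra *)

Section IsotypicDecomposition.
Import VectorInternalTheory.
Variables (C : numClosedFieldType) (n : nat) (E : unitary_module C n).
Local Notation G := (Bn n).
Local Notation V := (Ind E).
Local Notation N := (dim V).

Lemma translM (g h : G) (f : V) : transl (g * h)%g f = transl g (transl h f).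
Proof.
apply: val_inj; apply/ffunP => k; rewrite !translE.
by rewrite invMg mulgA.
Qed.

Lemma transl1 (f : V) : transl 1%g f = f.
Proof. by apply: val_inj; apply/ffunP => k; rewrite translE invg1 mul1g. Qed.

(* The transpose turns the left action on column vectors into a right action on
   row vectors, as expected by mx_representation. *)
Definition transl_mx (g : G) : 'M[C]_N :=
  (lin1_mx (v2r \o transl g \o (@r2v C V)))^T.

Lemma transl_mxE g (f : V) : v2r (transl g f) = v2r f *m (transl_mx g)^T.
Proof. by rewrite trmxK mul_rV_lin1 /= v2rK. Qed.

Fact transl_mx_repr : mx_repr [set: G] transl_mx.
Proof.
split=> [|g h _ _].
  apply: trmx_inj; apply/row_matrixP => i; rewrite !rowE -[delta_mx 0 i]r2vK.
  by rewrite -transl_mxE transl1 trmx1 mulmx1.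
apply: trmx_inj; apply/row_matrixP => i; rewrite !rowE -[delta_mx 0 i]r2vK.
by rewrite -transl_mxE translM !transl_mxE trmx_mul mulmxA.
Qed.

Definition transl_repr := MxRepresentation transl_mx_repr.

Lemma mem_vs2mx (f : V) (U : {vspace V}) : (f \in U) = (v2r f <= vs2mx U)%MS.
Proof. by rewrite memvE /subsetv /vline /= genmxE. Qed.

Lemma isotypic_stable (W : IrrB C n) g (f : V) :
  f \in isotypic E W -> transl g f \in isotypic E W.
Proof.
move=> /memv_sumP[fi fiP ->]; rewrite linear_sum; apply: memv_suml => i _.
have /memv_imgP[v _ ->] := fiP i isT.
have phiI : (vbasis (intertwiners E W))`_i \in intertwiners E W.
  by apply: vbasis_mem; apply: mem_nth; rewrite size_tuple.
have /intertwinersP/(_ g v) e := phiI.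
suff : (vbasis (intertwiners E W))`_i (irr_repr W g *m v) \in isotypic E W by rewrite e.
apply: (subvP (sumv_sup i _ (subvv _))) => //.
by rewrite memv_img ?memvf.
Qed.

Lemma isotypic_img (W : IrrB C n) phi :
  phi \in intertwiners E W -> (limg phi <= isotypic E W)%VS.
Proof. by move: phi; apply/isotypic_sub. Qed.

(* A simple submodule of the annihilator of the isotypic components would have an
   intertwiner dual to it, whose image is not annihilated. *)
Lemma isotypic_full : (\sum_(W : IrrB C n) isotypic E W)%VS = fullv.
Proof.
set U := (\sum_W _)%VS; apply/eqP/negPn/negP => Ufull.
have Ustable g (f : V) : f \in U -> transl g f \in U.
  move=> /memv_sumP[fi fiP ->]; rewrite linear_sum; apply: memv_sumr => W _.
  by apply: isotypic_stable; apply: fiP.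
(* [A] is the annihilator of [U], nonzero because [U] is assumed proper. *)
pose M := vs2mx U; pose A := kermx M^T.
have A0 : A != 0.
  rewrite -mxrank_eq0 mxrank_ker mxrank_tr subn_eq0 -ltnNge.
  rewrite ltn_neqAle rank_leq_row andbT; apply: contra Ufull => rkU.
  by rewrite -(dimv_leqif_eq (subvf U)).2 dimvf.
have MtM g : (M *m (transl_mx g)^T <= M)%MS.
  apply/row_subP => i; rewrite row_mul -[row i M]r2vK -transl_mxE -mem_vs2mx.
  by apply: Ustable; rewrite mem_vs2mx r2vK row_sub.
have Amod : mxmodule transl_repr A.
  apply/mxmoduleP => g _; apply/sub_kermxP; rewrite -mulmxA -[transl_repr g]trmxK -trmx_mul.
  by have /submxP[D ->] := MtM g; rewrite trmx_mul mulmxA mulmx_ker mul0mx.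
have : exists2 S, mxsimple transl_repr S & (S <= A)%MS.
  apply: contrapT => nS; suff : false by [].
  by apply: (mxsimple_exists Amod A0) => /nS.
move=> [S simS SA].
have Smod : mxmodule transl_repr S by case: simS.
have irrS := (submod_mx_irr Smod).2 simS.
have charG : (pgroup.pgroup [pchar C]^')%R [set: G].
  by apply/pnatP => [|p _ _]; rewrite ?cardG_gt0 // inE /= pchar_num.
pose W := irr_comp (IrrB C n) (submod_repr Smod).
have [B _ Bfree Bhom] := mx_rsim_sym (rsim_irr_comp_pchar (IrrB C n) charG irrS).
pose T := B *m val_submod (1%:M : 'M[C]_(\rank S)).
have TM g : irr_repr W g *m T = T *m transl_mx g.
  rewrite /T mulmxA Bhom ?inE // -[LHS]mulmxA -[RHS]mulmxA; congr (_ *m _).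
  rewrite -val_submodE; have Gg : g \in [set: G]%G by rewrite inE.
  have := val_submodJ Smod 1%:M Gg; rewrite mul1mx; exact.
have TU : T *m M^T = 0.
  apply/sub_kermxP; apply: submx_trans SA; rewrite /T.
  by apply: submx_trans (submxMl _ _) _; rewrite val_submod1.
have Tfree : row_free T.
  rewrite /row_free mxrankMfree //; last by rewrite /row_free val_submod1.
have /row_freeP[D TD] := Tfree; clearbody T.
(* Averaging a right inverse [D] of [T] gives an intertwiner. Its image lies in [U], so [T Phi = 0];
   but [T] intertwines too, so [T Phi] is [|G|] times the identity. *)
pose Phi := \sum_(g : G) transl_mx g^-1%g *m D *m irr_repr W g.
have WM x y : irr_repr W (x * y)%g = irr_repr W x *m irr_repr W y.
  by apply: repr_mxM; rewrite inE.
have MM x y : transl_mx (x * y)%g = transl_mx x *m transl_mx y.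
  by apply: (repr_mxM transl_repr); rewrite inE.
have PhiM h : transl_mx h *m Phi = Phi *m irr_repr W h.
  rewrite mulmx_sumr mulmx_suml [RHS](reindex_inj (mulIg h^-1%g)) /=.
  apply: eq_bigr => g _; rewrite -[RHS]mulmxA -WM mulgKV.
  by rewrite invMg invgK MM !mulmxA.
pose phi := linfun (@r2v C V \o trmx \o (mulmx Phi : 'cV[C]_(irr_degree W) -> _)).
have phiE v : phi v = r2v (Phi *m v)^T by rewrite lfunE.
have phiI : phi \in intertwiners E W.
  apply/intertwinersP => g v; rewrite !phiE mulmxA -PhiM -mulmxA trmx_mul.
  by apply: v2r_inj; rewrite transl_mxE !r2vK.
have TPhi : T *m Phi = 0.
  apply/trmx_inj/row_matrixP => i; rewrite trmx0 row0 -tr_col colE -mulmxA.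
  have phiU : phi (delta_mx i 0) \in U.
    apply: (subvP (sumv_sup W _ (subvv _))) => //.
    by apply: (subvP (isotypic_img phiI)); rewrite memv_img ?memvf.
  move: phiU; rewrite mem_vs2mx phiE r2vK => /submxP[X XM].
  have -> : Phi *m delta_mx i 0 = M^T *m X^T by rewrite -[LHS]trmxK XM trmx_mul.
  by rewrite mulmxA TU mul0mx trmx0.
have : T *m Phi = #|G|%:R *: 1%:M.
  rewrite mulmx_sumr (eq_bigr (fun=> 1%:M)) => [|g _].
    by rewrite sumr_const scaler_nat; congr (_ *+ _); apply: eq_card.
  by rewrite [LHS]mulmxA (mulmxA T _ D) -TM -(mulmxA _ T D) TD mulmx1 -WM mulVg repr_mx1.
rewrite TPhi => /esym/matrixP/(_ (Ordinal (irr_degree_gt0 W)) (Ordinal (irr_degree_gt0 W))).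
rewrite !mxE eqxx mulr1 => /eqP; rewrite pnatr_eq0 => /eqP G0.
by have := fintype.max_card (pred1 (1%g : G)); rewrite card1 G0.
Qed.

End IsotypicDecomposition.

(** * Operators given by kernels *)

Section KernelOperators.
Local Open Scope sesquilinear_scope.
Variables (C : numClosedFieldType) (n : nat) (E : unitary_module C n).
Local Notation X := 'rV['F_2]_n.
Local Notation e := (um_dim E).
Implicit Types k : X -> X -> 'M[C]_e.

(** The components of all types span the whole space, and the sum over the empty complement is 0. *)
Lemma z_proj_setT : z_proj E [set: IrrB C n] = \1%VF.
Proof.
apply/lfunP => f; rewrite id_lfunE /z_proj daddv_pi_id //.
  by rewrite [X in (_ :&: X)%VS]big_pred0 ?capv0 // => V; rewrite !inE.
rewrite (eq_bigl xpredT) => [|V]; last by rewrite inE.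
by rewrite isotypic_full memvf.
Qed.

Lemma of_kernel_lin k k' a :
  of_kernel k + a *: of_kernel k' = of_kernel (fun x y => k x y + a *: k' x y).
Proof.
apply/lfunP => f; apply: value_at_inj => x.
rewrite add_lfunE scale_lfunE [in LHS]addrC value_at_linear [in LHS]addrC !of_kernelE.
rewrite scalerA mulrC -scalerA -scalerDr scaler_sumr -big_split /=.
by congr (_ *: _); apply: eq_bigr => y _; rewrite scalemxAl -mulmxDl.
Qed.

Lemma eq_of_kernel k k' : (forall x y, k x y = k' x y) -> of_kernel k = of_kernel k'.
Proof.
move=> kk; apply/lfunP => f; apply: value_at_inj => x; rewrite !of_kernelE.
by congr (_ *: _); apply: eq_bigr => y _; rewrite kk.
Qed.

Lemma schur_of_kernel k :
  schur_t (of_kernel k) = of_kernel (fun x y => t_zonal C x y *: k x y).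
Proof. by apply: eq_of_kernel => x y; rewrite of_kernelK. Qed.

Lemma value_transl b (f : Ind E) x :
  value_at (transl b f) x = E (Defs.perm_of b^-1%g)^-1%g *m
    value_at f (Defs.word_of b^-1%g + \row_i x ord0 (Defs.perm_of b^-1%g i)).
Proof.
rewrite /value_at translE; set g := (b^-1)%g; set z := Defs.word_of g; set p := Defs.perm_of g.
have -> : (g * bn_word x = bn_word (z + \row_i x ord0 (p i))%R * bn_perm p)%g.
  have w1 : bn_word x = (bn_word x * bn_perm 1)%g by rewrite /bn_perm morph1 mulg1.
  by rewrite [in LHS](bn_decomp g) w1 bn_mulE mulg1.
by have /ind_spaceP -> := subvsP f.
Qed.

(** A translation moves points by an affine map [h] and acts on fibers through [E]; equivariance of
    the kernel allows reindexing the sum by [h]. *)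
Lemma hecke_of_kernel k :
  (forall (p : 'S_n) (z x y : X), k (z + \row_i x ord0 (p i)) (z + \row_i y ord0 (p i)) *m E p
     = E p *m k x y) ->
  hecke (of_kernel k).
Proof.
move=> equiv b f; apply: value_at_inj => x; rewrite value_transl !of_kernelE.
rewrite -scalemxAr; congr (_ *: _); rewrite mulmx_sumr.
set p := Defs.perm_of _; set z := Defs.word_of _.
pose h (y : X) : X := z + \row_i y ord0 (p i).
have h_inj : injective h.
  move=> y y' /addrI/rowP hy; apply/rowP => i; have := hy (p^-1 i)%g.
  by rewrite !mxE permKV.
rewrite [RHS](reindex_inj h_inj); apply: eq_bigr => y _.
rewrite value_transl -/p -/z -/(h y) [RHS]mulmxA [LHS]mulmxA; congr (_ *m _).
have EE q r : E (q * r)%g = E q *m E r by apply: repr_mxM; rewrite inE.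
have E1 : E 1%g = 1%:M by exact: repr_mx1.
rewrite -[RHS]mulmx1 -E1 -(mulgV p) EE mulmxA -[_ *m _ *m E p]mulmxA equiv.
by rewrite mulmxA -EE mulVg E1 mul1mx.
Qed.

Section Factorized.
Variables (N : nat) (V : X -> 'M[C]_(e, N)) (P : 'M[C]_N).

Lemma psd_of_kernel k : psd P -> (forall x y, k x y = V x *m P *m (V y)^t*) ->
  psd_op (of_kernel k).
Proof.
move=> pP kE f; rewrite /dotInd mulr_ge0 ?invr_ge0 ?ler0n //.
pose g := \sum_x (value_at f x)^t* *m V x.
have -> : \sum_x ((value_at f x)^t* *m value_at (of_kernel k f) x) 0 0 =
    (#|{: X}|%:R)^-1 * (g *m P *m g^t*) 0 0.
  rewrite /g adj_sum !mulmx_suml summxE mulr_sumr; apply: eq_bigr => x _.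
  rewrite of_kernelE -scalemxAr mxE; congr (_ * _); congr (fun_of_matrix _ 0 0).
  rewrite !mulmx_sumr; apply: eq_bigr => y _.
  by rewrite kE adjM trmxCK !mulmxA.
by rewrite mulr_ge0 ?invr_ge0 ?ler0n.
Qed.

(** A rank factorization of [P] makes the operator factor through a space of dimension [\rank P]. *)
Lemma rank_of_kernel k : (forall x y, k x y = V x *m P *m (V y)^t*) ->
  (D_rank (of_kernel k) <= \rank P)%N.
Proof.
move=> kE; set r := \rank P.
pose phi_fun (f : Ind E) : 'cV[C]_r := \sum_y row_base P *m (V y)^t* *m value_at f y.
have phi_lin : linear phi_fun.
  move=> a f f'; rewrite /phi_fun scaler_sumr -big_split; apply: eq_bigr => y _ /=.
  by rewrite value_at_linear mulmxDr scalemxAr.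
pose psi_fun (c : 'cV[C]_r) : Ind E :=
  section_of (fun x => (#|{: X}|%:R)^-1 *: (V x *m col_base P *m c)).
have psi_lin : linear psi_fun.
  move=> a c c'; apply: value_at_inj => x; rewrite value_at_linear !section_ofK.
  by rewrite mulmxDr -scalemxAr scalerDr !scalerA mulrC.
pose L := GRing.isLinear.Build C _ _ _ psi_fun psi_lin.
pose psi : {linear 'cV[C]_r -> Ind E} := HB.pack psi_fun L.
have : (limg (of_kernel k) <= limg (linfun psi))%VS.
  apply/subvP => _ /memv_imgP[f _ ->].
  have -> : of_kernel k f = linfun psi (phi_fun f).
    rewrite [RHS]lfunE; apply: value_at_inj => x; rewrite of_kernelE section_ofK.
    congr (_ *: _); rewrite /phi_fun mulmx_sumr; apply: eq_bigr => y _.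
    by rewrite kE -{1}(mulmx_base P) !mulmxA.
  by rewrite memv_img ?memvf.
move=> /dimvS; rewrite /D_rank => le1; apply: leq_trans le1 _.
have := leq_addl (\dim (fullv :&: lker (linfun psi))) (\dim (limg (linfun psi))).
by rewrite limg_ker_dim dimvf /dim /= muln1.
Qed.

End Factorized.
End KernelOperators.

(** * From invariant matrices to the Hecke algebra *)

Section HeckePackaging.
Local Open Scope sesquilinear_scope.
Variables (R : realType) (n m : nat).
Local Notation C := R[i].
Local Notation W := {ffun 'I_n -> bool * 'I_m}.
Local Notation A := {ffun 'I_n -> 'I_m}.
Local Notation X := 'rV['F_2]_n.

(** [permmx] reverses products, which the inverse corrects. *)
Definition word_repr (s : 'S_n) : 'M[C]_#|A| := permmx C 'I_m s^-1%g.

Fact word_mx_repr : mx_repr [set: 'S_n] word_repr.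
Proof.
split=> [|s t _ _]; apply: mentP => a b; rewrite ?pmxl !fmxE ?ment1.
  by rewrite invg1; congr (_ == _)%:R; apply/ffunP => i; rewrite ffunE perm1.
by rewrite permfM invMg.
Qed.

Definition word_mx := MxRepresentation word_mx_repr.

Fact word_mx_unitary s : word_mx s \is unitarymx.
Proof.
apply/unitarymxP; apply: mentP => a b; rewrite pmxr fmxE ment1.
by rewrite (inj_eq (@permf_inj _ _ _)).
Qed.

Definition word_module : unitary_module C n := UnitaryModule word_mx_unitary.

Definition bitsx (x : X) : {ffun 'I_n -> bool} := [ffun i => x ord0 i != 0].

Lemma bitsxD x y : bitsx (x + y) = addb (bitsx x) (bitsx y).
Proof.
apply/ffunP => i; rewrite !ffunE mxE.
by case: (x ord0 i) => [[|[|//]] ?]; case: (y ord0 i) => [[|[|//]] ?].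
Qed.

Lemma addbb0 (u : {ffun 'I_n -> bool}) : addb u u = zerob n.
Proof. by apply/ffunP => i; rewrite !ffunE addbb. Qed.

Lemma hamming_wt (x y : X) : hamming x y = wt (addb (bitsx x) (bitsx y)).
Proof.
rewrite /hamming /wt -sum1_card big_mkcond; apply: eq_bigr => i _.
rewrite !ffunE inE.
by case: (x ord0 i) => [[|[|//]] ?]; case: (y ord0 i) => [[|[|//]] ?].
Qed.

(** The Fourier transform, over the dual points, of the diagonal blocks of [P], evaluated at
    [x + y]. *)
Definition fourier_kernel (P : 'M[C]_#|W|) (x y : X) : 'M[C]_#|A| :=
  ptrace (twist R m (addb (bitsx x) (bitsx y)) *m P).

Lemma fourier_kernelE P x y a b : ment (fourier_kernel P x y) a b =
  \sum_u (chi R (addb (bitsx x) (bitsx y)) u)%:C%C * ment P (zipw u a) (zipw u b).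
Proof.
by rewrite fmxE; apply: eq_bigr => u _; rewrite dmxMl bits_zip.
Qed.

Lemma fourier_kernel_lin a P P' x y :
  fourier_kernel (P + a *: P') x y = fourier_kernel P x y + a *: fourier_kernel P' x y.
Proof.
apply: mentP => c d; rewrite mentD mentZ !fourier_kernelE mulr_sumr -big_split.
by apply: eq_bigr => u _; rewrite mentD mentZ mulrDr mulrCA.
Qed.

Lemma fourier_kernelZ a P x y : fourier_kernel (a *: P) x y = a *: fourier_kernel P x y.
Proof.
apply: mentP => c d; rewrite mentZ !fourier_kernelE mulr_sumr.
by apply: eq_bigr => u _; rewrite mentZ mulrCA.
Qed.

Lemma fourier_kernel0 P : fourier_kernel P 0 0 = ptrace P.
Proof.
apply: mentP => a b; rewrite fourier_kernelE fmxE; apply: eq_bigr => u _.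
by rewrite addbb0 chi0 mul1r.
Qed.

Lemma fourier_kernel_equiv P (p : 'S_n) (z x y : X) : inB P ->
  fourier_kernel P (z + \row_i x ord0 (p i)) (z + \row_i y ord0 (p i)) *m word_mx p
  = word_mx p *m fourier_kernel P x y.
Proof.
move=> [_ sP]; have bp (t : X) : bitsx (\row_i t ord0 (p i)) = permf p (bitsx t).
  by apply/ffunP => i; rewrite !ffunE mxE.
have e : addb (bitsx (z + \row_i x ord0 (p i))) (bitsx (z + \row_i y ord0 (p i)))
    = permf p (addb (bitsx x) (bitsx y)).
  rewrite !bitsxD !bp; apply/ffunP => i; rewrite !ffunE.
  by rewrite addbACA addbb.
apply: mentP => a b; rewrite pmxl.
rewrite -[word_mx p]trmxCK permmx_adj invgK pmxr !fourier_kernelE e.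
rewrite (reindex_inj (@permf_inj _ _ p)); apply: eq_bigr => u _.
rewrite chi_perm; congr (_ * _).
have Kp (t : A) : permf p (permf p^-1%g t) = t.
  by rewrite permfM mulgV; apply/ffunP => i; rewrite ffunE perm1.
by rewrite -[in LHS](Kp a) !zip_perm sP.
Qed.

(** The block at [x] of the unnormalized Fourier matrix; [fourier_kernel_walsh] gives the
    factorization behind positivity and the rank bound. *)
Definition walsh (x : X) : 'M[C]_(#|A|, #|W|) := \matrix_(a, w)
  ((lets (enum_val w) == enum_val a)%:R * (chi R (bitsx x) (bits (enum_val w)))%:C%C).

Lemma fourier_kernel_walsh P x y : blocked P ->
  fourier_kernel P x y = walsh x *m P *m (walsh y)^t*.
Proof.
move=> bP; apply: mentP => a b; rewrite fourier_kernelE /ment mxE sum_rank.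
have E1 w : (walsh x *m P) (enum_rank a) (enum_rank w) =
    (chi R (bitsx x) (bits w))%:C%C * ment P (zipw (bits w) a) w.
  rewrite mxE sum_rank sum_words (bigD1 (bits w)) //= [X in _ + X]big1 ?addr0 => [|u uw].
    rewrite (bigD1 a) //= [X in _ + X]big1 ?addr0 => [|c /negPf ca].
      by rewrite mxE !enum_rankK lets_zip bits_zip eqxx mul1r.
    by rewrite mxE !enum_rankK lets_zip ca !mul0r.
  by rewrite big1 // => c _; rewrite -/(ment P _ _) bP ?mulr0 // bits_zip.
under [RHS]eq_bigr do rewrite E1.
rewrite sum_words; apply: eq_bigr => u _.
rewrite (bigD1 b) //= [X in _ + X]big1 ?addr0 => [|c /negPf cb].
  rewrite !mxE !enum_rankK !bits_zip lets_zip eqxx mul1r.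
  have -> (r : R) : (r%:C%C)^* = r%:C%C by apply/CrealP/complex_realP; exists r.
  by rewrite chiD rmorphM /= mulrAC.
by rewrite !mxE !enum_rankK lets_zip cb mul0r conjC0 mulr0.
Qed.

Hypothesis n0 : (0 < n)%N.

Lemma t_zonal_chi (x y : X) :
  t_zonal C x y = n%:R^-1 * \sum_i (chi R (addb (bitsx x) (bitsx y)) (unitb i))%:C%C.
Proof.
rewrite -rmorph_sum; under eq_bigr do rewrite chiC.
rewrite sum_chi_unit /t_zonal hamming_wt rmorphB /= !rmorph_nat mulrBr mulVf.
  by rewrite mulrC.
by rewrite pnatr_eq0 -lt0n.
Qed.

(** [n t_n] is the sum of the characters of the unit vectors, and multiplying by a character
    translates the dual variable, here by one bit flip. *)
Lemma t_zonal_kernel P x y :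
  t_zonal C x y *: fourier_kernel P x y = n%:R^-1 *: fourier_kernel (flip_sum P) x y.
Proof.
rewrite t_zonal_chi -scalerA; congr (_ *: _); apply: mentP => a b.
rewrite mentZ !fourier_kernelE mulr_suml.
under [RHS]eq_bigr do rewrite flip_sumE mulr_sumr.
rewrite [RHS]exchange_big; apply: eq_bigr => i _ /=.
rewrite [RHS](reindex_inj (@addb_inj _ (unitb i))) mulr_sumr; apply: eq_bigr => u _.
have sh c : shiftw (unitb i) (zipw (addb (unitb i) u) c) = zipw u c.
  by rewrite /shiftw bits_zip lets_zip addbb_ffun.
by rewrite !sh mulrA -rmorphM chiC [chi R _ u]chiC -chiD chiC.
Qed.

Lemma fourier_realization (P : 'M[C]_#|W|) (Lam : R) :
  psd P -> inB P -> ptrace P != 0 ->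
  psd (flip_sum P - (n%:R * Lam)%:C%C *: P) ->
  exists (E : unitary_module C n) (Omega : {set IrrB C n}) (rho : 'End(Ind E)),
    [/\ rho != 0, psd_op rho, hecke_cut Omega rho &
        psd_op (Theta Omega rho - Lam%:C%C *: rho)] /\
    (D_rank rho <= \rank P)%N /\ r_rank rho = \rank (ptrace P).
Proof.
move=> pP BP P0 pS; pose k : X -> X -> 'M[C]_(um_dim word_module) := fourier_kernel P.
have kE x y : k x y = walsh x *m P *m (walsh y)^t* := fourier_kernel_walsh x y BP.1.
exists word_module, [set: IrrB C n]%SET, (of_kernel k); split; last split.
- split.
  + apply: contra_neq P0 => k0; rewrite -fourier_kernel0 -[fourier_kernel P]/k.
    rewrite -(of_kernelK k) k0; apply/matrixP => i j; rewrite !mxE lfunE /=.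
    by rewrite /value_at /= ffunE mxE mulr0.
  + exact: psd_of_kernel pP kE.
  + exists (of_kernel k); last by rewrite z_proj_setT comp_lfun1r comp_lfun1l.
    by apply: hecke_of_kernel => p z x y; exact: fourier_kernel_equiv.
  rewrite /Theta z_proj_setT comp_lfun1r comp_lfun1l schur_of_kernel -scaleNr of_kernel_lin.
  (* The Fourier transform of this matrix is the kernel of [Theta Omega rho - Lam rho], since [t_n]
     corresponds to [flip_sum / n]. *)
  have pQ : psd (n%:R^-1 *: (flip_sum P - (n%:R * Lam)%:C%C *: P)).
    by apply: psdZ => //; rewrite invr_ge0 ler0n.
  apply: (@psd_of_kernel C n word_module #|{: W}| walsh _ _ pQ) => x y; rewrite /k.
  rewrite -fourier_kernel_walsh; last first.
    by rewrite -scaleNr; exact: (inBZ _ (inBD (inB_flip BP) (inBZ _ BP))).1.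
  rewrite -scaleNr fourier_kernelZ fourier_kernel_lin scalerDr scalerA.
  rewrite t_zonal_kernel; congr (_ + _ *: _).
  rewrite mulrN rmorphM /= rmorph_nat mulrA mulVf ?mul1r //.
  by rewrite pnatr_eq0 -lt0n.
- exact: rank_of_kernel kE.
by rewrite /r_rank of_kernelK /k fourier_kernel0.
Qed.

End HeckePackaging.

(** * Asymptotics *)

Section Asymptotics.
Variable R : realType.

(** The scale of all errors: with [s = n^(1/4)] and [eps = 1 / s], the Chebyshev denominator
    [n eps^2] is [s^2]. *)
Definition fourthroot (n : nat) : R := Num.sqrt (Num.sqrt n%:R).

Lemma fourthroot4 n : fourthroot n ^+ 4 = n%:R.
Proof.
by rewrite (exprM _ 2 2) /fourthroot !sqr_sqrtr ?sqrtr_ge0 ?ler0n.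
Qed.

Lemma fourthroot_ge0 n : 0 <= fourthroot n.
Proof. exact: sqrtr_ge0. Qed.

Lemma fourthroot_ge1 n : (0 < n)%N -> 1 <= fourthroot n.
Proof.
move=> n0; rewrite -(@ler_pXn2r _ 4) ?nnegrE ?fourthroot_ge0 //.
by rewrite fourthroot4 expr1n ler1n.
Qed.

Lemma fourthroot_infty (M : R) : \forall n \near \oo%classic, M < fourthroot n.
Proof.
have [M0|M0] := ltP M 0; first by apply: nearW => n; apply: lt_le_trans (fourthroot_ge0 n).
near=> n; rewrite -(@ltr_pXn2r _ 4) ?nnegrE ?fourthroot_ge0 // fourthroot4.
by near: n; exact: nbhs_infty_gtr.
Unshelve. all: by end_near.
Qed.

(** Writing [n + 1] as a square, [ln (n + 1) <= 2 sqrt (n + 1) <= 4 s^2 <= 4 s^3], which is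
    [n * 4 / s]. *)
Lemma ln_succ_le n : (0 < n)%N -> ln n.+1%:R <= n%:R * (4 / fourthroot n) :> R.
Proof.
move=> n0; set s := fourthroot n.
have s1 : 1 <= s := fourthroot_ge1 n0.
have s0 : 0 < s by apply: lt_le_trans s1.
have n1 : (n.+1%:R : R) = Num.sqrt n.+1%:R ^+ 2 by rewrite sqr_sqrtr.
have r0 : 0 < Num.sqrt (n.+1%:R : R) by rewrite sqrtr_gt0 ltr0n.
have le2 : Num.sqrt (n.+1%:R : R) <= 2 * s ^+ 2.
  rewrite -(@ler_pXn2r _ 2) ?nnegrE ?ltW ?mulr_gt0 ?exprn_gt0 // -n1.
  rewrite exprMn -exprM fourthroot4 -natr1.
  have : 1 <= n%:R :> R by rewrite ler1n.
  by move=> h; rewrite expr2; lra.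
rewrite n1 lnXn // -[_ *+ 2]mulr_natl.
apply: le_trans (_ : 2 * (2 * s ^+ 2) <= _).
  by rewrite ler_pM2l // (le_trans _ le2) // ltW // ln_sublinear.
rewrite -(fourthroot4 n) -/s (_ : s ^+ 4 * (4 / s) = 4 * s ^+ 3); last by field; rewrite gt_eqF.
rewrite mulrA -natrM ler_pM2l // [leRHS]exprS ler_peMl // exprn_ge0 // ltW //.
Qed.

Lemma limn_esup_le (u : nat -> R) (l c : R) : 0 <= c ->
  (forall n, (0 < n)%N -> c < fourthroot n -> u n <= l + c / fourthroot n) ->
  (limn_esup (fun n => (u n)%:E) <= l%:E)%E.
Proof.
move=> c0 ul; apply/lee_addgt0Pr => e e0.
rewrite /limn_esup limf_esupE; apply: le_trans (ereal_inf_lbound _) _.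
  exists [set n | (0 < n)%N /\ Num.max c (c / e) < fourthroot n]%classic => //.
  near=> n; split; first by near: n; exact: nbhs_infty_gt.
  by near: n; exact: fourthroot_infty.
apply: ge_ereal_sup => y [n [n0]]; rewrite gt_max => /andP[cn cen] <-{y}.
rewrite -EFinD lee_fin; apply: le_trans (ul n n0 cn) _; rewrite lerD2l.
have s0 : 0 < fourthroot n by apply: lt_le_trans (fourthroot_ge1 n0).
by rewrite ler_pdivrMr // mulrC -ler_pdivrMr // ltW.
Unshelve. all: by end_near.
Qed.

Lemma limn_einf_ge (u : nat -> R) (l c : R) : 0 <= c ->
  (forall n, (0 < n)%N -> c < fourthroot n -> l - c / fourthroot n <= u n) ->
  (l%:E <= limn_einf (fun n => (u n)%:E))%E.
Proof.
move=> c0 ul; rewrite /limn_einf leeNr -EFinN.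
apply: (@limn_esup_le (fun n => - u n) (- l) c) => // n n0 cn.
by rewrite lerNl opprD opprK; exact: ul.
Qed.

Lemma ln2_gt0 : 0 < ln 2 :> R.
Proof. by rewrite ln_gt0 // ltr1n. Qed.

End Asymptotics.

(** * Choice of parameters for each length *)

Section HornSequence.
Variables (R : realType) (m : nat) (K L : 'M[R[i]]_m).
Hypotheses (pK : psd K) (pL : psd L) (trKL : \tr (K + L) = 1).
Local Notation W n := {ffun 'I_n -> bool * 'I_m}.
Local Notation J := (bool * 'I_m)%type.

Lemma horn_sequence : exists2 c : R, 0 <= c &
  forall n, (0 < n)%N -> exists (Lam : R) (P : 'M[R[i]]_#|{: W n}|),
  [/\ psd P, inB P, psd (flip_sum P - (n%:R * Lam)%:C%C *: P),
      (0 < \rank (ptrace P))%N &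
      c < fourthroot R n ->
      Gam K L - c / fourthroot R n <= Lam /\
      log2 ((\rank P)%:R / (\rank (ptrace P))%:R) / n%:R
        <= Phi K L + c / fourthroot R n].
Proof.
pose V1 := varentropy (pair_law K L); pose V2 := varentropy (sum_law K L).
have V10 : 0 <= V1 by apply: varentropy_ge0; exact: pair_law_ge0.
have V20 : 0 <= V2 by apply: varentropy_ge0; exact: sum_law_ge0.
(* The two variances come from Chebyshev bounds; the 1 pays for the rank term [tr1]. *)
pose V := V1 + V2 + 1; have V0 : 0 < V by rewrite /V; lra.
pose q := #|{: J * J}|; have l2 := ln2_gt0 R.
(* [1 + 4 V] covers the loss in [Gam] and forces [eta < 1]. In the exponent, 2 comes from the two
   uses of [eps], [4 (q + 1)] from [q + 1] factors [n + 1], and [ln 2] from the change of base. *)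
pose c := 1 + 4 * V + (2 + 4 * (q%:R + 1)) / ln 2.
have c2 : 0 <= (2 + 4 * (q%:R + 1)) / ln 2 :> R.
  by rewrite divr_ge0 // ?(ltW l2) // addr_ge0 // mulr_ge0 // addr_ge0.
have c0 : 0 <= c by rewrite /c; lra.
exists c => // n n0; set s := fourthroot R n.
have s1 : 1 <= s := fourthroot_ge1 R n0.
have s0 : 0 < s by apply: lt_le_trans s1.
have s4 : s ^+ 4 = n%:R := fourthroot4 R n.
have nR : 0 < n%:R :> R by rewrite ltr0n.
have [sc|cs] := leP s c.
  (* For small [n] the bounds are conditional on a false inequality, and the identity with [Lam = 0]
     serves as placeholder; [m] is positive because the trace is 1. *)
  have m0 : (0 < m)%N.
    rewrite lt0n; apply/eqP => m0; have /eqP := trKL; rewrite /mxtrace big1.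
      by rewrite eq_sym oner_eq0.
    by move=> i; have := ltn_ord i; rewrite {2}m0.
  pose a : {ffun 'I_n -> 'I_m} := [ffun=> Ordinal m0].
  exists 0, 1%:M; rewrite mulr0 scale0r subr0; split.
  - exact: psd1.
  - exact: inB1.
  - by apply: psd_flip; exact: psd1.
  - rewrite lt0n mxrank_eq0; apply/eqP => /(congr1 (fun Y => ment Y a a)).
    rewrite fmxE ment0 (eq_bigr (fun=> 1)) => [/eqP|u _]; last by rewrite ment1 eqxx.
    rewrite sumr_const pnatr_eq0 -leqn0 leqNgt => /negP; apply.
    by apply/card_gt0P; exists [ffun=> true].
  - by [].
pose eta := 2 * V / s ^+ 2.
(* The rank up to which a projection captures at most [1 / s^2] from eigenvalues below the
   threshold. *)
pose x := expR (n%:R * (entropy (sum_law K L) - s^-1)) / s ^+ 2.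
have x0 : 0 < x by rewrite divr_gt0 ?expR_gt0 ?exprn_gt0.
have Vs : 2 * V < s by apply: le_lt_trans cs; rewrite /c; lra.
have eta1 : eta < 1.
  rewrite /eta ltr_pdivrMr ?exprn_gt0 // mul1r; apply: lt_le_trans Vs _.
  by rewrite expr2 ler_peMl // ltW.
have neps : n%:R * s^-1 ^+ 2 = s ^+ 2 by rewrite -s4; field; rewrite gt_eqF.
have si0 : 0 < s^-1 by rewrite invr_gt0.
have small : 2 * (V1 / (n%:R * s^-1 ^+ 2) + (V2 / (n%:R * s^-1 ^+ 2)
      + (Num.trunc x)%:R * expR (- (n%:R * (entropy (sum_law K L) - s^-1))))) <= eta.
  have tr1 : (Num.trunc x)%:R * expR (- (n%:R * (entropy (sum_law K L) - s^-1)))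
      <= 1 / s ^+ 2.
    apply: le_trans (_ : x * expR (- (n%:R * (entropy (sum_law K L) - s^-1))) <= _).
      by rewrite ler_wpM2r ?expR_ge0 //; have /andP[] := truncn_itv (ltW x0).
    rewrite /x expRN mulrAC divff ?mul1r ?div1r // gt_eqF ?expR_gt0 //.
  rewrite neps /eta -mulrA ler_pM2l // /V !mulrDl addrA lerD2l //.
have [Lam [P [GL pP BP pS [Nr Dr]]]] := horn_family pK pL trKL n0 si0 si0 eta1 small.
exists Lam, P; split=> //; first exact: leq_ltn_trans Nr.
move=> _; split.
  apply: le_trans GL; rewrite lerB // /eta.
  have e1 : 2 * V / s ^+ 2 / s^-1 = 2 * V / s by field; rewrite gt_eqF.
  have e2 : 2 * V / s ^+ 2 <= 2 * V / s.
    rewrite ler_pM2l ?mulr_gt0 // lef_pV2 ?posrE ?exprn_gt0 //.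
    by rewrite expr2 ler_peMl // ltW.
  rewrite e1; apply: le_trans (_ : s^-1 + 2 * V / s + 2 * V / s <= _); first by rewrite lerD2l.
  rewrite (_ : s^-1 + 2 * V / s + 2 * V / s = (1 + 4 * V) / s); last by ring.
  by rewrite ler_pM2r // /c; lra.
set D := \rank P in Dr *; set r := \rank _ in Nr *.
have r0 : (0 < r)%N by apply: leq_ltn_trans Nr.
have xr : x <= r%:R.
  by apply: ltW; apply: lt_le_trans (truncnS_gt x) _; rewrite ler_nat.
have D0 : (0 < D)%N.
  rewrite lt0n; apply: contraL r0 => /eqP D0; rewrite -leqNgt leqn0.
  have P0 : P = 0 by apply/eqP; rewrite -mxrank_eq0 -/D D0.
  rewrite /r mxrank_eq0 P0; apply/eqP; apply: mentP => a b; rewrite fmxE ment0 big1 // => u _.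
  by rewrite ment0.
have rR : 0 < r%:R :> R by rewrite ltr0n.
have DR : 0 < D%:R :> R by rewrite ltr0n.
have h1 := entropy_pair pK pL; have h2 := entropy_sum pK pL.
have cardT : #|{: {ffun J * J -> 'I_n.+1}}| = (n.+1 ^ q)%N by rewrite card_ffun card_ord.
have lnD : ln D%:R <= q%:R * ln n.+1%:R + n%:R * (entropy (pair_law K L) + s^-1).
  have : ln D%:R <= ln ((n.+1 ^ q)%N%:R * expR (n%:R * (entropy (pair_law K L) + s^-1))).
    by rewrite ler_ln ?posrE ?mulr_gt0 ?expR_gt0 ?ltr0n ?expn_gt0 // -cardT.
  rewrite lnM ?posrE ?expR_gt0 ?ltr0n ?expn_gt0 // expRK natrX lnXn ?ltr0n //.
  by rewrite -[_ *+ q]mulr_natl.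
(* The denominator [s^2] of [x] costs at most [ln (n + 1)], as [s^2 <= s^4 = n]. *)
have lnr : n%:R * (entropy (sum_law K L) - s^-1) - ln n.+1%:R <= ln r%:R.
  apply: le_trans (_ : ln x <= _); last by rewrite ler_ln ?posrE.
  rewrite /x ln_div ?posrE ?expR_gt0 ?exprn_gt0 // expRK lerB //.
  rewrite ler_ln ?posrE ?exprn_gt0 ?ltr0n //.
  apply: le_trans (_ : s ^+ 4 <= _); first by rewrite ler_weXn2l.
  by rewrite s4 ler_nat.
have lnn := ln_succ_le R n0; rewrite -/s in lnn.
rewrite /log2 ln_div ?posrE // ler_pdivrMr // ler_pdivrMr //.
apply: le_trans (_ : n%:R * ((entropy (pair_law K L) - entropy (sum_law K L)
   + (2 + 4 * (q%:R + 1)) / s)) <= _).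
  apply: le_trans (lerB lnD lnr) _.
  have := ler_wpM2l (_ : 0 <= q%:R + 1 :> R) lnn.
  rewrite addr_ge0 // => /(_ isT) h; set ls := ln n.+1%:R in h *.
  apply: le_trans (_ : (q%:R + 1) * ls + n%:R *
     (entropy (pair_law K L) - entropy (sum_law K L) + 2 / s) <= _).
    by rewrite le_eqVlt; apply/orP; left; apply/eqP; field; rewrite gt_eqF.
  apply: le_trans (lerD h (lexx _)) _.
  by rewrite le_eqVlt; apply/orP; left; apply/eqP; field; rewrite gt_eqF.
have cl : 2 + 4 * (q%:R + 1) <= c * ln 2.
  by rewrite -ler_pdivrMr // /c lerDr; lra.
apply: le_trans (_ : n%:R * ((Ent K + Ent L) * ln 2 - Ent (K + L) * ln 2 + c * ln 2 / s) <= _).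
  by rewrite h1 h2 ler_pM2l // lerD2l ler_pM2r.
by rewrite /Phi le_eqVlt; apply/orP; left; apply/eqP; ring.
Qed.

End HornSequence.

Lemma D_rank_gt0 (C : numClosedFieldType) n (E : unitary_module C n) (rho : 'End(Ind E)) :
  rho != 0 -> (0 < D_rank rho)%N.
Proof.
rewrite lt0n; apply: contra; rewrite /D_rank dimv_eq0 => /eqP rho0.
apply/eqP/lfunP => f; rewrite lfunE /=; apply/eqP.
by rewrite -memv0 -rho0 memv_img ?memvf.
Qed.

Lemma log2_le (R : realType) (x y : R) : 0 < x -> x <= y -> log2 x <= log2 y.
Proof.
move=> x0 xy; rewrite /log2 ler_pM2r ?invr_gt0 ?ln2_gt0 //.
by rewrite ler_ln ?posrE // (lt_le_trans x0).
Qed.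

Lemma LP_gt0 (R : realType) n d : 0 < LP R n d.
Proof.
have [A [A0 Age _ _] ->] := LP_attained R n d.
by rewrite (bigD1 ord0) //= A0 ltr_pwDl // sumr_ge0.
Qed.

Lemma horn_realization (R : realType) m (K L : 'M[R[i]]_m) : horn_pair K L ->
  exists (E : forall n, unitary_module R[i] n) (Omega : forall n, {set IrrB R[i] n})
    (rho : forall n, 'End(Ind (E n))) (Lam : nat -> R),
    asymptotic_realization K L Omega rho Lam.
Proof.
move=> [[_ pK] [_ pL] trKL]; have [c c0 seq] := horn_sequence pK pL trKL.
(* Bundling the dependent data of each [n] lets a single choice produce all four sequences. *)
pose T n := {E : unitary_module R[i] n & ({set IrrB R[i] n} * 'End(Ind E) * R)%type}.
pose rho n (x : T n) : 'End(Ind (projT1 x)) := (projT2 x).1.2.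
pose Om n (x : T n) : {set IrrB R[i] n} := (projT2 x).1.1.
pose Lm n (x : T n) : R := (projT2 x).2.
pose good n (x : T n) := (0 < n)%N ->
  [/\ rho n x != 0, psd_op (rho n x), hecke_cut (Om n x) (rho n x) &
      psd_op (Theta (Om n x) (rho n x) - (Lm n x)%:C%C *: rho n x)] /\
  (c < fourthroot R n -> Gam K L - c / fourthroot R n <= Lm n x /\
     log2 ((D_rank (rho n x))%:R / (r_rank (rho n x))%:R) / n%:R
       <= Phi K L + c / fourthroot R n).
have ex n : exists x : T n, good n x.
  have [->|n0] := posnP n; first by exists (existT _ (word_module R 0 m) (finset.set0, 0, 0)).
  have [Lam [P [pP BP pS r0 bound]]] := seq n n0.
  have P0 : ptrace P != 0 by rewrite -mxrank_eq0 -lt0n.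
  have [Ew [Ow [rh [ok [rkD rkr]]]]] := fourier_realization n0 pP BP P0 pS.
  exists (existT _ Ew (Ow, rh, Lam)) => _; split=> // cs.
  have [GL DL] := bound cs; split=> //; apply: le_trans DL.
  have [rho0 _ _ _] := ok; rewrite /rho /= rkr ler_pM2r ?invr_gt0 ?ltr0n //.
  have rR : 0 < (\rank (ptrace P))%:R^-1 :> R by rewrite invr_gt0 ltr0n.
  apply: log2_le; first by rewrite mulr_gt0 // ltr0n D_rank_gt0.
  by rewrite ler_pM2r // ler_nat.
pose f n := projT1 (cid (ex n)); have fP n : good n (f n) := projT2 (cid (ex n)).
exists (fun n => projT1 (f n)), (fun n => Om n (f n)), (fun n => rho n (f n)),
  (fun n => Lm n (f n)); split.
- by move=> n n0; have [] := fP n n0.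
- apply: (limn_einf_ge c0) => n n0 cs; have [_ h] := fP n n0; by case: (h cs).
- apply: (limn_esup_le c0) => n n0 cs; have [_ h] := fP n n0; by case: (h cs).
Qed.

Lemma delsarte_exponent (R : realType) m (K L : 'M[R[i]]_m) (delta : R) :
  horn_pair K L -> 0 < delta -> delta < 1 / 2 -> 1 - 2 * delta < Gam K L ->
  (R_D delta <= (Phi K L)%:E)%E.
Proof.
move=> [[_ pK] [_ pL] trKL] d0 d1 gap; have [c c0 seq] := horn_sequence pK pL trKL.
pose g := Gam K L - (1 - 2 * delta); have g0 : 0 < g by rewrite subr_gt0.
(* [2 c / g] keeps [Lam] above [1 - 2 delta] by at least [g / 2]; the other entry absorbs the
   constant factor [8 / g] of the program bound. *)
pose c' := Num.max (2 * c / g) (c + `|log2 (8 / g)|).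
have cc' : c <= c' by rewrite le_max; apply/orP; right; rewrite lerDl.
apply: (@limn_esup_le R _ (Phi K L) c') => [|n n0 cs]; first exact: le_trans cc'.
have s1 := fourthroot_ge1 R n0; set s := fourthroot R n in cs s1 *.
have s0 : 0 < s by apply: lt_le_trans s1.
have nR : 0 < n%:R :> R by rewrite ltr0n.
have [Lam [P [pP BP pS r0 /(_ (le_lt_trans cc' cs)) [GL DL]]]] := seq n n0.
set d := Num.ceil _; have dge : delta * n%:R <= d%:~R := ceil_ge _.
have dlt : d%:~R < delta * n%:R + 1.
  by have /andP[] := ceil_itv (delta * n%:R); rewrite -/d intrB ltrBlDr.
have Lg : g / 2 <= Lam - (1 - 2 * delta).
  have : c / s <= g / 2.
    rewrite ler_pdivrMr // mulrC mulrA ler_pdivlMr // -ler_pdivrMr //.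
    have : 2 * c / g <= c' by rewrite le_max lexx.
    by move=> h; apply: le_trans (ltW cs); apply: le_trans h; rewrite [c * 2]mulrC.
  by move=> h; move: GL; rewrite -/s /g in h *; lra.
have gapn : n%:R * (g / 2) <= n%:R * Lam - (n%:R - 2 * d%:~R).
  have : n%:R * (g / 2) <= n%:R * (Lam - (1 - 2 * delta)) by rewrite ler_pM2l.
  by lra.
have gn0 : 0 < n%:R * (g / 2) by rewrite mulr_gt0 // divr_gt0.
have LP1 : LP R n d <= 8 / g * ((\rank P)%:R / (\rank (ptrace P))%:R).
  apply: le_trans (LP_le (d := d) pP BP pS r0 _) _.
    by rewrite -subr_gt0; apply: lt_le_trans gapn.
  rewrite ler_wpM2r ?divr_ge0 ?ler0n // ler_pdivrMr; last exact: lt_le_trans gapn.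
  apply: le_trans (_ : 8 / g * (n%:R * (g / 2)) <= _).
    (* The numerator [2 d] is at most [2 (delta n + 1) <= n + 2 <= 4 n], and the gap is at least
       [n g / 2]. *)
    have -> : 8 / g * (n%:R * (g / 2)) = 4 * n%:R by field; rewrite gt_eqF.
    have n1 : 1 <= n%:R :> R by rewrite ler1n.
    have : delta * n%:R <= n%:R / 2 by rewrite mulrC ler_pM2l // ltW // -[2^-1]mul1r.
    by lra.
  by rewrite ler_pM2l // divr_gt0.
have q0 : 0 < (\rank P)%:R / (\rank (ptrace P))%:R :> R.
  have := lt_le_trans (LP_gt0 R n d) LP1; rewrite pmulr_rgt0 // divr_gt0 //.
have lM : log2 (8 / g * ((\rank P)%:R / (\rank (ptrace P))%:R))
    = log2 (8 / g) + log2 ((\rank P)%:R / (\rank (ptrace P))%:R).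
  by rewrite /log2 -mulrDl -lnM ?posrE // divr_gt0.
apply: le_trans (_ : (log2 (8 / g) + log2 ((\rank P)%:R / (\rank (ptrace P))%:R)) / n%:R <= _).
  by rewrite ler_pM2r ?invr_gt0 // -lM log2_le // LP_gt0.
rewrite mulrDl; apply: le_trans (lerD (lexx _) DL) _; rewrite addrCA lerD2l -/s.
apply: le_trans (_ : `|log2 (8 / g)| / s + c / s <= _).
  rewrite lerD2r; apply: le_trans (_ : `|log2 (8 / g)| / n%:R <= _).
    by rewrite ler_pM2r ?invr_gt0 // ler_norm.
  rewrite ler_wpM2l // lef_pV2 ?posrE // -(fourthroot4 R n) -/s.
  by rewrite exprS ler_peMr ?(ltW s0) // exprn_ege1.
by rewrite -mulrDl ler_pM2r ?invr_gt0 // addrC le_max lexx orbT.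
Qed.

Theorem theorem2p20 (R : realType) (m : nat) (K L : 'M[R[i]]_m)
    (hm : (0 < m)%N) (hKL : horn_pair K L) :
  (exists (E : forall n, unitary_module R[i] n)
          (Omega : forall n, {set IrrB R[i] n})
          (rho : forall n, 'End(Ind (E n))) (Lam : nat -> R),
     asymptotic_realization K L Omega rho Lam)
  /\ (forall delta : R, 0 < delta -> delta < 1 / 2 ->
        1 - 2 * delta < Gam K L ->
        (R_D delta <= (Phi K L)%:E)%E).
Proof.
split; first exact: horn_realization.
by move=> delta; exact: delsarte_exponent.
Qed.
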